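(* Let $u\in H^{\frac12}(\mathbb{S}^1,\mathbb{R}^m)$ and let $\tilde u$ be its harmonic extension in $D^2$. Then the following statements are equivalent: 1. $u$ is a stationary point of the half Dirichlet energy; 2. for any $k\in\mathbb{N}_{>0}$, $\displaystyle\sum_{\substack{a,b\in\mathbb{N}_{>0} \\ a+b=k}}a\,\widehat u(a)\cdot_{\mathbb{C}^m}b\,\widehat u(b)=0$; 3. $\frac1r|\partial_\theta\tilde u|=|\partial_r\tilde u|$ in $D^2$; 4. $\partial_\theta\tilde u\cdot\partial_r\tilde u=0$ in $D^2$. In particular, $u$ is a stationary point of the half Dirichlet energy if and only if $\tilde u$ is conformal in $D^2$.
   Context: $m\ge1$ is an integer. $\mathbb{S}^1=\mathbb{R}/2\pi\mathbb{Z}$, identified with $\partial D^2$ ($D^2$ the unit disc in $\mathbb{R}^2$) via $x\mapsto e^{ix}$; $\widehat f(k)=\frac1{2\pi}\langle f,e^{-ik\cdot}\rangle$; $(-\Delta)^s$ is the Fourier multiplier $|k|^{2s}$; $H^{\frac12}(\mathbb{S}^1)$ is the space of distributions $f$ with $\sum_{k\in\mathbb{Z}}(1+k^2)^{\frac12}|\widehat f(k)|^2<\infty$. $z\cdot_{\mathbb{C}^m}w=\sum_jz_jw_j$ is the complex-bilinear product on $\mathbb{C}^m$. The half Dirichlet energy is $E(u)=\int_{\mathbb{S}^1}|(-\Delta)^{\frac14}u(x)|^2dx$, and $u$ is a stationary point of $E$ if for every vector field $X\in C^1(\mathbb{S}^1,\mathbb{R})$, $\frac{d}{dt}\big|_{t=0}E\big(u(x+tX(x))\big)=0$.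 The harmonic extension is $\tilde u(re^{i\theta})=\sum_{k\in\mathbb{Z}}r^{|k|}\widehat u(k)e^{ik\theta}$, $0\le r<1$, and $(r,\theta)$ are polar coordinates. A differentiable map $\phi$ between Riemannian manifolds $(\mathscr{M},g)$ and $(\mathscr{N},h)$ is called conformal if for any $p\in\mathscr{M}$ and any $X,Y\in T_p\mathscr{M}$, $h(d\phi_pX,d\phi_pY)=e^{2\lambda(p)}g(X,Y)$ for some $\lambda(p)\in\mathbb{R}$; here it is applied to $\tilde u:D^2\to\mathbb{R}^m$ with the Euclidean metrics.
   Formalization: In the final sentence ''conformal'' allows a vanishing factor e^{2λ(p)} (λ(p) = −∞), since constant u is stationary but not strictly conformal; for the literal definition it is proved that ũ is conformal iff u is stationary and dũ is injective at every point. *)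

(* Defs.v *)
From HB Require Import structures.
From mathcomp Require Export all_boot all_order all_algebra.
From mathcomp Require Export complex.
From mathcomp Require Import zify.
From mathcomp Require Export all_classical all_reals all_analysis.

Set Implicit Arguments.
Unset Strict Implicit.
Unset Printing Implicit Defensive.

Export Order.TTheory GRing.Theory Num.Theory.
Export numFieldNormedType.Exports.

Local Open Scope classical_set_scope.
Local Open Scope ring_scope.
Local Open Scope complex_scope.

(* On K = R this is the Euclidean inner product; on K = R[i] it is the
   bilinear (not Hermitian) product of C^m. *)
Definition dot (K : pzSemiRingType) (m : nat) (v w : 'rV[K]_m) : K :=
  \sum_(j < m) v 0 j * w 0 j.

(* The library norm on row vectors is the sup norm. *)
Definition enorm (R : realType) (m : nat) (v : 'rV[R]_m) : R :=
  Num.sqrt (dot v v).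

Section Circle.
Variables (R : realType) (m : nat).
Implicit Types (v w : R -> 'rV[R]_m) (k : int).

Definition circle_itv : set R := `[0, 2 * pi].

Definition expi (t : R) : R[i] := cos t +i* sin t.

Definition circle_integral (f : R -> R[i]) : R[i] :=
  (\int[lebesgue_measure]_(x in circle_itv) complex.Re (f x)) +i*
  (\int[lebesgue_measure]_(x in circle_itv) complex.Im (f x)).

(* Functions on the circle R / 2 pi Z are 2 pi-periodic functions on R.
   Elements of L^2 are represented by everywhere defined functions; all the
   notions below are insensitive to the choice of the representative (for the
   inner variations of u, because x |-> x + t X(x) is bi-Lipschitz for t near
   0). *)
Definition L2circle v : Prop :=
  [/\ periodic v (2 * pi),
      forall j, measurable_fun [set: R] (fun x => v x 0 j) &
      forall j, lebesgue_measure.-integrable circle_itv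
                  (fun x => (v x 0 j ^+ 2)%:E)].

Definition fourier v k : 'rV[R[i]]_m :=
  \row_j (((2 * pi)^-1)%:C *
          circle_integral (fun x => (v x 0 j)%:C * expi (- (k%:~R * x)))).

Definition sqnormC (z : 'rV[R[i]]_m) : R :=
  \sum_(j < m) (complex.Re (z 0 j) ^+ 2 + complex.Im (z 0 j) ^+ 2).

(* Distributions f with sum_k (1 + k^2)^(1/2) |fourier f k|^2 < oo are L^2
   functions, hence the first conjunct. *)
Definition H12 v : Prop :=
  L2circle v /\
  (\esum_(k in [set: int])
     (((1 + k%:~R ^+ 2) `^ (2^-1) * sqnormC (fourier v k))%:E) < +oo)%E.

(* w represents the image of v under the Fourier multiplier |k|^(2s), as an
   L^2 function.  Note that 0 `^ a = 0 for a != 0. *)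
Definition is_fracLap (s : R) v w : Prop :=
  L2circle w /\
  forall k, fourier w k = (`|k%:~R| `^ (2 * s))%:C *: fourier v k.

(* Unique up to a null set when it exists, as it does for v in H12 and
   s = 1/4; equal to 0 if there is no such L^2 function. *)
Definition fracLap (s : R) v : R -> 'rV[R]_m :=
  xget (cst 0) [set w | is_fracLap s v w].

Definition half_energy v : R :=
  \int[lebesgue_measure]_(x in circle_itv) enorm (fracLap (4^-1) v x) ^+ 2.

Definition C1_circle (X : R -> R) : Prop :=
  [/\ periodic X (2 * pi), forall x, derivable X x 1 & continuous (derive1 X)].

Definition half_stationary v : Prop :=
  forall X : R -> R, C1_circle X ->
    is_derive (0 : R) (1 : R)
      (fun t : R => half_energy (fun x => v (x + t * X x))) 0.

Definition polar (r t : R) : 'rV[R]_2 :=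
  \row_i (if i == 0 then r * cos t else r * sin t).

Definition disc : set 'rV[R]_2 := [set p | dot p p < 1].

Definition complex_of (p : 'rV[R]_2) : R[i] := p 0 0 +i* p 0 1.

(* Value at p = r e^(i t) of the partial sum over |k| <= n, with r = `|z| and
   e^(i t) = z / `|z| (see harm_ext_polar). At z = 0 only the term k = 0
   remains. *)
Definition harm_partial v (p : 'rV[R]_2) (n : nat) : 'rV[R[i]]_m :=
  let z := complex_of p in
  \sum_(i < n.*2.+1) let k := i%:Z - n%:Z in
    (`|z| ^+ `|k|%N * (z / `|z|) ^ k) *: fourier v k.

(* As v is real valued, the partial sums are real (see harm_partial_real). *)
Definition harm_ext v (p : 'rV[R]_2) : 'rV[R]_m :=
  \row_j limn (fun n => complex.Re (harm_partial v p n 0 j)).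

Definition dtheta (phi : 'rV[R]_2 -> 'rV[R]_m) (r t : R) : 'rV[R]_m :=
  derive1 (fun s : R => phi (polar r s)) t.

Definition dradial (phi : 'rV[R]_2 -> 'rV[R]_m) (r t : R) : 'rV[R]_m :=
  derive1 (fun s : R => phi (polar s t)) r.

End Circle.

Section Conformal.
Variables (R : realType) (n m : nat).
Implicit Types (D : set 'rV[R]_n) (phi : 'rV[R]_n -> 'rV[R]_m).

Definition conformal D phi : Prop :=
  forall p, D p -> differentiable phi p /\
    exists lambda : R, forall X Y : 'rV[R]_n,
      dot ('d phi p X) ('d phi p Y) = expR (2 * lambda) * dot X Y.

(* Same, allowing lambda p = -oo, i.e. the conformal factor e^(2 lambda) may
   vanish (branch points, constant maps). *)
Definition weakly_conformal D phi : Prop :=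
  forall p, D p -> differentiable phi p /\
    exists2 lambda : \bar R, (lambda < +oo)%E & forall X Y : 'rV[R]_n,
      ((dot ('d phi p X) ('d phi p Y))%:E =
        expeR (2%:E * lambda) * (dot X Y)%:E)%E.

Definition immersed D phi : Prop :=
  forall p, D p -> injective ('d phi p).

End Conformal.

Lemma expiD (R : realType) (a b : R) : expi (a + b) = expi a * expi b.
Proof.
rewrite /expi cosD sinD; apply/eqP.
by rewrite eq_complex /= !eqxx /= addrC.
Qed.

Lemma expiN (R : realType) (t : R) : expi (- t) = (expi t)^*%C.
Proof. by rewrite /expi cosN sinN. Qed.

Lemma expi0 (R : realType) : expi (0 : R) = 1.
Proof. by rewrite /expi cos0 sin0. Qed.

Lemma expi_norm (R : realType) (t : R) : `|expi t| = 1.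
Proof. by rewrite normc_def /= cos2Dsin2 sqrtr1. Qed.

Lemma expi_inv (R : realType) (t : R) : expi (- t) = (expi t)^-1.
Proof.
have nz : expi t != 0 by rewrite -normr_eq0 expi_norm oner_eq0.
by apply: (mulIf nz); rewrite mulVf // -expiD addNr expi0.
Qed.

Lemma expi_mulz (R : realType) (k : int) (t : R) : expi (k%:~R * t) = expi t ^ k.
Proof.
have h (n : nat) : expi (n%:R * t) = expi t ^+ n.
  elim: n => [|n IH]; first by rewrite mul0r expi0.
  by rewrite exprS -IH -expiD mulrS mulrDl mul1r.
case: k => n; first exact: h.
by rewrite NegzE mulrNz mulNr expi_inv (h n.+1) /= exprnN.
Qed.

Lemma fine_subC (R : realType) (x y : \bar R) :
  (0 <= x)%E -> (0 <= y)%E -> fine (x - y)%E = - fine (y - x)%E.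
Proof. by case: x => [x||]; case: y => [y||] //=; rewrite ?oppr0 ?opprB. Qed.

Lemma Rintegral_opp (R : realType) (D : set R) (f : R -> R) :
  \int[lebesgue_measure]_(x in D) (- f x) = - (\int[lebesgue_measure]_(x in D) f x).
Proof.
rewrite /Rintegral [in LHS]integralE [in RHS]integralE.
rewrite (_ : (fun x => (- f x)%:E) = (\- (fun x => (f x)%:E))%E); last first.
  by apply/funext => x; rewrite EFinN.
by rewrite funeposN funenegN fine_subC//; exact: integral_ge0.
Qed.

Lemma circle_integralJ (R : realType) (f : R -> R[i]) :
  circle_integral (fun x => (f x)^*%C) = (circle_integral f)^*%C.
Proof.
rewrite /circle_integral /= -Rintegral_opp.
by congr (_ +i* _); congr (Rintegral _ _ _); apply/funext => x; case: (f x).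
Qed.

Lemma fourierN (R : realType) (m : nat) (v : R -> 'rV[R]_m) (k : int) :
   fourier v (- k) = map_mx (fun z : R[i] => z^*%C) (fourier v k).
Proof.
apply/rowP => j; rewrite !mxE rmorphM; congr (_ * _); first by rewrite /= oppr0.
have e x : (v x 0 j)%:C * expi (- ((- k)%:~R * x)) =
           ((v x 0 j)%:C * expi (- (k%:~R * x)))^*%C.
  by rewrite mulrNz mulNr [in LHS]opprK [in RHS]expiN [RHS]rmorphM; congr (_ * _);
    [rewrite /= oppr0 | exact/esym/conjcK].
rewrite (funext e); exact: circle_integralJ.
Qed.

Lemma conj_dir (R : realType) (z : R[i]) : (z / `|z|)^*%C = (z / `|z|)^-1.
Proof.
have [->|z0] := eqVneq z 0; first by rewrite mul0r invr0 conjc0.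
have nz : `|z| != 0 by rewrite normr_eq0.
have wn : `|z / `|z| | = 1 by rewrite normrM normfV normr_id divff.
by rewrite [RHS]invc_norm wn expr1n invr1 mul1r.
Qed.

Lemma conj_dirX (R : realType) (z : R[i]) (k : int) :
  ((z / `|z|) ^ k)^*%C = (z / `|z|) ^ (- k).
Proof.
have := conj_dir z; move: (z / `|z|) => w cw; rewrite -exprz_inv -cw.
rewrite -[in LHS]/((conjc : {rmorphism R[i] -> R[i]}) (w ^ k)).
by rewrite fmorphXz.
Qed.

Lemma harm_partial_real (R : realType) (m : nat) (v : R -> 'rV[R]_m) p n j :
  complex.Im (harm_partial v p n 0 j) = 0.
Proof.
set w := harm_partial v p n 0 j.
suff : w^*%C = w.
  case: w => a b [] /eqP.
  by rewrite eq_sym -subr_eq0 opprK -mulr2n mulrn_eq0 /= => /eqP.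
rewrite {}/w /harm_partial !summxE rmorph_sum /=.
rewrite [RHS](reindex_inj rev_ord_inj) /=; apply: eq_bigr => i _.
have -> : (n.*2.+1 - i.+1)%N%:Z - n%:Z = - (i%:Z - n%:Z).
  have := ltn_ord i; lia.
rewrite mxE [in RHS]mxE fourierN abszN !rmorphM.
have cn : (`|complex_of p|)^*%C = `|complex_of p| by rewrite normc_def /= oppr0.
congr (_ * _); last by rewrite [RHS]mxE.
congr (_ * _); first by rewrite rmorphXn; congr (_ ^+ _); exact: cn.
exact: conj_dirX.
Qed.

Lemma harm_ext_polar (R : realType) (m : nat) (v : R -> 'rV[R]_m) r t : 0 <= r ->
  harm_ext v (polar r t) = \row_j limn (fun n => complex.Re
    (\sum_(i < n.*2.+1) let k := i%:Z - n%:Z in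
       (r ^+ `|k|%N)%:C * fourier v k 0 j * expi (k%:~R * t))).
Proof.
move=> r0; apply/rowP => j; rewrite !mxE.
congr (limn _); apply/funext => n.
rewrite /harm_partial summxE; congr complex.Re; apply: eq_bigr => i _ /=.
set k : int := _ - _; rewrite mxE expi_mulz.
move: (fourier v k 0 j) => c.
have -> : complex_of (polar r t) = r%:C * expi t.
  by rewrite /complex_of /polar !mxE /= /expi; simpc.
have -> : `|r%:C * expi t| = r%:C.
  by rewrite normrM expi_norm mulr1 ger0_norm // ler0c.
have -> : (r ^+ `|k|%N)%:C = r%:C ^+ `|k|%N by exact: rmorphXn.
rewrite [RHS]mulrAC; move: (expi t) => w.
suff -> : r%:C ^+ `|k| * (r%:C * w / r%:C) ^ k = r%:C ^+ `|k| * w ^ k by [].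
move: r0; rewrite le_eqVlt => /predU1P[<-|r0].
  have [->|k0] := eqVneq k 0; first by rewrite !expr0z.
  by rewrite [(0 : R)%:C]/(0 : R[i]) expr0n absz_eq0 (negbTE k0) !mul0r.
have rn : r%:C != 0 :> R[i] by rewrite eq_complex /= eqxx andbT gt_eqF.
by rewrite (mulrC r%:C) mulfK.
Qed.

(* Main.v *)
(** By Parseval the half Dirichlet energy is the Gagliardo double integral
    (1/2pi) iint |u(x) - u(y)|^2 / (4 sin^2((x-y)/2)) dx dy.
    Substituting phi = x + t X(x) in both variables moves the flow from u to
    the kernel, whose derivative in t at 0 for X = cos(kx) or sin(kx) is a
    trigonometric polynomial of the form sum_(p + q = k) p q e^(i(px + qy)), by
    an identity between divided differences.  So the derivative of the energy
    along e^(ikx) is a multiple of the k-th sum in the theorem, and uniform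
    approximation of X' by trigonometric polynomials extends the vanishing of
    the derivative to all C^1 fields X.  On the other side u~ = Re F with F
    holomorphic, the k-th sum is, up to a factor 4, the k-th coefficient of
    z^2 F'(z).F'(z), and at z = r e^(i theta) one has
    z F' = r d_r u~ - i d_theta u~, so that the last two conditions say that the
    real, resp. imaginary, part of (zF').(zF') vanishes, which forces all the
    coefficients to vanish.  *)

From HB Require Import structures.
Require Import Defs.
From mathcomp Require Import measurable_realfun ring lra zify.
Import HBNNSimple.

Set Implicit Arguments.
Unset Strict Implicit.
Unset Printing Implicit Defensive.

Local Open Scope classical_set_scope.
Local Open Scope ring_scope.

(** * Dirichlet, Fejer and Hopf kernels *)

(** The obstacle is regularity: [u] is only in H^(1/2), so neither [u (x + t X x)] nor its half
    Laplacian can be differentiated in [t]. In the double integral, [t] can be confined to the ratio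
    of kernels and Jacobians, which is estimated pointwise with a multiplicative error. Integration
    then bounds the error in the energy by a small multiple of the energy itself, and no dominating
    function has to be found. The frequency factor |k| appears because sin(kh/2)^2 / sin(h/2)^2 is a
    Fejer kernel, of integral 2 pi k.

    A general C^1 field has no explicit density. It is compared with a trigonometric field Y, at the
    price of |t| sup|X' - Y'| times a multiple of the energy; this makes the difference quotient
    along X arbitrarily small without a formula for the derivative along X.

    The half Laplacian is selected by choice among the L^2 functions with prescribed coefficients,
    so its existence and its energy rest on Riesz-Fischer and Parseval for everywhere defined
    periodic representatives, obtained here from Fejer approximation and Lebesgue
    differentiation. *)

Section TrigIdentities.
Variable R : realType.
Implicit Types (x y h d t : R) (k n : nat).

Lemma sin_halfX h : 2 * sin (h / 2) ^+ 2 = 1 - cos h.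
Proof. by rewrite [in RHS](splitr h) cosD -!expr2 cos2sin2; ring. Qed.

Definition dirichlet n h : R := 1 + 2 * \sum_(j < n) cos (j.+1%:R * h).

(** Not divided by [n]: in this normalisation it is sin(nh/2)^2 / sin(h/2)^2, of integral 2 pi n
    over the circle, and this integral is the source of the weight |k| in the energy. *)
Definition fejer n h : R := \sum_(i < n) dirichlet i h.

Lemma dirichletE n h :
  dirichlet n h * sin (h / 2) = sin (n%:R * h + h / 2).
Proof.
rewrite /dirichlet; elim: n => [|n IH]; first by rewrite big_ord0 mul0r add0r; ring.
rewrite big_ord_recr /= mulrDr addrA mulrDl IH.
have -> : n%:R * h + h / 2 = n.+1%:R * h - h / 2.
  by field.
rewrite sinB sinD; ring.
Qed.

Lemma fejerE n h : fejer n h * sin (h / 2) ^+ 2 = sin (n%:R * (h / 2)) ^+ 2.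
Proof.
rewrite /fejer; elim: n => [|n IH].
  by rewrite big_ord0 !mul0r sin0 expr0n.
rewrite big_ord_recr /= mulrDl IH.
have -> : dirichlet n h * sin (h / 2) ^+ 2 =
          sin (n%:R * h + h / 2) * sin (h / 2) by rewrite -dirichletE; ring.
have -> : n%:R * h + h / 2 = n%:R * (h / 2) + n.+1%:R * (h / 2) by field.
have -> : n.+1%:R * (h / 2) = n%:R * (h / 2) + h / 2 by field.
move: (n%:R * (h / 2)) (h / 2) => a b.
have eb : cos b ^+ 2 = 1 - sin b ^+ 2 by rewrite -(cos2Dsin2 b); ring.
have ea : cos a ^+ 2 = 1 - sin a ^+ 2 by rewrite -(cos2Dsin2 a); ring.
rewrite !sinD !cosD.
ring: ea eb.
Qed.

Lemma fejer_ge0 n h : sin (h / 2) != 0 -> 0 <= fejer n h.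
Proof.
move=> s0; have s2 : 0 < sin (h / 2) ^+ 2 by rewrite exprn_even_gt0.
by rewrite -(pmulr_lge0 _ s2) fejerE sqr_ge0.
Qed.

End TrigIdentities.

(** * Divided differences and the first variation of the chord kernel *)

Section HopfKernel.

Section Ring.
Variable K : comRingType.
Implicit Types (a b : K) (k : nat).

(** The Euler operator a d/da applied to the complete homogeneous polynomial (a^(k+1) - b^(k+1)) /
    (a - b). Applying b d/db in turn gives [hopf_sum]. *)
Let V k a b : K := \sum_(p < k.+1) p%:R * (a ^+ p * b ^+ (k - p)).
Definition hopf_sum k a b : K :=
  \sum_(p < k.+1) (p * (k - p))%:R * (a ^+ p * b ^+ (k - p)).

Let VS k a b : V k.+1 a b = b * V k a b + k.+1%:R * a ^+ k.+1.
Proof.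
rewrite /V big_ord_recr /= subnn expr0 mulr1; congr (_ + _).
rewrite mulr_sumr; apply: eq_bigr => i _.
by rewrite subSn ?exprS -1?ltnS//; ring.
Qed.

Let hopf_sumS k a b : hopf_sum k.+1 a b = b * (hopf_sum k a b + V k a b).
Proof.
rewrite /hopf_sum /V big_ord_recr /= subnn muln0 mul0r addr0.
rewrite -big_split /= mulr_sumr; apply: eq_bigr => i _.
rewrite subSn -1?ltnS// exprS mulnS natrD; ring.
Qed.

Let VE k a b : (a - b) ^+ 2 * V k a b =
  a * (k%:R * a ^+ k.+1 - k.+1%:R * a ^+ k * b + b ^+ k.+1).
Proof.
elim: k => [|k IH].
  by rewrite /V big_ord_recl big_ord0 /= !mul0r !mulr1; ring.
rewrite VS mulrDr mulrCA IH !exprS -!natr1; ring.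
Qed.

(** Formally this is (a d/da)(b d/db) of the quotient (a^(k+1) - b^(k+1)) / (a - b), cleared of its
    denominator (a - b)^3. The derivatives are replaced by an induction on [k] in which [V] carries
    the intermediate derivative, so that the identity holds in any commutative ring. *)
Lemma hopf_sumE k a b :
  a * b * ((a ^+ k - b ^+ k) * (a + b) - k%:R * (a ^+ k + b ^+ k) * (a - b)) =
  - (a - b) ^+ 3 * hopf_sum k a b.
Proof.
elim: k => [|k IH].
  by rewrite /hopf_sum big_ord_recl big_ord0 /= !mul0r !expr0; ring.
rewrite hopf_sumS [RHS]mulrCA [in RHS]mulrDr -IH.
have -> : - (a - b) ^+ 3 * V k a b = - (a - b) * ((a - b) ^+ 2 * V k a b) by ring.
rewrite VE !exprS -!natr1; ring.
Qed.

End Ring.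

Variable R : realType.
Implicit Types (x y t : R) (k : nat).

(** [hopf_cos] and [hopf_sin] are named after the vector fields cos(kx) and sin(kx) whose densities
    they are. They are the real and imaginary parts of i times [hopf_sum] at (e^(ix), e^(iy)), which
    is why the cosine field produces sines. *)
Definition hopf_cos k x y : R :=
  - \sum_(p < k.+1) (p * (k - p))%:R * sin (p%:R * x + (k - p)%:R * y).

Definition hopf_sin k x y : R :=
  \sum_(p < k.+1) (p * (k - p))%:R * cos (p%:R * x + (k - p)%:R * y).

Let half_angle (t : R) : 2%:R * (t / 2) = t. Proof. by field. Qed.

Lemma expi_natM k t : expi (k%:R * t) = expi t ^+ k.
Proof. exact: (@expi_mulz _ k%:Z). Qed.

Lemma hopf_sum_expi k x y :
  hopf_sum k (expi x) (expi y) = (hopf_sin k x y +i* - hopf_cos k x y)%C.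
Proof.
rewrite /hopf_sum /hopf_sin /hopf_cos opprK.
rewrite (eq_bigr (fun p : 'I_k.+1 =>
  ((p * (k - p))%:R * cos (p%:R * x + (k - p)%:R * y) +i*
   ((p * (k - p))%:R * sin (p%:R * x + (k - p)%:R * y)))%C)); last first.
  move=> p _; rewrite -!expi_natM -expiD /expi.
  by rewrite -(rmorph_nat (@real_complex R)); simpc.
by elim/big_rec3: _ => [//|i z1 z2 z3 _ ->]; simpc.
Qed.

Lemma hopf_kernel k x y (d := (x - y) / 2) :
  (cos (k%:R * x) - cos (k%:R * y)) * cos d
    + k%:R * (sin (k%:R * x) + sin (k%:R * y)) * sin d
    = 4 * sin d ^+ 3 * hopf_cos k x y /\
  (sin (k%:R * x) - sin (k%:R * y)) * cos d
    - k%:R * (cos (k%:R * x) + cos (k%:R * y)) * sin d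
    = 4 * sin d ^+ 3 * hopf_sin k x y.
Proof.
(* Half angles make everything polynomial: with I the imaginary unit, 2 cos(d) ab = a^2 + b^2 and 2
   I sin(d) ab = a^2 - b^2. After multiplication by 2 (ab)^3 the claim is [hopf_sumE] at a^2 and
   b^2. *)
pose a := expi (x / 2); pose b := expi (y / 2).
have aE : expi x = a ^+ 2 by rewrite /a -expi_natM half_angle.
have bE : expi y = b ^+ 2 by rewrite /b -expi_natM half_angle.
have a0 : a != 0 by rewrite -normr_eq0 expi_norm oner_eq0.
have b0 : b != 0 by rewrite -normr_eq0 expi_norm oner_eq0.
have dE : expi d = a / b.
  by rewrite /a /b -expi_inv -expiD /d mulrBl.
have dNE : expi (- d) = b / a by rewrite expi_inv dE invf_div.
pose c : R[i] := (cos d)%:C%C; pose s : R[i] := (sin d)%:C%C.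
pose I : R[i] := ('i)%C.
have cE : 2 * c * (a * b) = a ^+ 2 + b ^+ 2.
  have -> : 2 * c = expi d + expi (- d).
    rewrite /c /expi cosN sinN; simpc.
    by apply/eqP; rewrite eq_complex /=; apply/andP; split; apply/eqP; ring.
  by rewrite dE dNE; field; rewrite a0 b0.
have sE : 2 * I * s * (a * b) = a ^+ 2 - b ^+ 2.
  have -> : 2 * I * s = expi d - expi (- d).
    rewrite /s /I /expi cosN sinN; simpc.
    by apply/eqP; rewrite eq_complex /=; apply/andP; split; apply/eqP; ring.
  by rewrite dE dNE; field; rewrite a0 b0.
have I2 : I ^+ 2 = -1 by exact: sqr_i.
have main : (expi x ^+ k - expi y ^+ k) * c
     - k%:R * I * (expi x ^+ k + expi y ^+ k) * s =
     4 * I * s ^+ 3 * hopf_sum k (expi x) (expi y).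
  have ab3 : 2 * (a * b) ^+ 3 != 0.
    by rewrite mulf_neq0 ?pnatr_eq0 ?expf_neq0// mulf_neq0.
  apply: (mulfI ab3).
  have := hopf_sumE k (expi x) (expi y); rewrite aE bE -cE -sE => h.
  have -> : 2 * (a * b) ^+ 3 * (4 * I * s ^+ 3 * hopf_sum k (a ^+ 2) (b ^+ 2)) =
    - (2 * I * s * (a * b)) ^+ 3 * hopf_sum k (a ^+ 2) (b ^+ 2).
    ring: I2.
  rewrite -h; ring.
move: main; rewrite -!expi_natM hopf_sum_expi /expi /c /s /I.
rewrite -!(rmorph_nat (@real_complex R)) -rmorphXn /=; simpc.
by case=> e1 e2; split; [rewrite -[RHS]opprK -mulrN -mulNr| ]; lra.
Qed.

End HopfKernel.

(** * Elementary bounds for periodic functions and for the perturbed kernel *)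

Section Calculus.
Variable R : realType.
Implicit Types (x y h d t L e : R) (f g : R -> R).

Lemma lipschitz_derive f (df : R -> R) L :
  (forall x, is_derive x 1 f (df x)) -> (forall x, `|df x| <= L) ->
  forall x y, `|f x - f y| <= L * `|x - y|.
Proof.
move=> fdf dfL.
suff H x y : x <= y -> `|f x - f y| <= L * `|x - y|.
  move=> x y; have [|/ltW] := leP x y; first exact: H.
  by move=> yx; rewrite distrC (distrC x); exact: H.
move=> xy; rewrite distrC (distrC x).
have [|z _ ->] := MVT_segment xy (fun z _ => fdf z).
  apply: continuous_subspaceT => z.
  by apply: differentiable_continuous; apply/derivable1_diffP; have [] := fdf z.
by rewrite normrM ler_wpM2r.
Qed.

Lemma sin_lipschitz x y : `|sin x - sin y| <= `|x - y|.
Proof.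
rewrite -[leRHS]mul1r.
by apply: lipschitz_derive x y => z; exact: cos_max.
Qed.

Lemma cos_lipschitz x y : `|cos x - cos y| <= `|x - y|.
Proof.
rewrite -[leRHS]mul1r.
apply: lipschitz_derive x y => z.
by rewrite normrN; exact: sin_max.
Qed.

Lemma norm_sin_le x : `|sin x| <= `|x|.
Proof. by have := sin_lipschitz x 0; rewrite sin0 !subr0. Qed.

Lemma cos_sub1_le x : `|cos x - 1| <= x ^+ 2.
Proof.
rewrite distrC -sin_halfX ger0_norm; last by rewrite pmulr_rge0// sqr_ge0.
have : sin (x / 2) ^+ 2 <= (x / 2) ^+ 2.
  by rewrite -(real_normK (num_real (sin _))) -(real_normK (num_real (x / 2)))
    lerXn2r ?nnegrE// norm_sin_le.
have := sqr_ge0 x; move: (sin _) => s; nra.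
Qed.

Lemma sin_sub_le x : `|sin x - x| <= x ^+ 2.
Proof.
wlog x0 : x / 0 <= x.
  move=> H; have [/H//|/ltW x0] := leP 0 x.
  have := H (- x); rewrite sinN sqrrN -opprD normrN; apply.
  by rewrite oppr_ge0.
have := @MVT_segment R (fun z => sin z - z) (fun z => cos z - 1) 0 x x0.
case=> [|z].
  apply: continuous_subspaceT => z.
  apply: cvgB; [exact: continuous_sin | exact: cvg_id].
rewrite in_itv /= => /andP[z0 zx].
rewrite sin0 !subr0 => ->; rewrite normrM (ger0_norm x0) expr2 ler_wpM2r//.
have := cos_lipschitz z 0; rewrite cos0 subr0 (ger0_norm z0) => h.
exact: le_trans h zx.
Qed.

(** A crude Jordan inequality. On [0, pi/4] the mean value theorem applies with cos >= cos(pi/4) >=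
    1/2; on [pi/4, pi/2] already sin >= 1/2, while x < 2. *)
Lemma sin_ge_quarter x : 0 <= x <= pi / 2 -> x <= 4 * sin x.
Proof.
move=> /andP[x0 xp].
have pp := pihalf_lt2 R; have p0 := pi_gt0 R.
have sq : sin (pi / 4) = cos (pi / 4) :> R.
  by rewrite -cosBpihalf -cosN; congr cos; field.
have sq2 : 2 * sin (pi / 4) ^+ 2 = 1 :> R.
  by have := cos2Dsin2 (pi / 4 : R); rewrite -sq; lra.
have sq0 : 0 < sin (pi / 4) :> R by apply: sin_gt0_pi; apply/andP; split; lra.
have sqh : 1 / 2 <= sin (pi / 4) :> R by nra.
have [x4|/ltW x4] := leP x (pi / 4).
  have [|z] := @MVT_segment R sin cos 0 x x0 (fun z _ => is_derive_sin z).
    by apply: continuous_subspaceT => z; exact: continuous_sin.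
  rewrite in_itv /= sin0 !subr0 => /andP[z0 zx] ->.
  have : cos (pi / 4) <= cos z.
    have [->//|zn] := eqVneq z (pi / 4).
    rewrite ltW// ltr_cos ?in_itv/=; [|lra|lra].
    by rewrite lt_neqAle zn (le_trans zx).
  rewrite -sq => h; nra.
have : sin (pi / 4) <= sin x.
  have [->//|zn] := eqVneq x (pi / 4).
  rewrite ltW// ltr_sin ?in_itv/=; [|lra|lra].
  by rewrite lt_neqAle eq_sym zn.
lra.
Qed.

Lemma periodicz f T (z : int) x : periodic f T -> f (x + z%:~R * T) = f x.
Proof.
move=> pf; case: z => n; first by rewrite -[_ * T]/(n%:R * T) mulr_natl periodicn.
rewrite NegzE mulrNz mulNr -[_ * T]/(n.+1%:R * T).
by rewrite -[in RHS](subrK (n.+1%:R * T) x) mulr_natl periodicn.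
Qed.

Lemma cos_periodic : periodic (@cos R) (2 * pi).
Proof. by move=> x; rewrite mulr_natl cosD2pi. Qed.

Lemma sin_periodic : periodic (@sin R) (2 * pi).
Proof. by move=> x; rewrite mulr_natl sinD2pi. Qed.

Lemma sin_half_shift h (z : int) :
  `|sin ((h + z%:~R * (2 * pi)) / 2)| = `|sin (h / 2)|.
Proof.
apply/eqP; rewrite -(@eqrXn2 _ 2)// !real_normK ?num_real//.
rewrite -(inj_eq (mulfI (_ : (2 : R) != 0)))// !sin_halfX.
by rewrite periodicz//; exact: cos_periodic.
Qed.

(** The chord length controls the distance to the lattice 2 pi Z. As |sin| <= 1, the representative
    lies in [-8, 8], which serves below as a compact set meeting every orbit of the period. *)
Lemma near_multiple h : exists z : int,
  `|h + z%:~R * (2 * pi)| <= 8 * `|sin (h / 2)|.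
Proof.
have p0 := pi_gt0 R.
(* Minus the integer nearest to h / (2 pi), so that the translate has absolute value at most pi. *)
pose z : int := - Num.floor (h / (2 * pi) + 1 / 2).
exists z; rewrite -(sin_half_shift h z).
set g := h + _.
have gp : `|g| <= pi.
  have /andP[f1 f2] := floor_itv (h / (2 * pi) + 1 / 2).
  have hE : h = (h / (2 * pi)) * (2 * pi) by rewrite divfK// gt_eqF// mulr_gt0.
  rewrite /g /z mulrNz mulNr; move: f1 f2; rewrite intrD.
  move: (_%:~R : R) => w f1 f2.
  rewrite ler_norml {1 2}hE; apply/andP; split; nra.
move: g gp => g gp; have := @sin_ge_quarter (`|g| / 2).
have -> : sin (`|g| / 2) = `|sin (g / 2)|.
  rewrite -{1}(ger0_norm (_ : 0 <= (2:R)))// -normfV -normrM.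
  case: (leP 0 (g / 2)) => g0.
    rewrite (ger0_norm g0) ger0_norm// sin_ge0_pi// g0 /=.
    by move: gp; rewrite ler_norml => /andP[]; lra.
  rewrite ltr0_norm// sinN ler0_norm// -oppr_ge0 -sinN sin_ge0_pi//.
  by move: gp; rewrite ler_norml => /andP[]; lra.
have := normr_ge0 g; lra.
Qed.

(** By periodicity x may be replaced by its translate closest to y; there the Lipschitz bound and
    the chord bound agree up to the factor 8. *)
Lemma chord_bound f (df : R -> R) L :
  periodic f (2 * pi) ->
  (forall x, is_derive x 1 f (df x)) -> (forall x, `|df x| <= L) ->
  forall x y, `|f x - f y| <= 8 * L * `|sin ((x - y) / 2)|.
Proof.
move=> pf fdf dfL x y.
have L0 : 0 <= L by apply: le_trans (dfL 0).
have [z hz] := near_multiple (x - y).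
rewrite -(periodicz z x pf); apply: le_trans (lipschitz_derive fdf dfL _ _) _.
rewrite (_ : _ - y = x - y + z%:~R * (2 * pi)); last by ring.
by rewrite (mulrC 8) -mulrA ler_wpM2l.
Qed.

Lemma bounded_periodic f : periodic f (2 * pi) -> continuous f ->
  exists2 M : R, 0 <= M & forall x, `|f x| <= M.
Proof.
move=> pf cf.
have [||c _ Hc] := @EVT_max R (fun x => `|f x|) (- 8) 8; first lra.
  apply: continuous_subspaceT => x.
  by apply: continuous_comp; [exact: cf | exact: norm_continuous].
exists `|f c| => // x.
have [z hz] := near_multiple x; rewrite -(periodicz z x pf); apply: Hc.
by rewrite in_itv /= -ler_norml (le_trans hz)// ger_pMr// sin_max.
Qed.

(** The near-covering form of compactness of [-8, 8] gives a single [d] for all base points in that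
    segment, and [near_multiple] brings every other base point into it. *)
Lemma uniform_continuous_periodic f e : periodic f (2 * pi) -> continuous f ->
  0 < e -> exists2 d : R, 0 < d & forall x h, `|h| < d -> `|f (x + h) - f x| < e.
Proof.
move=> pf cf e0.
have : near_covering (`[-8, 8]%classic : set R).
  by rewrite -compact_near_coveringP; exact: segment_compact.
move=> /(_ R (0^'+) (fun (d x : R) => forall h, `|h| < d -> `|f (x + h) - f x| < e)) H.
have /H : forall x : R, `[-8, 8]%classic x -> \forall x' \near x & d \near 0^'+,
    forall h, `|h| < d -> `|f (x' + h) - f x'| < e.
  move=> x _.
  have /cvgrPdist_lt/(_ _ (divr_gt0 e0 (ltr0n _ 2))) := cf x.
  move=> /nbhs_ballP[r /= r0 xr].
  exists (ball x (r / 2), [set d | d < r / 2]) => /=.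
    split; first by apply: nbhsx_ballx; exact: divr_gt0.
    by apply: nbhs_right_lt; exact: divr_gt0.
  move=> [x' d] /= [xx' dr] h hd.
  have h1 : `|f x - f (x' + h)| < e / 2.
    apply: xr; rewrite /ball /= opprD addrA.
    apply: le_lt_trans (ler_normB _ _) _.
    rewrite [r]splitr ltrD//; exact: lt_trans dr.
  have h2 : `|f x - f x'| < e / 2.
    apply: xr; rewrite /ball /=; apply: lt_trans xx' _.
    by rewrite ltr_pdivrMr// ltr_pMr// ltr1n.
  rewrite distrC in h2; rewrite distrC -(subrKA (f x)).
  by apply: le_lt_trans (ler_normD _ _) _; rewrite [e]splitr ltrD.
move=> H1; near (0 : R)^'+ => d.
exists d; first by near: d; exact: nbhs_right_gt.
move=> x h hd; have [z hz] := near_multiple x.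
rewrite -(periodicz z x pf) -(periodicz z (x + h) pf) addrAC.
have : forall x, `[-8, 8]%classic x -> forall h, `|h| < d -> `|f (x + h) - f x| < e.
  by near: d; exact: H1.
apply => //=.
by rewrite in_itv /= -ler_norml (le_trans hz)// ger_pMr// sin_max.
Unshelve. all: by end_near. Qed.

(* Small increments are controlled by [e], the others by the chord length. *)
Lemma increment_bound f e : periodic f (2 * pi) -> continuous f ->
  0 < e -> exists2 C : R, 0 <= C &
    forall x h, `|f (x + h) - f x| <= e + C * sin (h / 2) ^+ 2.
Proof.
move=> pf cf e0.
have [d d0 fd] := uniform_continuous_periodic pf cf e0.
have [M M0 fM] := bounded_periodic pf cf.
have C0 : 0 <= 2 * M / (d / 8) ^+ 2.
  by apply: divr_ge0 (sqr_ge0 _); exact: mulr_ge0.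
exists (2 * M / (d / 8) ^+ 2) => //.
move=> x h; have [z hz] := near_multiple h.
rewrite -(periodicz z (x + h) pf) -addrA.
rewrite -(real_normK (num_real (sin _))) -(sin_half_shift h z).
rewrite -(sin_half_shift h z) in hz.
move: (_ + _) hz => {}h hh.
have [hd|hd] := ltP `|h| d.
  apply: (le_trans (ltW (fd x h hd))); rewrite lerDl.
  exact: mulr_ge0 C0 (sqr_ge0 _).
have s8 : d / 8 <= `|sin (h / 2)| by lra.
apply: (@le_trans _ _ (2 * M)).
  apply: (le_trans (ler_normB _ _)).
  by have := fM (x + h); have := fM x; lra.
apply: ler_wpDl (ltW e0) _.
rewrite mulrAC ler_pdivlMr ?exprn_gt0 ?divr_gt0//.
by rewrite ler_wpM2l ?mulr_ge0// lerXn2r// nnegrE ltW// divr_gt0.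
Qed.

(* The factor by which the kernel [1 / sin ((x - y) / 2) ^+ 2] changes under
   the diffeomorphism [x |-> x + t * X x], expanded to first order in [t]; here
   [D = (X x - X y) / 2], [d = (x - y) / 2] and [a], [b] stand for [X' x],
   [X' y]. *)
Lemma kernel_ratio_bound L t d D a b (N := 2 * (D * cos d / sin d) - a - b) :
  1 <= L -> `|t| * L <= 1 / 2 -> sin d != 0 ->
  `|D| <= L * `|sin d| -> `|a| <= L -> `|b| <= L ->
  `|sin (d + t * D) ^+ 2 -
    (1 + t * N) * ((1 + t * a) * (1 + t * b)) * sin d ^+ 2| <=
  76 * L ^+ 2 * t ^+ 2 * ((1 + t * a) * (1 + t * b)) * sin d ^+ 2.
Proof.
move=> L1 tL s0 DL aL bL.
set s := sin d in s0 DL N *; set c := cos d in N *.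
have c1 : `|c| <= 1 := cos_max d; have s1 : `|s| <= 1 := sin_max d.
(* [P] is the first order coefficient in [t] of the sine ratio [r]. The division by [s] is harmless
   because |D| <= L |s|. *)
pose P := D * c / s.
pose r := sin (d + t * D) / s.
have sr : sin (d + t * D) = r * s by rewrite /r divfK.
have t1 : `|t| <= 1 / 2 by have := normr_ge0 t; nra.
have PL : `|P| <= L.
  rewrite /P !normrM normfV ler_pdivrMr ?normr_gt0//.
  by apply: le_trans DL; rewrite -[leRHS]mulr1 ler_wpM2l.
have DL1 : `|D| <= L by apply: le_trans DL _; rewrite ger_pMr// (lt_le_trans _ L1).
(* The remainder comes from cos(tD) - 1 and sin(tD) - tD, both at most (tD)^2. Only the second is
   divided by [s], and D^2 <= L^2 s^2 leaves a factor |s| to spare there. *)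
have e1 : `|r - 1 - t * P| <= 2 * L ^+ 2 * t ^+ 2.
  have -> : r - 1 - t * P = (cos (t * D) - 1) + (sin (t * D) - t * D) * (c / s).
    rewrite /r /P sinD -/s -/c; field; exact: s0.
  apply: le_trans (ler_normD _ _) _.
  have h1 := cos_sub1_le (t * D).
  have h2 : `|(sin (t * D) - t * D) * (c / s)| <= L ^+ 2 * t ^+ 2.
    rewrite !normrM normfV mulrA ler_pdivrMr ?normr_gt0//.
    apply: (@le_trans _ _ ((t * D) ^+ 2)).
      apply: le_trans (sin_sub_le _); rewrite -[leRHS]mulr1 ler_wpM2l//.
    have : `|D| ^+ 2 <= L ^+ 2 * `|s| ^+ 2.
      by rewrite -exprMn lerXn2r// nnegrE mulr_ge0// (le_trans _ L1).
    rewrite (real_normK (num_real D)) => DL2.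
    have : `|s| ^+ 2 <= `|s| by rewrite expr2 ger_pMr ?normr_gt0.
    move=> ss; rewrite exprMn [leRHS](_ : _ = t ^+ 2 * (L ^+ 2 * `|s|)); last by ring.
    apply: ler_wpM2l (sqr_ge0 t) _ _ _.
    exact: le_trans DL2 (ler_wpM2l (sqr_ge0 L) ss).
  have : D ^+ 2 <= L ^+ 2.
    by rewrite -(real_normK (num_real D)) lerXn2r// nnegrE (le_trans _ L1).
  move: h1; rewrite exprMn; have := sqr_ge0 t; nra.

rewrite sr; set e := r - 1 - t * P in e1.
have rE : r = 1 + t * P + e by rewrite /e; ring.
set q := (1 + t * a) * (1 + t * b).
have half (z : R) : `|z| <= L -> `|t * z| <= 1 / 2.
  by move=> zL; apply: le_trans tL; rewrite normrM ler_wpM2l.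
have q0 : 1 / 4 <= q.
  have := half _ aL; have := half _ bL; rewrite !ler_norml.
  move=> /andP[b1 _] /andP[a1 _]; rewrite /q; nra.
have L0 : 0 <= L by lra.
have t2 : 0 <= t ^+ 2 by exact: sqr_ge0.
have NL : `|N| <= 4 * L.
  rewrite /N -/P; apply: (le_trans (ler_normB _ _)).
  have := ler_normB (2 * P) a; rewrite (normrM 2 P) (ger0_norm (_ : 0 <= 2))//; lra.
have mulL (y z y1 z1 : R) : `|y| <= y1 -> `|z| <= z1 -> `|y * z| <= y1 * z1.
  by move=> yL zL; rewrite normrM ler_pM.
(* The constant is 19 = 1 + 7 + 9 + 2, one summand for each of [b1] to [b4] below. The 76 of the
   statement is 4 * 19, since the product [q] of the Jacobians is at least 1/4. *)
suff A : `|r ^+ 2 - (1 + t * N) * q| <= 19 * L ^+ 2 * t ^+ 2.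
  have -> : (r * s) ^+ 2 - (1 + t * N) * q * s ^+ 2 =
            (r ^+ 2 - (1 + t * N) * q) * s ^+ 2 by ring.
  rewrite normrM (ger0_norm (sqr_ge0 s)) ler_wpM2r ?sqr_ge0//.
  apply: (le_trans A); have := mulr_ge0 (sqr_ge0 L) t2; nra.
have -> : r ^+ 2 - (1 + t * N) * q = t ^+ 2 * (P * P) + e * (2 + 2 * (t * P) + e)
   - (t ^+ 2 * (a * b + N * (a + b)) + t ^+ 2 * ((t * a) * (N * b))).
  by rewrite rE /q /N -/P; ring.
have eh : `|e| <= 1 / 2.
  apply: (le_trans e1).
  have : (`|t| * L) ^+ 2 <= (1 / 2) ^+ 2 by rewrite lerXn2r ?nnegrE ?mulr_ge0.
  by rewrite exprMn (real_normK (num_real t)); lra.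
have b1 : `|t ^+ 2 * (P * P)| <= t ^+ 2 * (L * L).
  by apply/mulL; [rewrite ger0_norm | exact/mulL].
have b2 : `|e * (2 + 2 * (t * P) + e)| <= 2 * L ^+ 2 * t ^+ 2 * (7 / 2).
  apply/mulL => //; have := half _ PL; move: eh; rewrite !ler_norml.
  by move=> /andP[? ?] /andP[? ?]; apply/andP; split; lra.
have b3 : `|t ^+ 2 * (a * b + N * (a + b))| <= t ^+ 2 * (L * L + 4 * L * (L + L)).
  apply/mulL; first by rewrite ger0_norm.
  apply: (le_trans (ler_normD _ _)); apply: lerD; first exact/mulL.
  by apply/mulL => //; apply: (le_trans (ler_normD _ _)); exact: lerD.
have b4 : `|t ^+ 2 * ((t * a) * (N * b))| <= t ^+ 2 * (1 / 2 * (4 * L * L)).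
  apply/mulL; first by rewrite ger0_norm.
  by apply/mulL; [exact: half | exact/mulL].
apply: (le_trans (ler_normB _ _)).
apply: (le_trans (lerD (ler_normD _ _) (ler_normD _ _))).
by lra.
Qed.

End Calculus.

(** * Changes of variables on the circle *)

Lemma integral_derive (R : realType) (F f : R -> R) (a b : R) :
  (forall x : R, is_derive x 1 F (f x)) -> continuous f -> a <= b ->
  (\int[lebesgue_measure]_(x in `[a, b]) (f x)%:E = (F b - F a)%:E)%E.
Proof.
move=> dF cf; rewrite le_eqVlt => /predU1P[->|ab].
  by rewrite set_itv1 integral_set1 subrr.
have cF : continuous F.
  move=> x; apply: differentiable_continuous; apply/derivable1_diffP.
  by have [] := dF x.
rewrite (continuous_FTC2 (F := F) ab (continuous_subspaceT cf)) ?EFinB//.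
- split; [by move=> x _; have [] := dF x | exact/cvg_at_right_filter/cF |
    exact/cvg_at_left_filter/cF].
- by move=> x _; rewrite derive1E; have [] := dF x.
Qed.

Section Substitution.
Variable R : realType.
Variables (phi dphi : R -> R).
Hypothesis phi_derive : forall x : R, is_derive x 1 phi (dphi x).
Hypothesis dphi_gt0 : forall x, 0 < dphi x.
Hypothesis dphi_cont : continuous dphi.
Hypothesis phi_surj : forall y, exists x, phi x = y.

Local Notation mu := (@lebesgue_measure R).

Let phi_cont : continuous phi.
Proof.
move=> x; apply: differentiable_continuous; apply/derivable1_diffP.
by have [] := phi_derive x.
Qed.

Let phi_within a b : {within `[a, b], continuous phi}.
Proof. exact: continuous_subspaceT. Qed.

Lemma deriv_pos_lt : {mono phi : x y / x < y}.
Proof.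
suff H x y : x < y -> phi x < phi y.
  move=> x y; have [/H//|] := ltP x y.
  rewrite le_eqVlt => /predU1P[->|/H/ltW yx]; first by rewrite ltxx.
  by apply/negbTE; rewrite -leNgt.
move=> xy; have [c _ E] := MVT xy (fun z _ => phi_derive z) (@phi_within _ _).
by rewrite -subr_gt0 E mulr_gt0// subr_gt0.
Qed.

Let phi_le : {mono phi : x y / x <= y}.
Proof. by move=> x y; rewrite !leNgt deriv_pos_lt. Qed.

Let phi_meas : measurable_fun setT phi.
Proof. exact: continuous_measurable_fun. Qed.

Let dphi_meas : measurable_fun setT dphi.
Proof. exact: continuous_measurable_fun. Qed.

(** The image under [phi] of the measure with density [dphi]. Once it is identified with Lebesgue
    measure, the substitution formula holds for indicators, hence for simple functions, hence by
    monotone convergence for all nonnegative measurable functions; the energy densities have no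
    further regularity. *)
Let m' (A : set (measurableTypeR R)) : \bar R :=
  (\int[mu]_(x in phi @^-1` A) (dphi x)%:E)%E.

Let m'0 : m' set0 = 0%E.
Proof. by rewrite /m' preimage_set0 integral_set0. Qed.

Let m'_ge0 A : (0 <= m' A)%E.
Proof. by apply: integral_ge0 => x _; rewrite lee_fin ltW. Qed.

Let m'_additive : semi_sigma_additive m'.
Proof.
move=> F mF tF mUF; rewrite /m'; apply: cvg_toP.
  apply: ereal_nondecreasing_is_cvgn => i j ij.
  by apply: lee_sum_nneg_natr => // k _ _; exact: m'_ge0.
rewrite preimage_bigcup ge0_integral_bigcup//=.
- by move=> k; rewrite -[_ @^-1` _]setTI; exact: phi_meas measurableT _ (mF k).
- by apply/measurable_funTS/measurable_EFinP.
- by move=> x _; rewrite lee_fin ltW.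
- move=> i j _ _ [x [Fi Fj]]; apply: tF => //; by exists (phi x).
Qed.

HB.instance Definition _ := isMeasure.Build _ _ _ m' m'0 m'_ge0 m'_additive.

Let m'E (A : set (measurableTypeR R)) : measurable A -> mu A = m' A.
Proof.
(* Agreement on half-open intervals suffices, and there it is the fundamental theorem of calculus
   for [phi]. *)
apply: lebesgue_measure_unique => _ [[a b] _ <-].
have [ab|ba] := ltP a b; last first.
  by rewrite /= set_itv_ge ?measure0// bnd_simp -leNgt.
rewrite lebesgue_measure_itv /= lte_fin ab /m'.
have [a' aE] := phi_surj a; have [b' bE] := phi_surj b.
have a'b' : a' < b' by rewrite -deriv_pos_lt aE bE.
have -> : phi @^-1` `]a, b]%classic = `]a', b']%classic.
  apply/seteqP; split => x /=; rewrite !in_itv /= -aE -bE.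
    by rewrite deriv_pos_lt phi_le.
  by rewrite deriv_pos_lt phi_le.
rewrite integral_itv_obnd_cbnd; last exact/measurable_funTS/measurable_EFinP.
by rewrite (integral_derive phi_derive dphi_cont (ltW a'b')) aE bE.
Qed.

Lemma ge0_integral_substitution (g : R -> \bar R) :
  measurable_fun setT g -> (forall y, (0 <= g y)%E) ->
  (\int[mu]_y g y = \int[mu]_x (g (phi x) * (dphi x)%:E))%E.
Proof.
move=> mg g0; pose g_ := @nnsfun_approx _ (measurableTypeR R) R _ measurableT g mg.
have g_cvg y : EFin \o g_^~ y @ \oo --> g y.
  by apply: cvg_nnsfun_approx.
have g_nd y : {homo (EFin \o g_^~ y) : i j / (i <= j)%N >-> (i <= j)%E}.
  by move=> i j ij; rewrite lee_fin; exact/lefP/nd_nnsfun_approx.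
have mgp n : measurable_fun [set: measurableTypeR R] (fun x => g_ n (phi x)).
  have H1 : measurable_fun [set: measurableTypeR R] (g_ n).
    exact: measurable_funPT.
  by apply: (measurableT_comp H1); exact: phi_meas.
transitivity (limn (fun n => \int[mu]_y (g_ n y)%:E))%E.
  rewrite -monotone_convergence//.
  - by apply: eq_integral => y _; apply/esym/cvg_lim => //; exact: g_cvg.
  - by move=> n; exact/measurable_EFinP.
  - by move=> n y _; rewrite lee_fin.
  - by move=> y _; exact: g_nd.
transitivity (limn (fun n => \int[mu]_x ((g_ n (phi x))%:E * (dphi x)%:E)))%E;
    last first.
  rewrite -monotone_convergence//.
  - apply: eq_integral => x _; apply/cvg_lim => //.
    apply: cvgeZr => //; exact: g_cvg.
  - move=> n; apply: emeasurable_funM; apply/measurable_EFinP => //; exact: mgp.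
  - by move=> n x _; rewrite mule_ge0 ?lee_fin// ltW.
  - by move=> x _ i j ij; rewrite lee_pmul2r ?lte_fin//; exact: g_nd.
congr (limn _); apply/funext => n.
transitivity (\sum_(k \in range (g_ n))
    (k%:E * m' (g_ n @^-1` [set k])))%E.
  under eq_integral do rewrite fimfunE -fsumEFin//.
  rewrite ge0_integral_fsum//; last 2 first.
  - by move=> y; exact/measurable_EFinP/measurable_funM.
  - by move=> y x _; rewrite nnfun_muleindic_ge0.
  apply: eq_fsbigr => r _; rewrite integralZl_indic_nnsfun// integral_indic//.
  by rewrite setIT; congr (_ * _)%E; apply: m'E.
apply/esym.
have mA r : measurable (phi @^-1` (g_ n @^-1` [set r]) : set (measurableTypeR R)).
  rewrite -[X in measurable X]setTI; apply: (phi_meas measurableT).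
  exact: (@measurable_funPTI _ _ (measurableTypeR R) _ (g_ n)).
transitivity (\sum_(k \in range (g_ n))
   \int[mu]_x ((k * \1_(g_ n @^-1` [set k]) (phi x))%:E * (dphi x)%:E))%E.
  rewrite -ge0_integral_fsum//.
  - apply: eq_integral => x _.
    rewrite [in LHS]fimfunE -fsumEFin// ge0_mule_fsuml// => r.
    by rewrite nnfun_muleindic_ge0.
  - move=> r; apply: emeasurable_funM; apply/measurable_EFinP => //.
    apply: measurable_funM => //.
    by rewrite (_ : (fun x => _) = \1_(phi @^-1` (g_ n @^-1` [set r]))).
  - by move=> r x _; rewrite mule_ge0 ?nnfun_muleindic_ge0// lee_fin ltW.
apply: eq_fsbigr => r /[!inE] -[y _ ry].
under eq_integral do rewrite EFinM -muleA.
rewrite ge0_integralZl//.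
- congr (_ * _)%E; rewrite /m' [RHS]integral_mkcond; apply: eq_integral => x _.
  rewrite patchE indicE /=; have -> : (phi x \in g_ n @^-1` [set r]) =
     (x \in phi @^-1` (g_ n @^-1` [set r])) by [].
  by case: ifPn => _; rewrite ?mul1e ?mul0e.
- apply: emeasurable_funM; apply/measurable_EFinP => //.
  by rewrite (_ : (fun x => _) = \1_(phi @^-1` (g_ n @^-1` [set r]))).
- by move=> x _; rewrite mule_ge0 ?lee_fin// ltW.
- by rewrite lee_fin -ry.
Qed.

End Substitution.

Section CircleIntegral.
Variable R : realType.
Local Notation mu := (@lebesgue_measure R).
Local Notation I := (@circle_itv R).

Lemma ge0_integral_subst_itv (phi dphi : R -> R) (g : R -> \bar R) (a b : R) :
  (forall x : R, is_derive x 1 phi (dphi x)) -> (forall x, 0 < dphi x) ->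
  continuous dphi -> (forall y, exists x, phi x = y) ->
  measurable_fun setT g -> (forall y, (0 <= g y)%E) ->
  (\int[mu]_(y in `[phi a, phi b]) g y =
   \int[mu]_(x in `[a, b]) (g (phi x) * (dphi x)%:E))%E.
Proof.
move=> dphiE dphi0 cdphi phi_surj mg g0.
rewrite integral_mkcond [RHS]integral_mkcond.
rewrite (ge0_integral_substitution dphiE dphi0 cdphi phi_surj).
- apply: eq_integral => x _; rewrite !patchE.
  have -> : (phi x \in `[phi a, phi b]%classic) = (x \in `[a, b]%classic).
    have mono := deriv_pos_lt dphiE dphi0.
    by apply/idP/idP; rewrite !inE /= !in_itv /= !leNgt !mono.
  by case: ifPn => // _; rewrite mul0e.
- by apply/(measurable_restrictT _ _).1 => //; exact: measurable_funTS.
- by move=> y; rewrite patchE; case: ifPn.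
Qed.

Lemma ge0_integral_translation (g : R -> \bar R) (s a b : R) :
  measurable_fun setT g -> (forall y, (0 <= g y)%E) ->
  (\int[mu]_(y in `[(a + s)%R, (b + s)%R]) g y = \int[mu]_(x in `[a, b]) g (x + s)%R)%E.
Proof.
move=> mg g0.
have D (x : R) : is_derive x 1 (fun x => x + s) (cst 1 x : R).
  by apply: is_derive_eq; rewrite addr0.
rewrite (ge0_integral_subst_itv a b D _ _ _ mg g0)//.
- by apply: eq_integral => x _; rewrite mule1.
- by move=> x; exact: cvg_cst.
- by move=> y; exists (y - s); rewrite subrK.
Qed.

(** A translation by a multiple of 2 pi brings the left end into [0, 2 pi]. There the interval is
    cut at 2 pi and the piece beyond is moved back by one period. *)
Lemma ge0_integral_period (g : R -> \bar R) (c : R) :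
  measurable_fun setT g -> (forall y, (0 <= g y)%E) ->
  (forall y : R, g (y + 2 * pi)%R = g y) ->
  (\int[mu]_(y in `[c, (c + 2 * pi)%R]) g y = \int[mu]_(y in I) g y)%E.
Proof.
move=> mg g0 pg; have p0 := pi_gt0 R.
have pgz (z : int) (x : R) : g (x + z%:~R * (2 * pi))%R = g x.
  have pgn (n : nat) (y : R) : g (y + n%:R * (2 * pi))%R = g y.
    by elim: n => [|n IH]; rewrite ?mul0r ?addr0// -natr1 mulrDl mul1r addrA pg.
  case: z => n; first exact: pgn.
  by rewrite NegzE mulrNz mulNr
    -[in RHS](subrK (n.+1%:R * (2 * pi)) x) (pgn n.+1).
have base r : 0 <= r <= 2 * pi ->
    (\int[mu]_(y in `[r, (r + 2 * pi)%R]) g y = \int[mu]_(y in I) g y)%E.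
  move=> /andP[r0 r2].
  have split_itv (a b c' : R) : a <= b -> b <= c' ->
     (\int[mu]_(y in `[a, c']) g y =
      \int[mu]_(y in `[a, b]) g y + \int[mu]_(y in `[b, c']) g y)%E.
    move=> ab bc.
    rewrite -(@integral_itv_obnd_cbnd _ b); last exact: measurable_funTS.
    rewrite -ge0_integral_setU//=.
    - by rewrite -itv_bndbnd_setU ?bnd_simp.
    - exact: measurable_funTS.
    - apply/disj_set2P/seteqP; split => x //= [].
      by rewrite !in_itv /= => /andP[_ xb] /andP[bx _]; rewrite ltNge xb in bx.
  rewrite (split_itv r (2 * pi)); [|lra|lra].
  rewrite /circle_itv (split_itv 0 r (2 * pi)) // addeC; congr (_ + _)%E.
  rewrite -{1}[2 * pi]add0r ge0_integral_translation//.
  by apply: eq_integral => x _; rewrite pg.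
pose z := Num.floor (c / (2 * pi)).
have /andP[z1 z2] := floor_itv (c / (2 * pi)).
move: z1 z2; rewrite -/z intrD => z1 z2.
have cE : c = c - z%:~R * (2 * pi) + z%:~R * (2 * pi) by rewrite subrK.
have hE : c = (c / (2 * pi)) * (2 * pi) by rewrite divfK// gt_eqF// mulr_gt0.
have := ge0_integral_translation (z%:~R * (2 * pi)) (c - z%:~R * (2 * pi))
  (c - z%:~R * (2 * pi) + 2 * pi) mg g0.
rewrite (addrAC _ (2 * pi)) -cE => ->.
under eq_integral do rewrite pgz.
rewrite base//; apply/andP; split; rewrite {1}hE; nra.
Qed.

(** The displacement phi - id is periodic, hence bounded by some [M], so [y] lies between the values
    of [phi] at y - M and y + M. *)
Lemma quasi_periodic_surj (phi : R -> R) : continuous phi ->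
  (forall x, phi (x + 2 * pi) = phi x + 2 * pi) -> forall y, exists x, phi x = y.
Proof.
move=> cphi pphi y; have p2 := pi_ge2 R.
have pphi' : periodic (fun x => phi x - x) (2 * pi).
  by move=> x /=; rewrite pphi; ring.
have [M M0 hM] : exists2 M : R, 0 <= M & forall x, `|phi x - x| <= M.
  apply: bounded_periodic pphi' _ => x; apply: cvgB; [exact: cphi | exact: cvg_id].
have [|||x _ <-] := @IVT R phi (y - M) (y + M) y; last by exists x.
- lra.
- exact: continuous_subspaceT.
- have := hM (y - M); have := hM (y + M); rewrite !ler_norml.
  move=> /andP[h1 h2] /andP[h3 h4].
  by rewrite ge_min le_max; apply/andP; split; apply/orP; [left|right]; lra.
Qed.

(** Here [phi] is a lift of a circle diffeomorphism of degree one. It maps [0, 2 pi] onto an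
    interval of length 2 pi starting at [phi 0], and periodicity of [g] moves that interval back. *)
Lemma ge0_circle_subst (phi dphi : R -> R) (g : R -> \bar R) :
  (forall x : R, is_derive x 1 phi (dphi x)) -> (forall x, 0 < dphi x) ->
  continuous dphi -> (forall x, phi (x + 2 * pi) = phi x + 2 * pi) ->
  measurable_fun setT g -> (forall y, (0 <= g y)%E) ->
  (forall y : R, g (y + 2 * pi)%R = g y) ->
  (\int[mu]_(x in I) (g (phi x) * (dphi x)%:E) = \int[mu]_(y in I) g y)%E.
Proof.
move=> D dphi0 cdphi pphi mg g0 pg.
have cphi : continuous phi.
  move=> x; apply: differentiable_continuous; apply/derivable1_diffP.
  by have [] := D x.
rewrite /circle_itv -(ge0_integral_subst_itv 0 (2 * pi) D dphi0 cdphi _ mg g0).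
  by rewrite -{1}[2 * pi]add0r pphi ge0_integral_period.
exact: quasi_periodic_surj.
Qed.

Lemma ge0_circle_translation (g : R -> \bar R) (h : R) :
  measurable_fun setT g -> (forall y, (0 <= g y)%E) ->
  (forall y : R, g (y + 2 * pi)%R = g y) ->
  (\int[mu]_(x in I) g (x + h)%R = \int[mu]_(x in I) g x)%E.
Proof.
move=> mg g0 pg.
rewrite -(ge0_integral_period h mg g0 pg) /circle_itv.
by rewrite addrC -{2}[h]add0r ge0_integral_translation.
Qed.

Lemma circle_translation (f : R -> R) (h : R) :
  measurable_fun setT f -> periodic f (2 * pi) ->
  \int[mu]_(x in I) f (x + h) = \int[mu]_(x in I) f x.
Proof.
move=> mf pf; rewrite /Rintegral; congr fine.
rewrite integralE [RHS]integralE.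
have mef : measurable_fun setT (EFin \o f) by exact/measurable_EFinP.
congr (_ - _)%E.
- rewrite -(@ge0_circle_translation (EFin \o f)^\+%E h)//.
  + by apply: eq_integral => x _; rewrite ?funeposE ?funenegE.
  + exact: measurable_funepos.
  + by move=> y; rewrite !funeposE /= pf.
- rewrite -(@ge0_circle_translation (EFin \o f)^\-%E h)//.
  + by apply: eq_integral => x _; rewrite ?funeposE ?funenegE.
  + exact: measurable_funeneg.
  + by move=> y; rewrite !funenegE /= pf.
Qed.

End CircleIntegral.

(** * Trigonometric polynomials *)

Section Trigpoly.
Variable R : realType.
Local Notation mu := (@lebesgue_measure R).
Local Notation I := (@circle_itv R).
Implicit Types (f g : R -> R) (k n : nat).

Lemma measurable_circle : measurable (I : set (measurableTypeR R)).
Proof. exact: measurable_itv. Qed.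
Hint Resolve measurable_circle : core.

Lemma mu_circle : mu I = (2 * pi)%:E.
Proof.
have p0 := pi_gt0 R.
by rewrite lebesgue_measure_itv /= lte_fin mulr_gt0// oppr0 addr0.
Qed.

Definition circle_int f : R := \int[mu]_(x in I) f x.
Definition circle_L1 f := mu.-integrable I (EFin \o f).

Lemma continuous_L1 f : continuous f -> circle_L1 f.
Proof.
move=> cf; apply: continuous_compact_integrable; first exact: segment_compact.
exact: continuous_subspaceT.
Qed.

Lemma circle_intD f g : circle_L1 f -> circle_L1 g ->
  circle_int (fun x => f x + g x) = circle_int f + circle_int g.
Proof. exact: RintegralD. Qed.

Lemma circle_intZ c f : circle_L1 f ->
  circle_int (fun x => c * f x) = c * circle_int f.
Proof. exact: RintegralZl. Qed.

Lemma circle_L1D f g : circle_L1 f -> circle_L1 g -> circle_L1 (fun x => f x + g x).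
Proof.
move=> f1 g1; have := integrableD measurable_circle f1 g1.
by apply: eq_integrable => // x _; rewrite /= EFinD.
Qed.

Lemma circle_L1Z c f : circle_L1 f -> circle_L1 (fun x => c * f x).
Proof.
move=> f1; have := integrableZl measurable_circle c f1.
by apply: eq_integrable => // x _; rewrite /= EFinM.
Qed.

Lemma circle_L1_sum n (F : 'I_n -> R -> R) : (forall i, circle_L1 (F i)) ->
  circle_L1 (fun x => \sum_(i < n) F i x).
Proof.
move=> F1; elim: n F F1 => [|n IH] F F1.
  rewrite (_ : (fun x => _) = cst 0); last by apply/funext => x; rewrite big_ord0.
  by apply: continuous_L1 => x; exact: cvg_cst.
rewrite (_ : (fun x => _) = fun x => F ord0 x + \sum_(i < n) F (lift ord0 i) x).
  by apply: circle_L1D => //; exact: IH.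
by apply/funext => x; rewrite big_ord_recl.
Qed.

Lemma circle_int_sum n (F : 'I_n -> R -> R) : (forall i, circle_L1 (F i)) ->
  circle_int (fun x => \sum_(i < n) F i x) = \sum_(i < n) circle_int (F i).
Proof.
move=> F1; elim: n F F1 => [|n IH] F F1.
  rewrite big_ord0 /circle_int (_ : (fun x => _) = cst 0).
    by rewrite Rintegral_cst// mul0r.
  by apply/funext => x; rewrite big_ord0.
rewrite big_ord_recl -IH// -circle_intD//; last exact: circle_L1_sum.
by congr circle_int; apply/funext => x; rewrite big_ord_recl.
Qed.

Lemma circle_L1M_bounded f g M : circle_L1 f -> measurable_fun setT g ->
  (forall x, `|g x| <= M) -> circle_L1 (fun x => f x * g x).
Proof.
move=> f1 mg gM.
have := @integrableMl _ _ _ mu I measurable_circle (EFin \o f) g f1.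
apply; first exact: measurable_funTS.
by exists M; split; [exact: num_real | move=> y My x _; apply: le_trans (gM x) (ltW My)].
Qed.

Lemma is_derive_mulc (c x : R) : is_derive x 1 (fun y => c * y) c.
Proof.
have := @is_deriveZ R R^o R^o id c x 1 1 (is_derive_id _ _).
by move=> h; apply: (is_derive_eq h); rewrite /GRing.scale /= mulr1.
Qed.

Lemma is_derive_cosM (c x : R) :
  is_derive x 1 (fun y => cos (c * y)) (- (c * sin (c * x))).
Proof.
have := @is_derive1_comp R cos _ x _ _ (is_derive_cos _) (is_derive_mulc c x).
by move=> h; apply: (is_derive_eq h); rewrite mulNr mulrC.
Qed.

Lemma is_derive_sinM (c x : R) :
  is_derive x 1 (fun y => sin (c * y)) (c * cos (c * x)).
Proof.
have := @is_derive1_comp R sin _ x _ _ (is_derive_sin _) (is_derive_mulc c x).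
by move=> h; apply: (is_derive_eq h); rewrite mulrC.
Qed.

Lemma continuous_cosM (c : R) : continuous (fun y : R => cos (c * y)).
Proof.
move=> x; apply: differentiable_continuous; apply/derivable1_diffP.
by have [] := is_derive_cosM c x.
Qed.

Lemma continuous_sinM (c : R) : continuous (fun y : R => sin (c * y)).
Proof.
move=> x; apply: differentiable_continuous; apply/derivable1_diffP.
by have [] := is_derive_sinM c x.
Qed.

Lemma circle_int_derive (F f : R -> R) :
  (forall x : R, is_derive x 1 F (f x)) -> continuous f ->
  circle_int f = F (2 * pi) - F 0.
Proof.
move=> dF cf; rewrite /circle_int /Rintegral (integral_derive dF cf)//.
by rewrite mulr_ge0// pi_ge0.
Qed.

Lemma cos2npi k : cos (k%:R * (2 * pi)) = 1 :> R.
Proof.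
by rewrite -[k%:R * _]add0r mulr_natl (periodicn (@cos_periodic R)) cos0.
Qed.

Lemma sin2npi k : sin (k%:R * (2 * pi)) = 0 :> R.
Proof.
by rewrite -[k%:R * _]add0r mulr_natl (periodicn (@sin_periodic R)) sin0.
Qed.

Lemma circle_int_cst c : circle_int (cst c) = 2 * pi * c.
Proof.
rewrite /circle_int Rintegral_cst// mulrC; congr (_ * _).
by rewrite -[RHS]/(fine (2 * pi)%:E) -mu_circle.
Qed.

Lemma circle_int_cos k :
  circle_int (fun x => cos (k%:R * x)) = if k == 0%N then 2 * pi else 0.
Proof.
case: k => [|k] /=.
  rewrite -[RHS]mulr1 -circle_int_cst; congr circle_int; apply/funext => x.
  by rewrite mul0r cos0.
have k0 : k.+1%:R != 0 :> R by rewrite pnatr_eq0.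
have D (x : R) : is_derive x 1 (fun x => k.+1%:R^-1 * sin (k.+1%:R * x))
    (cos (k.+1%:R * x)).
  have := is_derive1_comp (is_derive_mulc k.+1%:R^-1 (sin (k.+1%:R * x)))
    (is_derive_sinM k.+1%:R x).
  by move=> h; apply: (is_derive_eq h); rewrite mulKf.
rewrite (circle_int_derive D); last exact: continuous_cosM.
by rewrite sin2npi mulr0 mulr0 sin0 mulr0 subrr.
Qed.

Lemma circle_int_sin k : circle_int (fun x => sin (k%:R * x)) = 0.
Proof.
case: k => [|k].
  rewrite -[RHS](mulr0 (2 * pi)) -circle_int_cst.
  by congr circle_int; apply/funext => x; rewrite mul0r sin0.
have k0 : k.+1%:R != 0 :> R by rewrite pnatr_eq0.
have D (x : R) : is_derive x 1 (fun x => - k.+1%:R^-1 * cos (k.+1%:R * x))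
    (sin (k.+1%:R * x)).
  have := is_derive1_comp (is_derive_mulc (- k.+1%:R^-1) (cos (k.+1%:R * x)))
    (is_derive_cosM k.+1%:R x).
  by move=> h; apply: (is_derive_eq h); rewrite mulrNN mulKf.
rewrite (circle_int_derive D); last exact: continuous_sinM.
by rewrite cos2npi mulr0 cos0 subrr.
Qed.

Lemma circle_L1_cosM (c : R) : circle_L1 (fun x => cos (c * x)).
Proof. exact/continuous_L1/continuous_cosM. Qed.

Lemma circle_L1_sinM (c : R) : circle_L1 (fun x => sin (c * x)).
Proof. exact/continuous_L1/continuous_sinM. Qed.

Let cosBE (k n : nat) (x : R) : cos (k%:R * x - n%:R * x) = cos ((k%:R - n%:R) * x).
Proof. by rewrite mulrBl. Qed.
Let sinBE (k n : nat) (x : R) : sin (k%:R * x - n%:R * x) = sin ((k%:R - n%:R) * x).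
Proof. by rewrite mulrBl. Qed.

Let circle_int_cosB k n :
  circle_int (fun x => cos (k%:R * x - n%:R * x)) = if k == n then 2 * pi else 0.
Proof.
wlog kn : k n / (n <= k)%N.
  move=> H; have [/H//|/ltnW/H] := leqP n k; rewrite eq_sym => <-.
  by congr circle_int; apply/funext => x; rewrite -opprB cosN.
have -> : (k == n) = (k - n == 0)%N by lia.
rewrite -circle_int_cos.
by congr circle_int; apply/funext => x; rewrite natrB// mulrBl.
Qed.

Let circle_int_sinB k n :
  circle_int (fun x => sin (k%:R * x - n%:R * x)) = 0.
Proof.
wlog kn : k n / (n <= k)%N.
  move=> H; have [/H//|/ltnW/H h] := leqP n k.
  transitivity (-1 * circle_int (fun x => sin (n%:R * x - k%:R * x))); last first.
    by rewrite h mulr0.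
  rewrite -circle_intZ; last first.
    by under eq_fun do rewrite sinBE; exact: circle_L1_sinM.
  by congr circle_int; apply/funext => x; rewrite -opprB sinN mulN1r.
rewrite -(circle_int_sin (k - n)).
by congr circle_int; apply/funext => x; rewrite natrB// mulrBl.
Qed.

(** The squared L^2 norm of cos(kx), and of sin(kx) when k > 0. For k = 0 the sine is zero, hence
    the condition [b 0 = 0] on sine coefficients below. *)
Definition trig_norm k : R := if k == 0%N then 2 * pi else pi.

Lemma circle_int_coscos k n :
  circle_int (fun x => cos (k%:R * x) * cos (n%:R * x)) =
  if k == n then trig_norm k else 0.
Proof.
transitivity (circle_int (fun x => 1 / 2 * (cos (k%:R * x - n%:R * x) +
                                       cos ((k + n)%:R * x)))).
  congr circle_int; apply/funext => x; rewrite natrD mulrDl cosB cosD.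
  by field.
rewrite circle_intZ; last first.
  by apply: circle_L1D; under eq_fun do rewrite ?cosBE; exact: circle_L1_cosM.
rewrite circle_intD ?circle_int_cosB ?circle_int_cos//; last 2 first.
- by under eq_fun do rewrite cosBE; exact: circle_L1_cosM.
- exact: circle_L1_cosM.
rewrite /trig_norm addn_eq0; case: eqVneq => [->|kn].
  by case: eqVneq => _ /=; field.
have -> : (k == 0) && (n == 0) = false.
  by apply/negbTE; apply: contra kn => /andP[/eqP-> /eqP->].
by rewrite addr0 mulr0.
Qed.

Lemma circle_int_sinsin k n :
  circle_int (fun x => sin (k%:R * x) * sin (n%:R * x)) =
  if (k == n) && (k != 0%N) then trig_norm k else 0.
Proof.
transitivity (circle_int (fun x => 1 / 2 * (cos (k%:R * x - n%:R * x) +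
                                       -1 * cos ((k + n)%:R * x)))).
  congr circle_int; apply/funext => x; rewrite natrD mulrDl cosB cosD.
  by field.
have L1 := circle_L1_cosM.
rewrite circle_intZ; last first.
  by apply: circle_L1D; [under eq_fun do rewrite ?cosBE|exact: circle_L1Z].
rewrite circle_intD ?circle_intZ ?circle_int_cosB ?circle_int_cos//; last 2 first.
- by under eq_fun do rewrite cosBE.
- exact: circle_L1Z.
rewrite /trig_norm addn_eq0; case: eqVneq => [->|kn].
  by case: eqVneq => _ /=; field.
have -> : (k == 0) && (n == 0) = false.
  by apply/negbTE; apply: contra kn => /andP[/eqP-> /eqP->].
by rewrite !mulr0 addr0 mulr0.
Qed.

Lemma circle_int_sincos k n :
  circle_int (fun x => sin (k%:R * x) * cos (n%:R * x)) = 0.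
Proof.
transitivity (circle_int (fun x => 1 / 2 * (sin (k%:R * x - n%:R * x) +
                                       sin ((k + n)%:R * x)))).
  congr circle_int; apply/funext => x; rewrite natrD mulrDl sinB sinD.
  by field.
have L1 := circle_L1_sinM.
rewrite circle_intZ; last first.
  by apply: circle_L1D => //; under eq_fun do rewrite ?sinBE.
rewrite circle_intD ?circle_int_sinB ?circle_int_sin ?addr0 ?mulr0//.
by under eq_fun do rewrite sinBE.
Qed.

End Trigpoly.
#[global] Hint Resolve measurable_circle : core.

(** * Uniform density of trigonometric polynomials *)

Section Fejer.
Variable R : realType.
Local Notation mu := (@lebesgue_measure R).
Local Notation I := (@circle_itv R).
Implicit Types (f g : R -> R) (k n : nat).

(** Given by closure rules rather than by a list of coefficients: the statements proved about these
    functions are linear in them, so induction reduces each to a single cosine or sine. Constants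
    are multiples of the cosine of frequency 0. *)
Inductive trigpoly : (R -> R) -> Prop :=
| trigpoly_cos k : trigpoly (fun x => cos (k%:R * x))
| trigpoly_sin k : trigpoly (fun x => sin (k%:R * x))
| trigpolyD f g : trigpoly f -> trigpoly g -> trigpoly (fun x => f x + g x)
| trigpolyZ c f : trigpoly f -> trigpoly (fun x => c * f x).

Lemma trigpoly_cst c : trigpoly (cst c).
Proof.
rewrite (_ : cst c = fun x => c * cos (0%:R * x)).
  exact/trigpolyZ/trigpoly_cos.
by apply/funext => x; rewrite mul0r cos0 mulr1.
Qed.

Lemma trigpoly_sum n (F : 'I_n -> R -> R) : (forall i, trigpoly (F i)) ->
  trigpoly (fun x => \sum_(i < n) F i x).
Proof.
move=> F1; elim: n F F1 => [|n IH] F F1.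
  rewrite (_ : (fun x => _) = cst 0); first exact: trigpoly_cst.
  by apply/funext => x; rewrite big_ord0.
rewrite (_ : (fun x => _) = fun x => F ord0 x + \sum_(i < n) F (lift ord0 i) x).
  by apply: trigpolyD => //; exact: IH.
by apply/funext => x; rewrite big_ord_recl.
Qed.

Lemma continuous_trigpoly f : trigpoly f -> continuous f.
Proof.
elim=> [k|k|{}f g _ IHf _ IHg|c {}f _ IHf].
- exact: continuous_cosM.
- exact: continuous_sinM.
- by move=> x; apply: cvgD; [exact: IHf | exact: IHg].
- by move=> x; apply: cvgM; [exact: cvg_cst | exact: IHf].
Qed.

Lemma periodic_cosM k : periodic (fun x : R => cos (k%:R * x)) (2 * pi).
Proof.
move=> x; rewrite mulrDr (mulr_natl (2 * pi) k) (periodicn (@cos_periodic R))//.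
Qed.

Lemma periodic_sinM k : periodic (fun x : R => sin (k%:R * x)) (2 * pi).
Proof.
move=> x; rewrite mulrDr (mulr_natl (2 * pi) k) (periodicn (@sin_periodic R))//.
Qed.

Lemma periodic_trigpoly f : trigpoly f -> periodic f (2 * pi).
Proof.
elim=> [k|k|{}f g _ IHf _ IHg|c {}f _ IHf].
- exact: periodic_cosM.
- exact: periodic_sinM.
- by move=> x; rewrite IHf IHg.
- by move=> x; rewrite IHf.
Qed.

Lemma circle_L1M_cont f g : circle_L1 f -> periodic g (2 * pi) -> continuous g ->
  circle_L1 (fun x => f x * g x).
Proof.
move=> f1 pg cg; have [M _ gM] := bounded_periodic pg cg.
exact: circle_L1M_bounded f1 (continuous_measurable_fun cg) gM.
Qed.

Lemma trigpoly_dirichlet n : trigpoly (dirichlet n).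
Proof.
apply: trigpolyD; first exact: trigpoly_cst.
by apply/trigpolyZ/trigpoly_sum => i; exact: trigpoly_cos.
Qed.

Lemma trigpoly_fejer n : trigpoly (fejer n).
Proof. by apply: trigpoly_sum => i; exact: trigpoly_dirichlet. Qed.

Lemma circle_int_dirichlet n : circle_int (@dirichlet R n) = 2 * pi.
Proof.
have L1 := @circle_L1_cosM R.
rewrite /dirichlet circle_intD ?circle_intZ ?circle_int_cst ?circle_int_sum//.
- rewrite big1 ?mulr0 ?addr0 ?mulr1// => i _; exact: circle_int_cos.
- exact: circle_L1_sum.
- by apply: continuous_L1 => x; exact: cvg_cst.
- exact/circle_L1Z/circle_L1_sum.
Qed.

Lemma circle_int_fejer n : circle_int (@fejer R n) = n%:R * (2 * pi).
Proof.
rewrite /fejer circle_int_sum; last first.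
  by move=> i; exact/continuous_L1/continuous_trigpoly/trigpoly_dirichlet.
under eq_bigr do rewrite circle_int_dirichlet.
by rewrite sumr_const card_ord [RHS]mulr_natl.
Qed.

(** Where sin(h/2) = 0 the closed form of the kernel gives no information, but there every cosine in
    the defining sum equals 1. *)
Lemma fejer_ge0' n (h : R) : 0 <= fejer n h.
Proof.
have [s0|] := eqVneq (sin (h / 2)) 0; last exact: fejer_ge0.
apply: sumr_ge0 => i _; rewrite /dirichlet addr_ge0// mulr_ge0// sumr_ge0// => j _.
have sn k : sin (k%:R * (h / 2)) = 0.
  elim: k => [|k IH]; first by rewrite mul0r sin0.
  by rewrite -natr1 mulrDl mul1r sinD IH s0 mul0r mulr0 addr0.
have := sin_halfX (j.+1%:R * h); rewrite -mulrA sn expr0n mulr0 => h1.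
by have -> : cos (j.+1%:R * h) = 1 by lra.
Qed.

Definition fejer_mean g n x : R :=
  (n%:R * (2 * pi))^-1 * circle_int (fun y => g y * fejer n (x - y)).

Lemma fejerB n (x y : R) : fejer n (x - y) = \sum_(i < n) (1 + 2 * \sum_(j < i)
  (cos (j.+1%:R * x) * cos (j.+1%:R * y) + sin (j.+1%:R * x) * sin (j.+1%:R * y))).
Proof.
apply: eq_bigr => i _; congr (1 + 2 * _); apply: eq_bigr => j _.
by rewrite mulrBr cosB.
Qed.

Lemma trigpoly_fejer_mean g n : circle_L1 g -> trigpoly (fejer_mean g n).
Proof.
move=> g1; rewrite /fejer_mean; apply: trigpolyZ.
have gc k := circle_L1M_cont g1 (periodic_cosM k) (@continuous_cosM R k%:R).
have gs k := circle_L1M_cont g1 (periodic_sinM k) (@continuous_sinM R k%:R).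
have E x (i : 'I_n) : circle_L1 (fun y => g y + 2 * \sum_(j < i)
    (cos (j.+1%:R * x) * (g y * cos (j.+1%:R * y)) +
     sin (j.+1%:R * x) * (g y * sin (j.+1%:R * y)))).
  apply: circle_L1D => //; apply/circle_L1Z/circle_L1_sum => j.
  by apply: circle_L1D; exact: circle_L1Z.
rewrite (_ : (fun x => _) = fun x => \sum_(i < n) (circle_int g + 2 * \sum_(j < i)
    (circle_int (fun y => g y * cos (j.+1%:R * y)) * cos (j.+1%:R * x) +
     circle_int (fun y => g y * sin (j.+1%:R * y)) * sin (j.+1%:R * x)))).
  apply: trigpoly_sum => i; apply: trigpolyD; first exact: trigpoly_cst.
  apply/trigpolyZ/trigpoly_sum => j; apply: trigpolyD; apply: trigpolyZ.
    exact: trigpoly_cos.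
  exact: trigpoly_sin.
apply/funext => x.
transitivity (circle_int (fun y => \sum_(i < n) (g y + 2 * \sum_(j < i)
    (cos (j.+1%:R * x) * (g y * cos (j.+1%:R * y)) +
     sin (j.+1%:R * x) * (g y * sin (j.+1%:R * y)))))).
  congr circle_int; apply/funext => y; rewrite fejerB mulr_sumr.
  apply: eq_bigr => i _; rewrite mulrDr mulr1 mulrCA mulr_sumr; congr (_ + 2 * _).
  by apply: eq_bigr => j _; ring.
rewrite circle_int_sum//; apply: eq_bigr => i _.
have h2 (j : 'I_i) : circle_L1 (fun y =>
    cos (j.+1%:R * x) * (g y * cos (j.+1%:R * y)) +
    sin (j.+1%:R * x) * (g y * sin (j.+1%:R * y))).
  by apply: circle_L1D; exact: circle_L1Z.
rewrite circle_intD//; last exact/circle_L1Z/circle_L1_sum.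
congr (_ + _); rewrite circle_intZ; last exact: circle_L1_sum.
congr (2 * _); rewrite circle_int_sum//; apply: eq_bigr => j _.
rewrite circle_intD; [|exact: circle_L1Z|exact: circle_L1Z].
by rewrite !circle_intZ// mulrC (mulrC (sin _)).
Qed.

Lemma le_circle_int f g : circle_L1 f -> circle_L1 g ->
  (forall x, f x <= g x) -> circle_int f <= circle_int g.
Proof. by move=> f1 g1 fg; apply: le_Rintegral. Qed.

Lemma normr_circle_int f : circle_L1 f ->
  `|circle_int f| <= circle_int (fun x => `|f x|).
Proof. by move=> f1; exact: le_normr_Rintegral. Qed.

Lemma circle_L1_norm f : circle_L1 f -> circle_L1 (fun x => `|f x|).
Proof. by move=> f1; exact: integrable_norm. Qed.

(** The usual splitting into near and far increments is hidden in [increment_bound]: its far term C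
    sin(h/2)^2 cancels the denominator of the kernel and contributes at most C pointwise. After
    division by 2 pi n the total error is at most e/2 + C/n. *)
Lemma trigpoly_dense g e : periodic g (2 * pi) -> continuous g -> 0 < e ->
  exists2 T, trigpoly T & forall x, `|T x - g x| <= e.
Proof.
move=> pg cg e0; have p0 := pi_gt0 R.
have [C C0 gC] := increment_bound pg cg (divr_gt0 e0 (ltr0n R 2)).
have [n nC] : exists n, C <= n.+1%:R * (e / 2).
  exists (Num.trunc (C / (e / 2))).
  by rewrite -ler_pdivrMr ?divr_gt0// ltW// truncnS_gt.
exists (fejer_mean g n.+1); first exact/trigpoly_fejer_mean/continuous_L1.
move=> x; set N : R := n.+1%:R * (2 * pi).
have N0 : 0 < N by rewrite !mulr_gt0.
have cF := continuous_trigpoly (trigpoly_fejer n.+1).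
have pF := periodic_trigpoly (trigpoly_fejer n.+1).
have FN h : fejer n.+1 (- h) = fejer n.+1 h :> R.
  apply: eq_bigr => i _; congr (1 + 2 * _); apply: eq_bigr => j _.
  by rewrite mulrN cosN.
have cgx : continuous (fun h => g (x + h)).
  move=> h; apply: (continuous_comp (f := fun h => x + h)); last exact: cg.
  by apply: cvgD; [exact: cvg_cst|exact: cvg_id].
have shift : circle_int (fun y => g y * fejer n.+1 (x - y)) =
    circle_int (fun h => g (x + h) * fejer n.+1 h).
  rewrite /circle_int -(@circle_translation _ (fun y => g y * fejer n.+1 (x - y)) x).
  - by congr Rintegral; apply/funext => h; rewrite opprD addrCA subrr addr0 FN addrC.
  - apply: continuous_measurable_fun => y; apply: cvgM; first exact: cg.
    apply: (continuous_comp (f := fun h => x - h)); last exact: cF.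
    by apply: cvgB; [exact: cvg_cst|exact: cvg_id].
  - by move=> y; rewrite pg -FN opprB addrAC pF -opprB FN.
have L1gF : circle_L1 (fun h => g (x + h) * fejer n.+1 h).
  apply: continuous_L1 => h; apply: cvgM; [exact: cgx|exact: cF].
have L1F : circle_L1 (fejer n.+1) := continuous_L1 cF.
have -> : fejer_mean g n.+1 x - g x =
    N^-1 * circle_int (fun h => (g (x + h) - g x) * fejer n.+1 h).
  rewrite /fejer_mean shift.
  rewrite [in RHS](_ : (fun h => _) =
     fun h => g (x + h) * fejer n.+1 h + (- g x) * fejer n.+1 h).
    rewrite circle_intD ?circle_intZ ?circle_int_fejer//; last exact: circle_L1Z.
    by rewrite -/N mulrDr; congr (_ + _); field; rewrite gt_eqF.
  by apply/funext => h; rewrite mulrBl mulNr.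
rewrite normrM gtr0_norm ?invr_gt0// mulrC ler_pdivrMr//.
have L1d : circle_L1 (fun h => (g (x + h) - g x) * fejer n.+1 h).
  apply: continuous_L1 => h; apply: cvgM; last exact: cF.
  by apply: cvgB; [exact: cgx|exact: cvg_cst].
apply: le_trans (normr_circle_int L1d) _.
have L1cst (c : R) : circle_L1 (cst c).
  by apply: continuous_L1 => h; exact: cvg_cst.
apply: (@le_trans _ _ (circle_int (fun h => e / 2 * fejer n.+1 h + C))).
  apply: le_circle_int; first exact: circle_L1_norm.
    by apply: circle_L1D; [exact: circle_L1Z | exact: L1cst].
  move=> h; rewrite normrM (ger0_norm (fejer_ge0' _ _)).
  apply: (le_trans (ler_wpM2r (fejer_ge0' _ _) (gC x h))).
  rewrite mulrDl lerD2l -mulrA (mulrC (_ ^+ 2)) fejerE.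
  by rewrite ler_piMr// expr_le1 // sin_max.
rewrite circle_intD; [|exact: circle_L1Z|exact: L1cst].
rewrite circle_intZ// circle_int_fejer circle_int_cst /N.
have p2 : 0 <= 2 * pi :> R by rewrite mulr_ge0// ltW.
by have := ler_wpM2l p2 nC; lra.
Qed.

End Fejer.

(** * Fourier series in L^2 *)

Section Uniqueness.
Variable R : realType.
Local Notation mu := (@lebesgue_measure R).
Local Notation I := (@circle_itv R).
Implicit Types (f g : R -> R) (k n : nat).

Lemma circle_intM_approx f g : circle_L1 f ->
  (forall T, trigpoly T -> circle_int (fun x => f x * T x) = 0) ->
  periodic g (2 * pi) -> continuous g -> circle_int (fun x => f x * g x) = 0.
Proof.
move=> f1 f0 pg cg; set c := circle_int _.
set F := circle_int (fun x => `|f x|).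
have F0 : 0 <= F by apply: Rintegral_ge0.
apply/eqP/negPn/negP => c0.
(* The [+ 1] keeps the quotient defined if [f] has zero L^1 norm; this choice makes |c| <= e F
   impossible, as e F < |c|. *)
have e0 : 0 < `|c| / (2 * (F + 1)) by rewrite divr_gt0 ?normr_gt0 ?mulr_gt0// ltr_wpDl.
have [T tT Tg] := trigpoly_dense pg cg e0; set e := _ / _ in e0 Tg.
have cT := continuous_trigpoly tT; have pT := periodic_trigpoly tT.
have d1 : circle_L1 (fun x => f x * (g x - T x)).
  apply: circle_L1M_cont => //; first by move=> x; rewrite pg pT.
  by move=> x; apply: cvgB; [exact: cg | exact: cT].
have cE : c = circle_int (fun x => f x * (g x - T x)).
  rewrite -[LHS]addr0 -[X in _ + X](mulr0 (-1)) -(f0 T tT).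
  rewrite -circle_intZ; last exact: circle_L1M_cont.
  rewrite -circle_intD; first by congr circle_int; apply/funext => x; ring.
    exact: circle_L1M_cont.
  by apply: circle_L1Z; exact: circle_L1M_cont.
have : `|c| <= e * F.
  rewrite {1}cE; apply: le_trans (normr_circle_int d1) _.
  rewrite -circle_intZ; last exact: circle_L1_norm.
  apply: le_circle_int; [exact: circle_L1_norm|exact/circle_L1Z/circle_L1_norm|].
  by move=> x; rewrite normrM mulrC ler_wpM2r// distrC.
rewrite /e mulrAC ler_pdivlMr ?mulr_gt0 ?ltr_wpDl//.
have : 0 < `|c| by rewrite normr_gt0.
nra.
Qed.

(** The functions min(1, n max(0, p)) are continuous, periodic, bounded by 1 and converge pointwise
    to the indicator of {p > 0}; dominated convergence with majorant |f| concludes. *)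
Lemma circle_int_superlevel f (p : R -> R) : circle_L1 f ->
  (forall T, trigpoly T -> circle_int (fun x => f x * T x) = 0) ->
  periodic p (2 * pi) -> continuous p ->
  circle_int (fun x => f x * \1_[set y | 0 < p y] x) = 0.
Proof.
move=> f1 f0 pp cp.
pose g n x := Num.min 1 (n%:R * Num.max 0 (p x)) : R.
have cg n : continuous (g n).
  move=> x; apply: (@continuous_min R R (cst 1) (fun x => n%:R * Num.max 0 (p x)) x).
    exact: cvg_cst.
  apply: cvgM; first exact: cvg_cst.
  by apply: (@continuous_max R R (cst 0) p x); [exact: cvg_cst | exact: cp].
have pg n : periodic (g n) (2 * pi) by move=> x; rewrite /g pp.
have g01 n x : 0 <= g n x <= 1.
  rewrite /g le_min ler01 ge_min lexx /= andbT mulr_ge0// le_max lexx//.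
have fg0 n : circle_int (fun x => f x * g n x) = 0.
  exact: circle_intM_approx.
have mf : measurable_fun (I : set (measurableTypeR R)) f.
  by apply/measurable_EFinP; exact: measurable_int f1.
have gl x : f x * g n x @[n --> \oo] --> f x * \1_[set y | 0 < p y] x.
  apply: cvgM; first exact: cvg_cst.
  rewrite indicE; have [/[!inE] px|px] := boolP (x \in _).
    apply: cvg_near_cst; near=> n; rewrite /g.
    apply/min_idPl; rewrite max_r ?(ltW px)// -ler_pdivrMr// mul1r.
    near: n; exact: nbhs_infty_ger.
  apply: cvg_near_cst; near=> n; rewrite /g max_l ?mulr0 ?min_r//.
  by rewrite leNgt; apply: contra px; rewrite inE.
have [|||||_ _] := @dominated_convergence _ _ R mu I (@measurable_circle R)
  (fun n x => (f x * g n x)%:E) (fun x => (f x * \1_[set y | 0 < p y] x)%:E)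
  (fun x => `|f x|%:E).
- move=> n; apply/measurable_EFinP/measurable_funM => //.
  by apply: measurable_funTS; exact: (continuous_measurable_fun (cg n)).
- apply/measurable_EFinP/measurable_funM => //.
  apply/measurable_funTS/measurable_indic.
  rewrite -[X in measurable X]setTI.
  have -> : [set y | 0 < p y] = p @^-1` `]0, +oo[.
    by apply/seteqP; split => y /=; rewrite in_itv /= andbT.
  exact: (continuous_measurable_fun cp).
- by apply: aeW => x _; apply/fine_cvgP; split => //=; [exact: nearW|exact: gl].
- exact: circle_L1_norm.
- apply: aeW => x n _; rewrite lee_fin normrM ler_piMr//.
  by have /andP[g0 g1] := g01 n x; rewrite ger0_norm.
move=> /= H; rewrite /circle_int /Rintegral.
move: H; rewrite (_ : (fun n => _) = cst 0%E).
  by move/cvg_lim => <-//; rewrite lim_cst.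
apply/funext => n /=; rewrite -[RHS]/(0%:E) -(fg0 n) /circle_int /Rintegral fineK//.
apply: integrable_fin_num => //; exact: circle_L1M_cont.
Unshelve. all: by end_near. Qed.

Let mem_oo (a b x : R) : (x \in `]a, b[%classic) = (a < x < b).
Proof. by rewrite mem_setE in_itv. Qed.

Let mem_circle (x : R) : (x \in I) = (0 <= x <= 2 * pi).
Proof. by rewrite mem_setE in_itv. Qed.

(** An open arc with midpoint c and half-length r < pi is, within [0, 2 pi], the superlevel set of
    cos(x - c) - cos r, so indicators of arcs are reached from trigonometric polynomials. *)
Lemma circle_int_itv0 f (a b : R) : circle_L1 f ->
  (forall T, trigpoly T -> circle_int (fun x => f x * T x) = 0) ->
  0 <= a -> a < b -> b <= 2 * pi -> b - a < 2 * pi ->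
  \int[mu]_(x in `]a, b[) f x = 0.
Proof.
move=> f1 f0 a0 ab b2 ba.
pose c := (a + b) / 2; pose r := (b - a) / 2.
pose p (x : R) := cos (x - c) - cos r.
have cp : continuous p.
  move=> x; apply: cvgB; last exact: cvg_cst.
  apply: (continuous_comp (f := fun x => x - c)); last exact: continuous_cos.
  by apply: cvgB; [exact: cvg_id|exact: cvg_cst].
have pp : periodic p (2 * pi).
  by move=> x; rewrite /p addrAC cos_periodic.
have := circle_int_superlevel f1 f0 pp cp; rewrite /circle_int => <-.
rewrite Rintegral_mkcond [RHS]Rintegral_mkcond; congr Rintegral.
suff H (x : R) : (f \_ `]a, b[) x =
    ((fun x => f x * \1_[set y | 0 < p y] x) \_ I) x by exact/funext/H.
rewrite !patchE indicE.
have [xI|xI] := boolP (x \in I); last first.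
  case: ifPn => // xab; move: xI; rewrite mem_circle => /negP[]; move: xab.
  rewrite mem_oo => /andP[h1 h2]; apply/andP; split; lra.
have -> : (x \in [set y | 0 < p y]) = (x \in `]a, b[%classic).
  move: xI; rewrite mem_circle mem_oo => /andP[x0 x2].
  have p0 := pi_gt0 R.
  apply/idP/idP; rewrite inE /= /p subr_gt0.
    move=> h; have : `|x - c| < r.
      rewrite -(cos_norm (x - c)) in h; rewrite ltNge; apply/negP => rx.
      have [xp|xp] := leP `|x - c| pi.
        move: rx; rewrite le_eqVlt => /predU1P[rE|rx]; first by rewrite -rE ltxx in h.
        have := ltr_cos; move=> /(_ R r `|x - c|); rewrite !in_itv /= normr_ge0 xp rx /=.
        have -> : (0 <= r <= pi) by rewrite /r; apply/andP; split; lra.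
        by move=> /(_ isT isT); rewrite ltNge (ltW h).
      (* Beyond distance pi the cosine increases again. Reflection to 2 pi - |x - c|, still at least
         [r] because the arc lies in [0, 2 pi], returns to the decreasing branch. *)
      have xr : `|x - c| <= 2 * pi - r by rewrite ler_norml /c /r; apply/andP; split; lra.
      have cE : cos `|x - c| = cos (2 * pi - `|x - c|).
        by rewrite -[RHS]cosN opprB -[RHS]cos_periodic subrK.
      rewrite cE in h; have rx' : r <= 2 * pi - `|x - c| by lra.
      move: rx'; rewrite le_eqVlt => /predU1P[rE|rx']; first by rewrite -rE ltxx in h.
      have := ltr_cos; move=> /(_ R r (2 * pi - `|x - c|)); rewrite !in_itv /=.
      have -> : (0 <= r <= pi) by rewrite /r; apply/andP; split; lra.
      have -> : (0 <= 2 * pi - `|x - c| <= pi) by apply/andP; split; rewrite /r in rx'; lra.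
      by rewrite rx' => /(_ isT isT); rewrite ltNge (ltW h).
    by rewrite ltr_norml /c /r => /andP[h1 h2]; apply/andP; split; lra.
  move=> /andP[xa xb]; rewrite -(cos_norm (x - c)).
  have xr : `|x - c| < r by rewrite ltr_norml /c /r; apply/andP; split; lra.
  rewrite ltr_cos//= in_itv /= ?normr_ge0 /= /r; first by rewrite (le_trans (ltW xr))// /r; lra.
  by apply/andP; split; lra.
by case: ifPn => _; rewrite ?mulr1 ?mulr0.
Qed.

(** The primitive of [f] from 0 vanishes on (0, 2 pi), being an integral over arcs; at each Lebesgue
    point its derivative is the value of [f]. *)
Lemma circle_orthogonal_ae0 f : circle_L1 f ->
  (forall T, trigpoly T -> circle_int (fun x => f x * T x) = 0) ->
  {ae mu, forall x, I x -> f x = 0}.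
Proof.
move=> f1 f0; have p0 := pi_gt0 R.
pose h := f \_ I.
have loch : locally_integrable setT h.
  by apply: integrable_locally_restrict; [exact: measurable_itv | exact: f1].
have [N [mN N0 hN]] := lebesgue_differentiation loch.
(* The primitive is differentiated at interior points only, so both endpoints join the exceptional
   null set. *)
exists (N `|` [set 0] `|` [set 2 * pi]); split.
- by apply: measurableU => //; apply: measurableU.
- apply: null_set_setU => //; first exact: measurableU.
    by apply: null_set_setU => //; exact: lebesgue_measure_set1.
  exact: lebesgue_measure_set1.
move=> x /= /not_implyP[xI fx].
have [x00|x0] := eqVneq x 0; first by left; right.
have [x22|x2] := eqVneq x (2 * pi); first by right.
left; left; apply: contrapT => xN; apply: fx.
have lpx : lebesgue_pt h x by apply: contrapT => nl; apply: xN; exact: hN.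
move: xI; rewrite /circle_itv /= in_itv /= => /andP[x0' x2'].
have {x0'}x0 : 0 < x by rewrite lt_neqAle eq_sym x0.
have {x2'}x2 : x < 2 * pi by rewrite lt_neqAle x2.
have inth (u : R) : mu.-integrable `[0, u] (EFin \o h).
  apply: (@integrableS _ _ _ mu setT) => //.
  by rewrite /h -restrict_EFin -integrable_mkcond.
have [dF] := @FTC1_lebesgue_pt R h (BLeft 0) x (2 * pi) x2 (inth _) x0 lpx.
rewrite {2}/h patchE mem_set ?/circle_itv /= ?in_itv /= ?(ltW x0) ?(ltW x2)// => <-.
rewrite derive1E; apply: derive_val.
have : \forall y \near x, cst (0 : R) y = \int[mu]_(t in `[0, y]) h t.
  near=> y.
  have y0 : 0 < y by near: y; exact: lt_nbhsr.
  have y2 : y < 2 * pi by near: y; exact: lt_nbhsl.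
  rewrite -Rintegral_itv_obnd_cbnd; last by apply: integrableS (inth y) => //; exact: subset_itv_oc_cc.
  rewrite -Rintegral_itv_bndo_bndc; last by apply: integrableS (inth y) => //; exact: subset_itv_oo_cc.
  rewrite -[LHS](circle_int_itv0 f1 f0 (lexx 0) y0 (ltW y2)) ?subr0//.
  apply: eq_Rintegral => t; rewrite inE /= in_itv /= => /andP[t0 ty].
  by rewrite /h patchE mem_set// /circle_itv /= in_itv /= (ltW t0) ltW// (lt_trans ty).
move=> H; apply: near_eq_is_derive H _ => //.
Unshelve. all: by end_near. Qed.

End Uniqueness.

(** * Completeness of L^2 on the circle *)

Section Completeness.
Variable R : realType.
Local Notation mu := (@lebesgue_measure R).
Local Notation I := (@circle_itv R).
Implicit Types (f g : R -> R) (k n : nat).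

Lemma limn_einf_le_near (u : (\bar R)^nat) (e : \bar R) (N : nat) :
  (forall n, (N <= n)%N -> (u n <= e)%E) -> (limn_einf u <= e)%E.
Proof.
move=> ue; rewrite limn_einf_lim; apply: lime_le; first exact: is_cvg_einfs.
apply: nearW => n; apply: le_trans (ue (maxn n N) _); last exact: leq_maxr.
by apply: ereal_inf_lbound; exists (maxn n N) => //=; exact: leq_maxl.
Qed.

Lemma limn_einf_ge0 (u : (\bar R)^nat) :
  (forall n, (0 <= u n)%E) -> (0 <= limn_einf u)%E.
Proof.
move=> u0; rewrite limn_einf_lim; apply: lime_ge; first exact: is_cvg_einfs.
by apply: nearW => n; apply: le_ereal_inf_tmp => _ [k _ <-].
Qed.

Lemma summable_increments_cvg (s : nat -> R) (C : R) :
  (forall n, \sum_(i < n) `|s i.+1 - s i| <= C) -> cvgn s.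
Proof.
move=> sC.
have : cvgn (series (telescope s)).
  apply: normed_cvg; apply: nondecreasing_is_cvgn.
    apply/nondecreasing_seqP => n.
    by rewrite /= seriesSr lerDl.
  by exists C => _ [n _ <-]; apply: le_trans (sC n); rewrite /= seriesEord.
move=> /cvg_ex[l sl]; apply/cvg_ex; exists (s 0%N + l).
have H : (fun n => s 0%N + series (telescope s) n) @ \oo --> s 0%N + l.
  by apply: cvgD => //; exact: cvg_cst.
have E : (fun n => s 0%N + series (telescope s) n) = s.
  by apply/funext => n; rewrite -eq_sum_telescope.
by rewrite E in H.
Qed.

Lemma sum_half_pow n : \sum_(i < n) (2^-1 : R) ^+ i <= 2.
Proof.
suff : \sum_(i < n) (2^-1 : R) ^+ i = 2 - 2 * 2^-1 ^+ n.
  by move=> ->; rewrite gerBl mulr_ge0// exprn_ge0// invr_ge0.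
elim: n => [|n IH]; first by rewrite big_ord0 expr0; ring.
by rewrite big_ord_recr /= IH exprS; field.
Qed.

(** The Riesz-Fischer argument along a rapidly Cauchy subsequence: the increments are summable
    almost everywhere, and Fatou's lemma turns pointwise convergence into convergence in L^2. The
    limit is needed as an everywhere defined, measurable and exactly periodic function. *)
Lemma circle_L2_complete (S : nat -> R -> R) :
  (forall n, measurable_fun setT (S n)) ->
  (forall n, periodic (S n) (2 * pi)) ->
  (forall e : R, 0 < e -> exists N, forall n m, (N <= n)%N -> (N <= m)%N ->
     (\int[mu]_(x in I) (((S n x - S m x) ^+ 2)%:E) <= e%:E)%E) ->
  exists w : R -> R, [/\ measurable_fun setT w, periodic w (2 * pi) &
    forall e : R, 0 < e -> exists N, forall n, (N <= n)%N ->
     (\int[mu]_(x in I) (((w x - S n x) ^+ 2)%:E) <= e%:E)%E].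
Proof.
move=> mS pS cS; have p0 := pi_gt0 R.
have h0 i : 0 < (2^-1 : R) ^+ i by rewrite exprn_gt0// invr_gt0.
have /choice[N hN] : forall i, exists N, forall n m, (N <= n)%N -> (N <= m)%N ->
    (\int[mu]_(x in I) (((S n x - S m x) ^+ 2)%:E) <= ((2^-1 ^+ i) ^+ 2)%:E)%E.
  by move=> i; apply: cS; exact: exprn_gt0.
(* Partial sums of the thresholds: they are monotone, dominate each [N i], and tend to infinity
   because every summand is a successor. *)
pose nn i := (\sum_(j < i.+1) (N j).+1)%N.
have nnN i : (N i <= nn i)%N.
  by rewrite /nn big_ord_recr /= (leq_trans (leqnSn _))// leq_addl.
have nni i : (i <= nn i)%N.
  elim: i => [//|i IH].
  by rewrite /nn big_ord_recr /= -/(nn i) addnS ltnS (leq_trans IH)// leq_addr.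
have nnS i : (nn i <= nn i.+1)%N.
  by rewrite [X in (_ <= X)%N]/nn big_ord_recr /= leq_addr.
pose s i := S (nn i).
pose D i x := `|s i.+1 x - s i x|.
have mD i : measurable_fun setT (D i).
  by apply: measurableT_comp => //; apply: measurable_funB; exact: mS.
have mDI i : measurable_fun (I : set (measurableTypeR R)) (EFin \o D i).
  by apply/measurable_EFinP; apply: measurable_funTS; exact: mD.
have mdiff n m : measurable_fun (I : set (measurableTypeR R))
    (fun x => ((S n x - S m x) ^+ 2)%:E).
  apply/measurable_EFinP; apply: measurable_funTS.
  by apply: measurable_funX; apply: measurable_funB; exact: mS.
(* In place of Cauchy-Schwarz, |d| <= h/2 + d^2/(2h) with h = 2^(-i). The integral is then at most
   pi h + h/2, which is below (pi + 1) h. *)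
have DI i : (\int[mu]_(x in I) (D i x)%:E <= ((pi + 1) * 2^-1 ^+ i)%:E)%E.
  set h := 2^-1 ^+ i : R.
  have hh := h0 i; rewrite -/h in hh.
  apply: (@le_trans _ _ (\int[mu]_(x in I) ((2^-1 * h)%:E +
     (2^-1 * h^-1)%:E * ((s i.+1 x - s i x) ^+ 2)%:E))%E).
    apply: ge0_le_integral => //.
    - by move=> x _; rewrite lee_fin /D.
    - exact: mDI.
    - apply: emeasurable_funD; first exact: measurable_cst.
      by apply: emeasurable_funM; [exact: measurable_cst | exact: mdiff].
    move=> x _; rewrite -EFinM -EFinD lee_fin /D; set d := _ - _.
    rewrite -(real_normK (num_real d)).
    have : 0 <= (2^-1 * h^-1) * (`|d| - h) ^+ 2.
      by rewrite mulr_ge0 ?sqr_ge0// mulr_ge0 ?invr_ge0// ltW.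
    have -> : 2^-1 * h^-1 * (`|d| - h) ^+ 2 =
       2^-1 * h + 2^-1 * h^-1 * `|d| ^+ 2 - `|d|.
      by field; rewrite gt_eqF.
    lra.
  rewrite ge0_integralD//; first last.
  - by apply: emeasurable_funM; [exact: measurable_cst | exact: mdiff].
  - by move=> x _; rewrite -EFinM lee_fin mulr_ge0 ?sqr_ge0// mulr_ge0 ?invr_ge0// ltW.
  - by move=> x _; rewrite lee_fin mulr_ge0 ?invr_ge0// ltW.
  rewrite integral_cst// ge0_integralZl_EFin//; first last.
  - by rewrite mulr_ge0 ?invr_ge0// ltW.
  - exact: mdiff.
  - by move=> x _; rewrite lee_fin sqr_ge0.
  have -> : ((pi + 1) * h)%:E =
     ((2^-1 * h)%:E * (2 * pi)%:E + (2^-1 * h^-1)%:E * (2 * h ^+ 2)%:E)%E.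
    by rewrite -!EFinM -EFinD; congr (_%:E); field; rewrite gt_eqF.
  apply: leeD; first by rewrite -mu_circle.
  apply: lee_wpmul2l; first by rewrite lee_fin mulr_ge0 ?invr_ge0// ltW.
  apply: (@le_trans _ _ ((h ^+ 2)%:E)).
    by apply: hN; [exact: leq_trans (nnN i) (nnS i) | exact: nnN].
  by rewrite lee_fin; have := sqr_ge0 h; lra.
have D0 i x : (0 <= (D i x)%:E)%E by rewrite lee_fin /D.
pose F x := (\sum_(i <oo) (D i x)%:E)%E.
have F0 x : (0 <= F x)%E by apply: nneseries_ge0.
have mF : measurable_fun (I : set (measurableTypeR R)) F.
  apply: (ge0_emeasurable_sum (h := fun i x => (D i x)%:E) (P := xpredT)).
    by move=> i x _ _; exact: D0.
  by move=> i _; exact: mDI.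
have iF : mu.-integrable I F.
  apply/integrableP; split => //.
  under eq_integral do rewrite gee0_abs//.
  rewrite /F integral_nneseries//.
  apply: (@le_lt_trans _ _ (((pi + 1) * 2)%:E)); last exact: ltry.
  apply: lime_le.
    apply: is_cvg_nneseries => i _ _; exact: integral_ge0.
  apply: nearW => n; rewrite big_mkord.
  apply: (@le_trans _ _ (\sum_(i < n) ((pi + 1) * 2^-1 ^+ i)%:E)%E).
    by apply: lee_sum => i _; exact: DI.
  rewrite sumEFin lee_fin -mulr_sumr ler_wpM2l ?sum_half_pow//.
  by rewrite addr_ge0// ltW.
have aeF := integrable_ae (@measurable_circle R) iF.
(* The upper limit exists at every point and inherits measurability and periodicity from the
   sequence, so no null set has to be modified; [fine] supplies 0 where it is infinite. *)
pose w x := fine (limn_esup (fun i => (s i x)%:E)).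
have w_lim x : F x \is a fin_num -> s^~ x @ \oo --> w x.
  move=> Fx.
  have /cvg_ex[l sl] : cvgn (s^~ x).
    apply: (@summable_increments_cvg _ (fine (F x))) => n.
    rewrite -lee_fin fineK// -sumEFin -(big_mkord xpredT (fun i => (D i x)%:E)).
    by apply: nneseries_lim_ge.
  have esl : (fun i => (s i x)%:E) @ \oo --> l%:E.
    by apply/fine_cvgP; split => //=; exact: nearW.
  by rewrite /w is_cvg_limn_esupE ?(cvg_lim _ esl)//; apply/cvg_ex; exists l%:E.
have mw : measurable_fun [set: R] w.
  apply: measurableT_comp; first exact: fine_measurable.
  apply: measurable_fun_limn_esup => i; apply/measurable_EFinP; exact: mS.
have pw : periodic w (2 * pi).
  by move=> x; rewrite /w; congr (fine (limn_esup _)); apply/funext => i; rewrite /s pS.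
exists w; split => // e e0; have [M hM] := cS e e0; exists M => n Mn.
(* Writing the square as a lower limit prepares Fatou's lemma: for fixed [n], the distance from [w]
   to [S n] is bounded by the lower limit of distances along the subsequence, each at most [e]. *)
have aeE : ae_eq mu I (fun x => ((w x - S n x) ^+ 2)%:E)
    (fun x => limn_einf (fun i => ((s i x - S n x) ^+ 2)%:E)).
  apply: filterS aeF => x Fx xI; have {}Fx := Fx xI.
  have c : (fun i => ((s i x - S n x) ^+ 2)%:E) @ \oo --> ((w x - S n x) ^+ 2)%:E.
    apply/fine_cvgP; split => /=; first exact: nearW.
    have c1 : (fun i => s i x - S n x) @ \oo --> w x - S n x.
      by apply: cvgB; [exact: w_lim | exact: cvg_cst].
    exact: (cvgM c1 c1).
  rewrite is_cvg_limn_einfE; first by rewrite (cvg_lim _ c).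
  by apply/cvg_ex; eexists; exact: c.
have mlim : measurable_fun (I : set (measurableTypeR R))
   (fun x => limn_einf (fun i => ((s i x - S n x) ^+ 2)%:E)).
  apply: measurableT_comp => //; apply: measurable_fun_limn_esup => i.
  by apply: measurableT_comp => //; exact: mdiff.
rewrite (ge0_ae_eq_integral _ _ mlim _ _ aeE)//.
- have := @fatou _ _ _ mu I (@measurable_circle R)
    (fun i x => ((s i x - S n x) ^+ 2)%:E) (fun i => mdiff _ _).
  move=> /(_ (fun i x _ => _))/le_trans; apply.
    by move=> i x; rewrite lee_fin sqr_ge0.
  apply: (@limn_einf_le_near _ _ M) => i Mi; apply: hM => //.
  exact: leq_trans Mi (nni i).
- apply/measurable_EFinP; apply: measurable_funTS.
  by apply: measurable_funX; apply: measurable_funB; [exact: mw | exact: mS].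
- by move=> x _; rewrite lee_fin sqr_ge0.
- move=> x _; apply: limn_einf_ge0 => i; by rewrite lee_fin sqr_ge0.
Qed.

End Completeness.

(** * Fourier coefficients, Riesz-Fischer and Parseval *)

Section Parseval.
Variable R : realType.
Local Notation mu := (@lebesgue_measure R).
Local Notation I := (@circle_itv R).
Implicit Types (f g : R -> R) (k n l : nat) (a b : nat -> R).

Definition circle_L2 f := [/\ periodic f (2 * pi), measurable_fun [set: R] f &
  circle_L1 (fun x => f x ^+ 2)].

Lemma circle_L1_le f g : measurable_fun [set: R] f -> circle_L1 g ->
  (forall x, `|f x| <= g x) -> circle_L1 f.
Proof.
move=> mf g1 fg; apply: (le_integrable _ _ _ g1) => //.
  by apply/measurable_EFinP; apply: measurable_funTS; exact: mf.
move=> x _ /=; rewrite lee_fin; apply: (le_trans (fg x)); exact: ler_norm.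
Qed.

Lemma circle_L1_cst c : circle_L1 (cst c : R -> R).
Proof. by apply: continuous_L1 => x; exact: cvg_cst. Qed.

Lemma circle_L1M f g : measurable_fun [set: R] f -> measurable_fun [set: R] g ->
  circle_L1 (fun x => f x ^+ 2) -> circle_L1 (fun x => g x ^+ 2) ->
  circle_L1 (fun x => f x * g x).
Proof.
move=> mf mg f2 g2; apply: circle_L1_le (circle_L1D f2 g2) _.
  exact: measurable_funM.
move=> x; rewrite normrM -(real_normK (num_real (f x))) -(real_normK (num_real (g x))).
have := sqr_ge0 (`|f x| - `|g x|); rewrite sqrrB => h.
have := mulr_ge0 (normr_ge0 (f x)) (normr_ge0 (g x)); lra.
Qed.

Lemma circle_L2_L1 f : circle_L2 f -> circle_L1 f.
Proof.
move=> [_ mf f2]; rewrite (_ : f = fun x => f x * cst 1 x); last first.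
  by apply/funext => x; rewrite mulr1.
apply: circle_L1M => //; rewrite (_ : (fun x => _) = cst (1 ^+ 2))//.
exact: circle_L1_cst.
Qed.

Lemma circle_L2_cont f : periodic f (2 * pi) -> continuous f -> circle_L2 f.
Proof.
move=> pf cf; split => //; first exact: continuous_measurable_fun.
by apply: continuous_L1 => x; exact: (cvgM (cf x) (cf x)).
Qed.

Lemma circle_L2D f g : circle_L2 f -> circle_L2 g -> circle_L2 (fun x => f x + g x).
Proof.
move=> [pf mf f2] [pg mg g2]; split.
- by move=> x; rewrite pf pg.
- exact: measurable_funD.
rewrite (_ : (fun x => _) = fun x => f x ^+ 2 + (2 * (f x * g x) + g x ^+ 2)).
  apply: circle_L1D => //; apply: circle_L1D => //; apply: circle_L1Z.
  exact: circle_L1M.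
by apply/funext => x; ring.
Qed.

Lemma circle_L2Z c f : circle_L2 f -> circle_L2 (fun x => c * f x).
Proof.
move=> [pf mf f2]; split.
- by move=> x; rewrite pf.
- exact: measurable_funM.
rewrite (_ : (fun x => _) = fun x => c ^+ 2 * f x ^+ 2); first exact: circle_L1Z.
by apply/funext => x; rewrite exprMn.
Qed.

Lemma circle_L2B f g : circle_L2 f -> circle_L2 g -> circle_L2 (fun x => f x - g x).
Proof.
move=> f2 g2; rewrite (_ : (fun x => _) = fun x => f x + -1 * g x).
  exact: circle_L2D f2 (circle_L2Z (-1) g2).
by apply/funext => x; rewrite mulN1r.
Qed.

Lemma circle_L2_translation f h : circle_L2 f -> circle_L2 (fun x => f (x + h)).
Proof.
move=> [pf mf f2].
have mh : measurable_fun [set: R] (fun x : R => x + h) by exact: measurable_funD.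
have mfh : measurable_fun [set: R] (fun x => f (x + h)) := measurableT_comp mf mh.
split => //; first by move=> x; rewrite addrAC pf.
apply/integrableP; split.
  apply/measurable_EFinP/measurable_funTS; exact: (measurable_funX 2 mfh).
have /integrableP[_] := f2; apply: le_lt_trans; rewrite le_eqVlt; apply/orP; left.
apply/eqP; have := @ge0_circle_translation R (fun x => `|(f x ^+ 2)%:E|)%E h.
apply.
- by apply: measurableT_comp => //; apply/measurable_EFinP/measurable_funX.
- by move=> y.
- by move=> y; rewrite pf.
Qed.

(** Plain integrals, without normalising factor: the division by [trig_norm] is made in [trig_sum]
    and [trig_energy] instead, and by 2 pi in passing to [fourier]. *)
Definition ccos f k := circle_int (fun x => f x * cos (k%:R * x)).
Definition csin f k := circle_int (fun x => f x * sin (k%:R * x)).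

Lemma csin0 f : csin f 0 = 0.
Proof.
rewrite /csin -[RHS](mulr0 (2 * pi)) -circle_int_cst; congr circle_int.
by apply/funext => x; rewrite mul0r sin0 mulr0.
Qed.

Definition trig_sum a b n x : R :=
  \sum_(k < n) (trig_norm R k)^-1 * (a k * cos (k%:R * x) + b k * sin (k%:R * x)).

Definition trig_energy a b n : R :=
  \sum_(k < n) (trig_norm R k)^-1 * (a k ^+ 2 + b k ^+ 2).

Lemma trig_norm_gt0 k : 0 < trig_norm R k.
Proof. by have p0 := pi_gt0 R; rewrite /trig_norm; case: ifP => _; rewrite ?mulr_gt0. Qed.

Lemma trigpoly_trig_sum a b n : trigpoly (trig_sum a b n).
Proof.
apply: trigpoly_sum => k; apply: trigpolyZ; apply: trigpolyD; apply: trigpolyZ.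
  exact: trigpoly_cos.
exact: trigpoly_sin.
Qed.

Lemma circle_L2_trigpoly T : trigpoly T -> circle_L2 T.
Proof.
move=> tT; apply: circle_L2_cont; first exact: periodic_trigpoly.
exact: continuous_trigpoly.
Qed.

Lemma circle_L1_cos f k : circle_L1 f -> circle_L1 (fun x => f x * cos (k%:R * x)).
Proof.
by move=> f1; apply: circle_L1M_cont => //; [exact: periodic_cosM | exact: continuous_cosM].
Qed.

Lemma circle_L1_sin f k : circle_L1 f -> circle_L1 (fun x => f x * sin (k%:R * x)).
Proof.
by move=> f1; apply: circle_L1M_cont => //; [exact: periodic_sinM | exact: continuous_sinM].
Qed.

Lemma circle_intB f g : circle_L1 f -> circle_L1 g ->
  circle_int (fun x => f x - g x) = circle_int f - circle_int g.
Proof. exact: RintegralB. Qed.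

Lemma circle_int_trig_sum f a b n : circle_L1 f ->
  circle_int (fun x => f x * trig_sum a b n x) =
  \sum_(k < n) (trig_norm R k)^-1 * (a k * ccos f k + b k * csin f k).
Proof.
move=> f1; have fc k := circle_L1_cos k f1; have fs k := circle_L1_sin k f1.
rewrite (_ : (fun x => _) = fun x => \sum_(k < n) (trig_norm R k)^-1 *
   (a k * (f x * cos (k%:R * x)) + b k * (f x * sin (k%:R * x)))).
  rewrite circle_int_sum; last first.
    by move=> k; apply: circle_L1Z; apply: circle_L1D; exact: circle_L1Z.
  apply: eq_bigr => k _; rewrite circle_intZ; last first.
    by apply: circle_L1D; exact: circle_L1Z.
  by rewrite circle_intD ?circle_intZ//; exact: circle_L1Z.
apply/funext => x; rewrite /trig_sum mulr_sumr; apply: eq_bigr => k _; ring.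
Qed.

Lemma ccos_trig_sum a b n l : ccos (trig_sum a b n) l = if (l < n)%N then a l else 0.
Proof.
rewrite /ccos; under eq_fun do rewrite mulrC.
rewrite circle_int_trig_sum; last exact: circle_L1_cosM.
under eq_bigr => k _.
  rewrite /ccos /csin circle_int_coscos.
  under [X in circle_int X]eq_fun do rewrite mulrC.
  rewrite circle_int_sincos mulr0 addr0; over.
case: ltnP => ln; last first.
  apply: big1 => k _; case: eqVneq => [lk|]; last by rewrite !mulr0.
  by have := ltn_ord k; rewrite -lk ltnNge ln.
rewrite (bigD1 (Ordinal ln))//= eqxx mulrCA mulVf ?gt_eqF ?trig_norm_gt0//.
rewrite mulr1 big1 ?addr0// => k kl.
case: eqVneq => [lk|]; last by rewrite !mulr0.
by move/eqP: kl; case; apply: val_inj.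
Qed.

Lemma csin_trig_sum a b n l : b 0%N = 0 ->
  csin (trig_sum a b n) l = if (l < n)%N then b l else 0.
Proof.
move=> b0; rewrite /csin; under eq_fun do rewrite mulrC.
rewrite circle_int_trig_sum; last exact: circle_L1_sinM.
under eq_bigr => k _.
  rewrite /ccos /csin circle_int_sincos circle_int_sinsin mulr0 add0r; over.
case: ltnP => ln; last first.
  apply: big1 => k _; case: eqVneq => [lk|]; last by rewrite !mulr0.
  by have := ltn_ord k; rewrite -lk ltnNge ln.
rewrite (bigD1 (Ordinal ln))//= eqxx /= big1 ?addr0; last first.
  move=> k kl; case: eqVneq => [lk|]; last by rewrite !mulr0.
  by move/eqP: kl; case; apply: val_inj.
case: eqVneq => [->|_] /=; first by rewrite b0 mul0r mulr0.
by rewrite mulrCA mulVf ?gt_eqF ?trig_norm_gt0// mulr1.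
Qed.

Lemma circle_int_trig_sum_sqr a b n : b 0%N = 0 ->
  circle_int (fun x => trig_sum a b n x ^+ 2) = trig_energy a b n.
Proof.
move=> b0; under eq_fun do rewrite expr2.
rewrite circle_int_trig_sum; last first.
  exact/continuous_L1/continuous_trigpoly/trigpoly_trig_sum.
apply: eq_bigr => k _; rewrite ccos_trig_sum csin_trig_sum// ltn_ord.
by rewrite !expr2.
Qed.

Lemma circle_int_residual f a b n : circle_L2 f -> b 0%N = 0 ->
  (forall k, (k < n)%N -> ccos f k = a k) -> (forall k, (k < n)%N -> csin f k = b k) ->
  circle_int (fun x => (f x - trig_sum a b n x) ^+ 2) =
  circle_int (fun x => f x ^+ 2) - trig_energy a b n.
Proof.
move=> f2 b0 fa fb; have f1 := circle_L2_L1 f2; have [pf mf ff] := f2.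
have [pS mS SS] := circle_L2_trigpoly (trigpoly_trig_sum a b n).
have fS := circle_L1M mf mS ff SS.
rewrite (_ : (fun x => _) = fun x => f x ^+ 2 + (-2 * (f x * trig_sum a b n x) +
  trig_sum a b n x ^+ 2)); last by apply/funext => x; ring.
rewrite circle_intD//; last by apply: circle_L1D => //; exact: circle_L1Z.
rewrite circle_intD ?circle_intZ//; last exact: circle_L1Z.
rewrite circle_int_trig_sum_sqr// circle_int_trig_sum//.
rewrite (_ : \sum_(k < n) _ = trig_energy a b n); first by ring.
by apply: eq_bigr => k _; rewrite fa// fb// !expr2.
Qed.

Lemma trig_sumB a b n m : (n <= m)%N ->
  (fun x => trig_sum a b m x - trig_sum a b n x) =
  trig_sum (fun k => if (k < n)%N then 0 else a k)
           (fun k => if (k < n)%N then 0 else b k) m.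
Proof.
move=> nm; apply/funext => x; rewrite /trig_sum.
rewrite (big_ord_widen m (fun k => (trig_norm R k)^-1 *
  (a k * cos (k%:R * x) + b k * sin (k%:R * x))) nm).
rewrite [X in _ - X]big_mkcond /= -sumrB; apply: eq_bigr => k _.
by case: ifP => _; ring.
Qed.

Lemma trig_energyB a b n m : (n <= m)%N ->
  trig_energy a b m - trig_energy a b n =
  trig_energy (fun k => if (k < n)%N then 0 else a k)
           (fun k => if (k < n)%N then 0 else b k) m.
Proof.
move=> nm; rewrite /trig_energy.
rewrite (big_ord_widen m (fun k => (trig_norm R k)^-1 * (a k ^+ 2 + b k ^+ 2)) nm).
rewrite [X in _ - X]big_mkcond /= -sumrB; apply: eq_bigr => k _.
by case: ifP => _; ring.
Qed.

Lemma trig_energy_nd a b : nondecreasing_seq (trig_energy a b).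
Proof.
apply/nondecreasing_seqP => n; rewrite /trig_energy big_ord_recr /= lerDl.
by rewrite mulr_ge0 ?invr_ge0 ?(ltW (trig_norm_gt0 _))// addr_ge0// sqr_ge0.
Qed.

Lemma circle_int_fin f : circle_L1 f ->
  (\int[mu]_(x in I) (f x)%:E = (circle_int f)%:E)%E.
Proof. by move=> f1; rewrite /circle_int /Rintegral fineK//; exact: integrable_fin_num. Qed.

(** Besides existence this delivers Parseval's identity for the function it constructs, because the
    residual is the L^2 distance to partial sums already known to converge. The general identity is
    deduced from this one. *)
Lemma Riesz_Fischer a b C : b 0%N = 0 -> (forall n, trig_energy a b n <= C) ->
  exists w, [/\ circle_L2 w, forall k, ccos w k = a k, forall k, csin w k = b k &
    trig_energy a b @ \oo --> circle_int (fun x => w x ^+ 2)].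
Proof.
move=> b0 aC; have p0 := pi_gt0 R.
pose S := trig_sum a b.
have S2 n : circle_L2 (S n) := circle_L2_trigpoly (trigpoly_trig_sum a b n).
have cE : cvgn (trig_energy a b).
  apply: nondecreasing_is_cvgn; first exact: trig_energy_nd.
  by exists C => _ [n _ <-].
have SE n m : (n <= m)%N -> circle_int (fun x => (S m x - S n x) ^+ 2) =
    trig_energy a b m - trig_energy a b n.
  move=> nm; rewrite trig_energyB// -circle_int_trig_sum_sqr ?b0 ?if_same//.
  congr circle_int; apply/funext => x; congr (_ ^+ 2).
  by rewrite -(trig_sumB a b nm).
have cauchyS (e : R) : 0 < e -> exists N, forall n m, (N <= n)%N -> (N <= m)%N ->
     (\int[mu]_(x in I) (((S n x - S m x) ^+ 2)%:E) <= e%:E)%E.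
  move=> e0.
  have /cvgrPdist_le/(_ e e0)[N _ hN] := cE; exists N.
  suff H n m : (N <= n)%N -> (n <= m)%N ->
      (\int[mu]_(x in I) (((S m x - S n x) ^+ 2)%:E) <= e%:E)%E.
    move=> n m Nn Nm; have [nm|/ltnW mn] := leqP n m; last exact: H.
    under eq_integral do rewrite -sqrrN opprB; exact: H.
  move=> Nn nm.
  have [_ _ Sd] := circle_L2B (S2 m) (S2 n).
  rewrite circle_int_fin// lee_fin SE//.
  have := hN n Nn; rewrite ler_norml => /andP[_].
  have := nondecreasing_cvgn_le (@trig_energy_nd a b) cE m; lra.
have [w [mw pw wS]] := circle_L2_complete
  (fun n => let: And3 _ h _ := S2 n in h) (fun n => let: And3 h _ _ := S2 n in h) cauchyS.
have wS1 n : measurable_fun [set: R] (fun x => w x - S n x).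
  by apply: measurable_funB => //; have [] := S2 n.
have wS2 n : (\int[mu]_(x in I) (((w x - S n x) ^+ 2)%:E) < +oo)%E ->
    circle_L1 (fun x => (w x - S n x) ^+ 2).
  move=> h; apply/integrableP; split.
    by apply/measurable_EFinP/measurable_funTS; apply: measurable_funX; exact: wS1.
  by under eq_integral do rewrite gee0_abs ?lee_fin ?sqr_ge0//.
have w2 : circle_L2 w.
  have [N hN] := wS 1 ltr01.
  have h : circle_L2 (fun x => w x - S N x).
    split; last by apply: wS2; apply: le_lt_trans (hN N (leqnn N)) _; exact: ltry.
      by move=> x; rewrite pw; have [-> _ _] := S2 N.
    exact: wS1.
  have := circle_L2D h (S2 N); congr circle_L2; apply/funext => x; exact: subrK.
have w1 := circle_L2_L1 w2.
(* L^2 convergence passes to integrals against functions bounded by 1, again through |d| <= h/2 +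
   d^2/(2h), here with h = e / (2 pi). *)
have lim0 (c : R -> R) : periodic c (2 * pi) -> continuous c ->
    (forall x, `|c x| <= 1) ->
    circle_int (fun x => S n x * c x) @[n --> \oo] --> circle_int (fun x => w x * c x).
  move=> pc cc c1; apply/cvgrPdist_le => e e0.
  pose h : R := e / (2 * pi).
  have h0 : 0 < h by rewrite divr_gt0 ?mulr_gt0.
  have [N hN] := wS (h * e) (mulr_gt0 h0 e0).
  exists N => // n /= Nn; have {}hN := hN n Nn.
  have dn : circle_L2 (fun x => w x - S n x) := circle_L2B w2 (S2 n).
  have [_ _ d2] := dn.
  rewrite -circle_intB; try exact: circle_L1M_cont => //; last first.
    by apply: circle_L1M_cont => //; exact: circle_L2_L1.
  have d1 : circle_L1 (fun x => w x * c x - S n x * c x).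
    rewrite (_ : (fun x => _) = fun x => (w x - S n x) * c x).
      by apply: circle_L1M_cont => //; exact: circle_L2_L1.
    by apply/funext => x; rewrite mulrBl.
  apply: le_trans (normr_circle_int d1) _.
  apply: (@le_trans _ _ (circle_int (fun x => (2^-1 * h) +
       (2^-1 * h^-1) * ((w x - S n x) ^+ 2)))).
    apply: le_circle_int; first exact: circle_L1_norm.
      by apply: circle_L1D; [exact: circle_L1_cst | exact: circle_L1Z].
    move=> x; rewrite -mulrBl normrM; set d := w x - S n x.
    apply: (@le_trans _ _ `|d|); first by rewrite ler_piMr.
    rewrite -(real_normK (num_real d)).
    have : 0 <= (2^-1 * h^-1) * (`|d| - h) ^+ 2.
      by rewrite mulr_ge0 ?sqr_ge0// mulr_ge0 ?invr_ge0// ltW.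
    have -> : 2^-1 * h^-1 * (`|d| - h) ^+ 2 =
       2^-1 * h + 2^-1 * h^-1 * `|d| ^+ 2 - `|d|.
      by field; rewrite gt_eqF.
    lra.
  rewrite circle_intD; [|exact: circle_L1_cst|exact: circle_L1Z].
  rewrite circle_int_cst circle_intZ//.
  have : circle_int (fun x => (w x - S n x) ^+ 2) <= h * e.
    by rewrite -lee_fin -circle_int_fin.
  have he : h * (2 * pi) = e by rewrite /h divfK// gt_eqF// mulr_gt0.
  have -> : 2 * pi * (2^-1 * h) = e / 2 by rewrite -he; field.
  move=> H; have : 2^-1 * h^-1 * circle_int (fun x => (w x - S n x) ^+ 2) <=
     2^-1 * h^-1 * (h * e).
    by rewrite ler_wpM2l// mulr_ge0 ?invr_ge0// ltW.
  have -> : 2^-1 * h^-1 * (h * e) = e / 2 by field; rewrite gt_eqF.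
  lra.
have wa k : ccos w k = a k.
  have H := lim0 _ (periodic_cosM k) (@continuous_cosM R k%:R) (fun x => cos_max _).
  rewrite /ccos -(cvg_lim _ H)//; apply/cvg_lim => //; apply: cvg_near_cst.
  near=> n; rewrite -[LHS]/(ccos (S n) k) ccos_trig_sum.
  by rewrite ifT//; near: n; exact: nbhs_infty_gt.
have wb k : csin w k = b k.
  have H := lim0 _ (periodic_sinM k) (@continuous_sinM R k%:R) (fun x => sin_max _).
  rewrite /csin -(cvg_lim _ H)//; apply/cvg_lim => //; apply: cvg_near_cst.
  near=> n; rewrite -[LHS]/(csin (S n) k) csin_trig_sum//.
  by rewrite ifT//; near: n; exact: nbhs_infty_gt.
exists w; split => //; apply/cvgrPdist_le => e e0.
have [N hN] := wS e e0; exists N => // n /= Nn.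
rewrite -(circle_int_residual w2 b0 (fun k _ => wa k) (fun k _ => wb k)).
have [_ _ d2] := circle_L2B w2 (S2 n).
rewrite ger0_norm; first by rewrite -lee_fin -circle_int_fin//; exact: hN.
by apply: Rintegral_ge0 => x _; exact: sqr_ge0.
Unshelve. all: by end_near. Qed.

Lemma trigpoly_orthogonal f : circle_L1 f -> (forall k, ccos f k = 0) ->
  (forall k, csin f k = 0) ->
  forall T, trigpoly T -> circle_int (fun x => f x * T x) = 0.
Proof.
move=> f1 fc fs T; elim=> [k|k|{}T U tT IHT tU IHU|c {}T tT IHT].
- exact: fc.
- exact: fs.
- under eq_fun do rewrite mulrDr.
  rewrite circle_intD ?IHT ?IHU ?addr0//; apply: circle_L1M_cont => //;
    by [exact: periodic_trigpoly | exact: continuous_trigpoly].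
- under eq_fun do rewrite mulrCA.
  rewrite circle_intZ ?IHT ?mulr0//; apply: circle_L1M_cont => //;
    by [exact: periodic_trigpoly | exact: continuous_trigpoly].
Qed.

(** Bessel's inequality allows [Riesz_Fischer] to be applied to the coefficients of [f] itself. The
    resulting [w] satisfies the identity, and f - w has vanishing coefficients, hence is zero almost
    everywhere. *)
Theorem Parseval f : circle_L2 f ->
  trig_energy (ccos f) (csin f) @ \oo --> circle_int (fun x => f x ^+ 2).
Proof.
move=> f2.
have bessel n : trig_energy (ccos f) (csin f) n <= circle_int (fun x => f x ^+ 2).
  have := @circle_int_residual f (ccos f) (csin f) n f2 (csin0 f) (fun _ _ => erefl)
    (fun _ _ => erefl).
  have : 0 <= circle_int (fun x => (f x - trig_sum (ccos f) (csin f) n x) ^+ 2).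
    by apply: Rintegral_ge0 => x _; exact: sqr_ge0.
  lra.
have [w [w2 wc ws]] := Riesz_Fischer (csin0 f) bessel.
suff -> : circle_int (fun x => w x ^+ 2) = circle_int (fun x => f x ^+ 2) by [].
have d2 := circle_L2B f2 w2; have d1 := circle_L2_L1 d2.
have f1 := circle_L2_L1 f2; have w1 := circle_L2_L1 w2.
have ae0 : {ae mu, forall x, I x -> f x - w x = 0}.
  apply: circle_orthogonal_ae0 => //; apply: trigpoly_orthogonal => // k.
    rewrite /ccos; under eq_fun do rewrite mulrBl.
    rewrite circle_intB; [|exact: circle_L1_cos|exact: circle_L1_cos].
    by apply/eqP; rewrite subr_eq0; apply/eqP/esym/wc.
  rewrite /csin; under eq_fun do rewrite mulrBl.
  rewrite circle_intB; [|exact: circle_L1_sin|exact: circle_L1_sin].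
  by apply/eqP; rewrite subr_eq0; apply/eqP/esym/ws.
rewrite /circle_int /Rintegral; congr fine.
have [_ mf ff] := f2; have [_ mw ww] := w2.
apply: ge0_ae_eq_integral => //.
- by apply/measurable_EFinP/measurable_funTS; exact: measurable_funX.
- by apply/measurable_EFinP/measurable_funTS; exact: measurable_funX.
- by move=> x _; rewrite lee_fin sqr_ge0.
- by move=> x _; rewrite lee_fin sqr_ge0.
- apply: filterS ae0; first exact: (ae_filter_ringOfSetsType mu).
  by move=> x h xI; have /eqP := h xI; rewrite subr_eq0 => /eqP->.
Qed.

End Parseval.

(** * The half Dirichlet energy as a Gagliardo integral *)

Section Gagliardo.
Variable R : realType.
Local Notation mu := (@lebesgue_measure R).
Local Notation I := (@circle_itv R).
Local Notation mR := (measurableTypeR R).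
Implicit Types (f g : R -> R) (k n l : nat).

(** Iterated integrals over the square become integrals over the whole plane of a restricted
    function, the form to which Tonelli's theorem applies. *)
Lemma torus_restrict (G : R * R -> \bar R) (x : R) :
  (\int[mu]_y (G \_ (I `*` I)) (x, y) =
   ((fun x => \int[mu]_(y in I) G (x, y)) \_ I) x)%E.
Proof.
rewrite patchE; have [/[!inE] xI|xI] := boolP (x \in I).
  rewrite [RHS]integral_mkcond; apply: eq_integral => y _; rewrite !patchE.
  by congr (if _ then _ else _); apply/idP/idP; rewrite !inE => //= -[].
rewrite integral0_eq// => y _; rewrite patchE memNset//= => -[] xI' _.
by move: xI; rewrite notin_setE.
Qed.

Lemma torus_restrict2 (G : R * R -> \bar R) (y : R) :
  (\int[mu]_x (G \_ (I `*` I)) (x, y) =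
   ((fun y => \int[mu]_(x in I) G (x, y)) \_ I) y)%E.
Proof.
rewrite patchE; have [/[!inE] yI|yI] := boolP (y \in I).
  rewrite [RHS]integral_mkcond; apply: eq_integral => x _; rewrite !patchE.
  by congr (if _ then _ else _); apply/idP/idP; rewrite !inE => //= -[].
rewrite integral0_eq// => x _; rewrite patchE memNset//= => -[] _ yI'.
by move: yI; rewrite notin_setE.
Qed.

Lemma measurable_torus : measurable (I `*` I : set (mR * mR)).
Proof. exact: measurableX. Qed.

Lemma measurable_torus_restrict (G : R * R -> \bar R) :
  measurable_fun [set: mR * mR] G -> measurable_fun [set: mR * mR] (G \_ (I `*` I)).
Proof.
move=> mG; apply: (measurable_restrictT _ measurable_torus).1.
by apply: measurable_funS mG => //; exact: measurableT.
Qed.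

Lemma torus_restrict_ge0 (G : R * R -> \bar R) : (forall z, (0 <= G z)%E) ->
  forall z, (0 <= (G \_ (I `*` I)) z)%E.
Proof. by move=> G0 z; rewrite patchE; case: ifP. Qed.

Lemma torus_tonelli (G : R * R -> \bar R) :
  measurable_fun [set: mR * mR] G -> (forall z, (0 <= G z)%E) ->
  (\int[mu]_(x in I) \int[mu]_(y in I) G (x, y) =
   \int[mu]_(y in I) \int[mu]_(x in I) G (x, y))%E.
Proof.
move=> mG G0.
rewrite integral_mkcond [RHS]integral_mkcond.
under eq_integral do rewrite -torus_restrict.
under [in RHS]eq_integral do rewrite -torus_restrict2.
apply: (@fubini_tonelli _ _ mR mR R mu mu (G \_ (I `*` I))).
  exact: measurable_torus_restrict.
exact: torus_restrict_ge0.
Qed.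

Lemma measurable_torus_section (G : R * R -> \bar R) :
  measurable_fun [set: mR * mR] G -> (forall z, (0 <= G z)%E) ->
  measurable_fun [set: mR] (fun x => \int[mu]_(y in I) G (x, y))%E.
Proof.
move=> mG G0.
rewrite (_ : (fun x => _) =
  fubini_F mu (G \_ ([set: mR] `*` I))).
  apply: measurable_fun_fubini_tonelli_F.
    apply/(measurable_restrictT _ _).1; first exact: measurableX.
    exact: measurable_funTS.
  by move=> z; rewrite patchE; case: ifP.
apply/funext => x; rewrite integral_mkcond /fubini_F; apply: eq_integral => y _.
by rewrite !patchE; congr (if _ then _ else _); apply/idP/idP; rewrite !inE //= => -[].
Qed.

(* Equal to 0 at the multiples of [2 * pi], where it divides by 0. *)
Definition chord_kernel (h : R) : R := (4 * sin (h / 2) ^+ 2)^-1.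

Lemma chord_kernel_ge0 h : 0 <= chord_kernel h.
Proof. by rewrite invr_ge0 mulr_ge0// sqr_ge0. Qed.

Lemma chord_kernel_periodic : periodic chord_kernel (2 * pi).
Proof.
move=> h; rewrite /chord_kernel; congr (_^-1).
have e (x : R) : 4 * sin (x / 2) ^+ 2 = 2 * (1 - cos x) by rewrite -sin_halfX; ring.
by rewrite !e cos_periodic.
Qed.

Lemma chord_kernelN h : chord_kernel (- h) = chord_kernel h.
Proof. by rewrite /chord_kernel mulNr sinN sqrrN. Qed.

Lemma measurable_chord_kernel : measurable_fun [set: R] chord_kernel.
Proof.
have msin : measurable_fun [set: R] (fun h : R => 4 * sin (h / 2) ^+ 2).
  apply: measurable_funM => //; apply: (measurable_funX 2).
  apply: continuous_measurable_fun.
  rewrite (_ : (fun h => _) = fun h => sin (2^-1 * h)); first exact: continuous_sinM.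
  by apply/funext => h; rewrite mulrC.
have := measurableT_comp (@measurable_powR R (-1)) msin.
congr measurable_fun; apply/funext => h /=.
by rewrite powR_inv1// mulr_ge0// sqr_ge0.
Qed.

Definition gagliardo f : \bar R :=
  (\int[mu]_(x in I) \int[mu]_(y in I)
    ((f x - f y) ^+ 2 * chord_kernel (x - y))%:E)%E.

Lemma ccos_translation f k h : circle_L2 f ->
  ccos (fun x => f (x + h)) k =
  cos (k%:R * h) * ccos f k + sin (k%:R * h) * csin f k.
Proof.
move=> f2; have f1 := circle_L2_L1 f2; have [pf mf _] := f2.
have fc := circle_L1_cos k f1; have fs := circle_L1_sin k f1.
rewrite /ccos /csin -!circle_intZ// -circle_intD; [|exact: circle_L1Z..].
rewrite [RHS](_ : _ = circle_int (fun x => f x * cos (k%:R * (x - h)))).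
  rewrite /circle_int -(@circle_translation _ (fun x => f x * cos (k%:R * (x - h))) h).
  - by congr Rintegral; apply/funext => x; rewrite addrK.
  - apply: measurable_funM => //; apply: continuous_measurable_fun => x.
    apply: (continuous_comp (f := fun x => k%:R * (x - h))); last exact: continuous_cos.
    apply: cvgM; first exact: cvg_cst.
    by apply: cvgB; [exact: cvg_id | exact: cvg_cst].
  - by move=> x; rewrite pf addrAC periodic_cosM.
by congr circle_int; apply/funext => x; rewrite mulrBr cosB; ring.
Qed.

Lemma csin_translation f k h : circle_L2 f ->
  csin (fun x => f (x + h)) k =
  cos (k%:R * h) * csin f k - sin (k%:R * h) * ccos f k.
Proof.
move=> f2; have f1 := circle_L2_L1 f2; have [pf mf _] := f2.
have fc := circle_L1_cos k f1; have fs := circle_L1_sin k f1.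
rewrite /ccos /csin -!circle_intZ// -circle_intB; [|exact: circle_L1Z..].
rewrite [RHS](_ : _ = circle_int (fun x => f x * sin (k%:R * (x - h)))).
  rewrite /circle_int -(@circle_translation _ (fun x => f x * sin (k%:R * (x - h))) h).
  - by congr Rintegral; apply/funext => x; rewrite addrK.
  - apply: measurable_funM => //; apply: continuous_measurable_fun => x.
    apply: (continuous_comp (f := fun x => k%:R * (x - h))); last exact: continuous_sin.
    apply: cvgM; first exact: cvg_cst.
    by apply: cvgB; [exact: cvg_id | exact: cvg_cst].
  - by move=> x; rewrite pf addrAC periodic_sinM.
by congr circle_int; apply/funext => x; rewrite mulrBr sinB; ring.
Qed.

Lemma Parseval_series f : circle_L2 f ->
  ((circle_int (fun x => f x ^+ 2))%:E =
   \sum_(k <oo) ((trig_norm R k)^-1 * (ccos f k ^+ 2 + csin f k ^+ 2))%:E)%E.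
Proof.
move=> f2; apply/esym/cvg_lim => //.
have := Parseval f2 => H.
rewrite (_ : (fun n => _) = EFin \o trig_energy (ccos f) (csin f)).
  by apply: cvg_EFin => //; exact: nearW.
by apply/funext => n; rewrite sumEFin big_mkord.
Qed.

Lemma circle_int_increment f h : circle_L2 f ->
  ((circle_int (fun x => (f x - f (x + h)) ^+ 2))%:E =
   \sum_(k <oo) ((trig_norm R k)^-1 * (ccos f k ^+ 2 + csin f k ^+ 2) *
      (4 * sin (k%:R * (h / 2)) ^+ 2))%:E)%E.
Proof.
move=> f2; have f1 := circle_L2_L1 f2.
have h2 := circle_L2_translation h f2; have h1 := circle_L2_L1 h2.
rewrite (Parseval_series (circle_L2B f2 h2)).
apply: eq_eseriesr => k _; congr (_%:E); rewrite -mulrA; congr (_ * _).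
have -> : ccos (fun x => f x - f (x + h)) k = ccos f k - ccos (fun x => f (x + h)) k.
  rewrite /ccos -circle_intB; [|exact: circle_L1_cos..].
  by congr circle_int; apply/funext => x; rewrite mulrBl.
have -> : csin (fun x => f x - f (x + h)) k = csin f k - csin (fun x => f (x + h)) k.
  rewrite /csin -circle_intB; [|exact: circle_L1_sin..].
  by congr circle_int; apply/funext => x; rewrite mulrBl.
rewrite ccos_translation// csin_translation//.
have -> : 4 * sin (k%:R * (h / 2)) ^+ 2 = 2 * (1 - cos (k%:R * h)) :> R.
  by rewrite -sin_halfX -mulrA; ring.
move: (ccos f k) (csin f k) (k%:R * h) => a b t.
have st : sin t ^+ 2 = 1 - cos t ^+ 2 by rewrite -(cos2Dsin2 t); ring.
ring: st.
Qed.

Lemma measurable_increment f : measurable_fun [set: R] f ->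
  measurable_fun [set: mR * mR] (fun z : R * R => f z.1 - f z.2).
Proof.
move=> mf; apply: measurable_funB.
  exact: (measurableT_comp mf measurable_fst).
exact: (measurableT_comp mf measurable_snd).
Qed.

Lemma measurable_kernel_diff :
  measurable_fun [set: mR * mR] (fun z : R * R => chord_kernel (z.1 - z.2)).
Proof.
apply: (measurableT_comp measurable_chord_kernel).
by apply: measurable_funB; [exact: measurable_fst | exact: measurable_snd].
Qed.

Lemma measurable_gagliardo f : measurable_fun [set: R] f ->
  measurable_fun [set: mR * mR]
    (fun z : R * R => ((f z.1 - f z.2) ^+ 2 * chord_kernel (z.1 - z.2))).
Proof.
move=> mf; apply: measurable_funM; last exact: measurable_kernel_diff.
exact: (measurable_funX 2 (measurable_increment mf)).
Qed.

(** With y = x + h, Tonelli and Parseval for the increment f - f(. + h) give coefficients weighted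
    by 4 sin(kh/2)^2. The chord kernel turns this weight into the Fejer kernel of order [k], of
    integral 2 pi k; for k > 0 division by [trig_norm], which is pi, leaves 2k. *)
Theorem gagliardo_fourier f : circle_L2 f ->
  (gagliardo f =
   \sum_(k <oo) (2 * k%:R * (ccos f k ^+ 2 + csin f k ^+ 2))%:E)%E.
Proof.
move=> f2; have [pf mf _] := f2; have p0 := pi_gt0 R.
pose G (z : R * R) := ((f z.1 - f (z.1 + z.2)) ^+ 2 * chord_kernel z.2)%:E.
have mG : measurable_fun [set: mR * mR] G.
  have mshift : measurable_fun [set: mR * mR] (fun z : mR * mR => (z.1, z.1 + z.2) : mR * mR).
    apply/measurable_fun_prod => /=; first exact: measurable_fst.
    by apply: measurable_funD; [exact: measurable_fst | exact: measurable_snd].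
  have := measurableT_comp (measurable_gagliardo mf) mshift.
  move=> h; apply/measurable_EFinP; move: h; congr measurable_fun.
  by apply/funext => z /=; rewrite opprD addNKr chord_kernelN.
have G0 z : (0 <= G z)%E by rewrite lee_fin mulr_ge0 ?sqr_ge0 ?chord_kernel_ge0.
have E1 : gagliardo f = (\int[mu]_(x in I) \int[mu]_(h in I) G (x, h))%E.
  apply: eq_integral => x _.
  rewrite -(@ge0_circle_translation R (fun y => ((f x - f y) ^+ 2 * chord_kernel (x - y))%:E) x).
  - apply: eq_integral => h _; rewrite /G /=.
    by rewrite (addrC h x) opprD addNKr chord_kernelN.
  - have := measurableT_comp (measurable_gagliardo mf) (@measurable_pair1 _ _ mR mR x).
    by move=> h; apply/measurable_EFinP; exact: h.
  - by move=> y; rewrite lee_fin mulr_ge0 ?sqr_ge0 ?chord_kernel_ge0.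
  - move=> y; rewrite pf -(chord_kernelN (x - y)) -(chord_kernelN (x - (y + _))).
    by rewrite !opprB addrAC chord_kernel_periodic.
rewrite E1 torus_tonelli//.
pose c k := (trig_norm R k)^-1 * (ccos f k ^+ 2 + csin f k ^+ 2).
have c0 k : 0 <= c k.
  by rewrite mulr_ge0 ?invr_ge0 ?(ltW (trig_norm_gt0 _ _))// addr_ge0 ?sqr_ge0.
have mF k : measurable_fun [set: R] (@fejer R k).
  apply: continuous_measurable_fun.
  exact: (continuous_trigpoly (trigpoly_fejer R k)).
transitivity (\int[mu]_(h in I) \sum_(k <oo) (c k * fejer k h)%:E)%E.
  have mL : measurable_fun [set: mR] (fun h => \int[mu]_(x in I) G (x, h))%E.
    have := @measurable_torus_section (G \o (fun z => (z.2, z.1))).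
    apply; last by move=> z; exact: G0.
    have mswap : measurable_fun [set: mR * mR] (fun z : mR * mR => (z.2, z.1) : mR * mR).
      by apply/measurable_fun_prod => /=; [exact: measurable_snd|exact: measurable_fst].
    exact: (measurableT_comp mG mswap).
  have mRr : measurable_fun [set: mR] (fun h => \sum_(k <oo) (c k * fejer k h)%:E)%E.
    apply: (ge0_emeasurable_sum (h := fun k h => (c k * fejer k h)%:E) (P := xpredT)).
      by move=> k h _ _; rewrite lee_fin mulr_ge0// fejer_ge0'.
    by move=> k _; apply/measurable_EFinP; apply: measurable_funM => //; exact: mF.
  (* The endpoints are removed because [chord_kernel] takes its default value 0 there, whereas the
     Fejer kernel of order [k] equals k^2. *)
  rewrite /circle_itv [LHS]integral_itv_bndoo; last exact: measurable_funTS.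
  rewrite [RHS]integral_itv_bndoo; last exact: measurable_funTS.
  apply: eq_integral => h; rewrite inE /= in_itv /= => /andP[h0 h2].
  have s0 : sin (h / 2) != 0.
    have h0' : 0 < (h : R) by []. have h2' : (h : R) < 2 * pi by [].
    by rewrite gt_eqF// sin_gt0_pi//; apply/andP; split; lra.
  have [_ _ d2] := circle_L2B f2 (circle_L2_translation h f2).
  transitivity (\int[mu]_(x in I) ((chord_kernel h)%:E *
      ((f x - f (x + h)) ^+ 2)%:E))%E.
    by apply: eq_integral => x _; rewrite -EFinM mulrC.
  rewrite ge0_integralZl_EFin//; last 3 first.
  - by move=> x _; rewrite lee_fin sqr_ge0.
  - exact: measurable_int d2.
  - exact: chord_kernel_ge0.
  rewrite circle_int_fin// circle_int_increment// -nneseriesZl; last first.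
    by move=> k _; rewrite lee_fin mulr_ge0 ?c0// mulr_ge0// sqr_ge0.
  apply: eq_eseriesr => k _; rewrite -EFinM -fejerE -/(c k) /chord_kernel; congr (_%:E).
  by field.
rewrite integral_nneseries//; last 2 first.
- move=> k; apply/measurable_EFinP/measurable_funTS; apply: measurable_funM => //.
  exact: mF.
- by move=> k h _; rewrite lee_fin mulr_ge0// fejer_ge0'.
apply: eq_eseriesr => k _.
have F1 : circle_L1 (@fejer R k).
  apply: continuous_L1; exact: (continuous_trigpoly (trigpoly_fejer R k)).
rewrite (@circle_int_fin _ (fun h => c k * fejer k h)); last exact: circle_L1Z.
rewrite circle_intZ// circle_int_fejer /c /trig_norm.
congr (_%:E); case: (k =P 0%N) => [->|_]; first by rewrite !(mul0r, mulr0).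
have E (p q s : R) : p != 0 -> p^-1 * s * (q * (2 * p)) = 2 * q * s.
  by move=> pn; field.
by apply: E; rewrite gt_eqF.
Qed.

End Gagliardo.

(** * Identification of the half Dirichlet energy *)

Section HalfEnergy.
Variable R : realType.
Local Notation mu := (@lebesgue_measure R).
Local Notation I := (@circle_itv R).
Implicit Types (f g : R -> R) (k n l : nat).

Lemma L2circleP (m : nat) (v : R -> 'rV[R]_m) :
  L2circle v <-> forall j, circle_L2 (fun x => v x 0 j).
Proof.
split=> [[pv mv v2] j|v2].
  by split; [move=> x; rewrite pv | exact: mv | exact: v2].
split; last 2 first.
- by move=> j; have [] := v2 j.
- by move=> j; have [] := v2 j.
by move=> x; apply/rowP => j; have [-> _ _] := v2 j.
Qed.

Lemma fourier_nat (m : nat) (v : R -> 'rV[R]_m) k j :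
  fourier v k%:Z 0 j = (((2 * pi)^-1 * ccos (fun x => v x 0 j) k) +i*
                        (- ((2 * pi)^-1 * csin (fun x => v x 0 j) k)))%C.
Proof.
rewrite mxE /circle_integral.
have -> : (fun x => complex.Re ((v x 0 j)%:C%C * expi (- (k%:Z%:~R * x)))) =
          (fun x => v x 0 j * cos (k%:R * x)).
  by apply/funext => x; rewrite /expi cosN /= mul0r subr0.
have -> : (fun x => complex.Im ((v x 0 j)%:C%C * expi (- (k%:Z%:~R * x)))) =
          (fun x => - (v x 0 j * sin (k%:R * x))).
  by apply/funext => x; rewrite /expi sinN /= mul0r addr0 mulrN.
rewrite Rintegral_opp /ccos /csin /circle_int.
by apply/eqP; rewrite eq_complex /=; apply/andP; split; apply/eqP; ring.
Qed.

(** The multiplier of [is_fracLap] for s = 1/4, left unsimplified so that it folds back by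
    conversion. *)
Definition half_pow k : R := `|k%:R : R| `^ (2 * 4^-1).

Lemma half_pow_sqr k : half_pow k ^+ 2 = k%:R.
Proof.
rewrite /half_pow -powR_mulrn ?powR_ge0// -powRrM.
have -> : 2 * 4^-1 * 2%:R = 1 :> R by field.
by rewrite powRr1// normr_nat.
Qed.

Lemma half_pow0 : half_pow 0 = 0.
Proof. by apply/eqP; rewrite -sqrf_eq0 half_pow_sqr. Qed.

(** Since the functions are real, negative frequencies are conjugate to positive ones, and the
    multiplier is real and even; the condition therefore reduces to cosine and sine coefficients at
    natural frequencies. *)
Lemma is_fracLapP (m : nat) (v w : R -> 'rV[R]_m) :
  is_fracLap 4^-1 v w <-> L2circle w /\ forall j k,
     ccos (fun x => w x 0 j) k = half_pow k * ccos (fun x => v x 0 j) k /\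
     csin (fun x => w x 0 j) k = half_pow k * csin (fun x => v x 0 j) k.
Proof.
have c0 : (2 * pi)^-1 != 0 :> R by rewrite invr_eq0 mulf_neq0// gt_eqF// pi_gt0.
split=> [[w2 wE]|[w2 wE]]; split => //.
  move=> j k; have : fourier w k%:Z 0 j = (half_pow k)%:C%C * fourier v k%:Z 0 j.
    by rewrite wE [LHS]mxE.
  rewrite !fourier_nat; simpc => -[e1 e2].
  split; apply: (mulfI c0).
    by rewrite e1 mulrCA.
  apply: oppr_inj; move: e2; rewrite ?mulrN ?mulNr => ->; congr (- _); ring.
have H k : fourier w k%:Z = (`|k%:Z%:~R : R| `^ (2 * 4^-1))%:C%C *: fourier v k%:Z.
  apply/rowP => j; rewrite [RHS]mxE !fourier_nat -/(half_pow k).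
  by have [-> ->] := wE j k; simpc; congr (_ +i* _)%C; ring.
case=> k; first exact: H.
rewrite NegzE !fourierN mulrNz normrN H map_mxZ; congr (_ *: _).
by rewrite /= oppr0.
Qed.

Lemma gagliardo_energy f n : circle_L2 f -> (gagliardo f < +oo)%E ->
  trig_energy (fun k => half_pow k * ccos f k) (fun k => half_pow k * csin f k) n =
  (2 * pi)^-1 * \sum_(k < n) 2 * k%:R * (ccos f k ^+ 2 + csin f k ^+ 2).
Proof.
move=> f2 fg; rewrite /trig_energy mulr_sumr; apply: eq_bigr => k _.
rewrite !exprMn -mulrDr half_pow_sqr /trig_norm.
have p0 : pi != 0 :> R by rewrite gt_eqF// pi_gt0.
case: eqP => [->|_]; first by rewrite !(mul0r, mulr0).
have E (p q s : R) : p != 0 -> p^-1 * (q * s) = (2 * p)^-1 * (2 * q * s).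
  by move=> pn; field.
exact: E.
Qed.

Lemma gagliardo_limit f : circle_L2 f -> (gagliardo f < +oo)%E ->
  (fun n => \sum_(k < n) 2 * k%:R * (ccos f k ^+ 2 + csin f k ^+ 2)) @ \oo -->
  fine (gagliardo f).
Proof.
move=> f2 fg.
suff H : (fun n => (\sum_(k < n) 2 * k%:R * (ccos f k ^+ 2 + csin f k ^+ 2))%:E)
  @ \oo --> (fine (gagliardo f))%:E by exact: (fine_cvg H).
rewrite fineK; last first.
  rewrite ge0_fin_numE//; apply: integral_ge0 => x _; apply: integral_ge0 => y _.
  by rewrite lee_fin; apply: mulr_ge0; [exact: sqr_ge0 | exact: chord_kernel_ge0].
rewrite gagliardo_fourier//.
rewrite [X in X @ _ --> _](_ : _ = fun n => (\sum_(0 <= k < n)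
   (2 * k%:R * (ccos f k ^+ 2 + csin f k ^+ 2))%:E)%E).
  by apply: is_cvg_nneseries => k _ _; rewrite lee_fin !mulr_ge0// addr_ge0 ?sqr_ge0.
by apply/funext => n; rewrite big_mkord sumEFin.
Qed.

Lemma gagliardo_fracLap f : circle_L2 f -> (gagliardo f < +oo)%E ->
  exists2 w, circle_L2 w & forall k, ccos w k = half_pow k * ccos f k /\
     csin w k = half_pow k * csin f k.
Proof.
move=> f2 fg; have p0 := pi_gt0 R.
have [|n|w [w2 wc ws _]] := @Riesz_Fischer R (fun k => half_pow k * ccos f k)
    (fun k => half_pow k * csin f k) ((2 * pi)^-1 * fine (gagliardo f)).
- by rewrite half_pow0 mul0r.
- rewrite gagliardo_energy// ler_wpM2l ?invr_ge0 ?mulr_ge0 ?(ltW p0)//.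
  have H := gagliardo_limit f2 fg; rewrite -(cvg_lim _ H)//.
  apply: (nondecreasing_cvgn_le (u_ := fun n => \sum_(k < n) _)); last first.
    by apply/cvg_ex; eexists; exact: H.
  apply/nondecreasing_seqP => i; rewrite big_ord_recr /= lerDl.
  by rewrite !mulr_ge0// addr_ge0 ?sqr_ge0.
by exists w.
Qed.

Lemma fracLap_energy f w : circle_L2 f -> (gagliardo f < +oo)%E -> circle_L2 w ->
  (forall k, ccos w k = half_pow k * ccos f k /\ csin w k = half_pow k * csin f k) ->
  circle_int (fun x => w x ^+ 2) = (2 * pi)^-1 * fine (gagliardo f).
Proof.
move=> f2 fg w2 wE.
have H1 := Parseval w2.
have H2 : (fun n => (2 * pi)^-1 *
    \sum_(k < n) 2 * k%:R * (ccos f k ^+ 2 + csin f k ^+ 2)) @ \oo -->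
    (2 * pi)^-1 * fine (gagliardo f).
  by apply: cvgM; [exact: cvg_cst | exact: gagliardo_limit].
rewrite -(cvg_lim _ H1)// -(cvg_lim _ H2)//; congr (limn _); apply/funext => n.
rewrite -gagliardo_energy//; apply: eq_bigr => k _.
by have [-> ->] := wE k.
Qed.

(** [fracLap] returns the constant 0 unless a suitable L^2 function exists, so existence has to come
    first: finiteness of [gagliardo] bounds the coefficients |k|^(1/2) times those of [v] in l^2,
    and [Riesz_Fischer] applies. Parseval then makes the energy independent of the function
    chosen. *)
Theorem half_energyE (m : nat) (v : R -> 'rV[R]_m) : L2circle v ->
  (forall j, gagliardo (fun x => v x 0%R j) < +oo)%E ->
  half_energy v = (2 * pi)^-1 * \sum_(j < m) fine (gagliardo (fun x => v x 0 j)).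
Proof.
move=> /L2circleP v2 vg.
have [w0 hw0] : exists w0, is_fracLap 4^-1 v w0.
  have /choice[w hw] : forall j, exists w : R -> R, circle_L2 w /\
     forall k, ccos w k = half_pow k * ccos (fun x => v x 0 j) k /\
       csin w k = half_pow k * csin (fun x => v x 0 j) k.
    by move=> j; have [w w2 wE] := gagliardo_fracLap (v2 j) (vg j); exists w.
  have E j : (fun x => (\row_j w j x) 0 j) = w j by apply/funext => x; rewrite mxE.
  exists (fun x => \row_j w j x); apply/is_fracLapP; split.
    by apply/L2circleP => j; rewrite E; have [] := hw j.
  by move=> j k; rewrite E; have [_] := hw j.
have /is_fracLapP[/L2circleP w2 wE] : is_fracLap 4^-1 v (fracLap 4^-1 v).
  exact: (xgetPex (cst 0) (P := [set w | is_fracLap 4^-1 v w]) (ex_intro _ _ hw0)).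
rewrite /half_energy; move: (fracLap _ _) w2 wE => w w2 wE.
transitivity (circle_int (fun x => \sum_(j < m) w x 0 j ^+ 2)).
  congr Rintegral; apply/funext => x; rewrite /enorm sqr_sqrtr; last first.
    by apply: sumr_ge0 => j _; rewrite -expr2 sqr_ge0.
  by apply: eq_bigr => j _; rewrite expr2.
rewrite circle_int_sum; last by move=> j; have [] := w2 j.
rewrite mulr_sumr; apply: eq_bigr => j _.
exact: fracLap_energy.
Qed.

(** The weights compare by k <= (1 + k^2)^(1/2), and the sum over natural frequencies is part of the
    sum over all integers. *)
Lemma H12_gagliardo (m : nat) (v : R -> 'rV[R]_m) : H12 v ->
  forall j, (gagliardo (fun x => v x 0%R j) < +oo)%E.
Proof.
move=> [/L2circleP v2 vs] j; rewrite gagliardo_fourier//.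
(* The 2 is the weight in [gagliardo_fourier]; (2 pi)^2 undoes the factor 1/(2 pi) in each [fourier]
   coefficient. *)
set c : R := 2 * (2 * pi) ^+ 2.
have cge0 : 0 <= c by apply: mulr_ge0 => //; exact: sqr_ge0.
pose F (k : int) : \bar R :=
  (((1 + k%:~R ^+ 2) `^ (2^-1) * sqnormC (fourier v k))%:E)%E.
have F0 (k : int) : (0 <= F k)%E.
  rewrite lee_fin mulr_ge0 ?powR_ge0// sumr_ge0// => i _.
  by rewrite addr_ge0 ?sqr_ge0.
apply: (@le_lt_trans _ _ (c%:E * \esum_(k in [set: int]) F k)%E); last first.
  by apply: lte_mul_pinfty => //; rewrite lee_fin.
apply: (@le_trans _ _ (\sum_(k <oo) c%:E * F k%:Z)%E).
  apply: lee_nneseries => [k _ _|k _].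
    by rewrite lee_fin !mulr_ge0// addr_ge0 ?sqr_ge0.
  rewrite /F -EFinM lee_fin.
  have jk : (2 * pi)^-1 ^+ 2 * (ccos (fun x => v x 0 j) k ^+ 2 +
      csin (fun x => v x 0 j) k ^+ 2) <= sqnormC (fourier v k%:Z).
    rewrite /sqnormC (bigD1 j)//= fourier_nat /= sqrrN !exprMn -mulrDr lerDl.
    by apply: sumr_ge0 => i _; rewrite addr_ge0 ?sqr_ge0.
  have kp : k%:R <= (1 + (k%:Z%:~R : R) ^+ 2) `^ 2^-1.
    rewrite powR12_sqrt; last by rewrite addr_ge0// sqr_ge0.
    rewrite -{1}(ger0_norm (ler0n R k)) -sqrtr_sqr ler_wsqrtr//.
    by rewrite -[_%:~R]/(k%:R : R) lerDr.
  have c0 : (2 * pi) ^+ 2 != 0 :> R by rewrite expf_neq0// mulf_neq0// gt_eqF// pi_gt0.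
  set s := _ + _ in jk *.
  have s0 : 0 <= s by rewrite addr_ge0 ?sqr_ge0.
  have -> : 2 * k%:R * s = c * (k%:R * ((2 * pi)^-1 ^+ 2 * s)).
    by rewrite /c exprVn; move: ((2 * pi) ^+ 2) c0 => q q0; field.
  apply: ler_wpM2l cge0 _ _ _; apply: ler_pM => //.
  by apply: mulr_ge0 => //; exact: sqr_ge0.
rewrite nneseriesZl//; apply: lee_wpmul2l; first by rewrite lee_fin.
rewrite nneseries_esumT// -(@esum_image _ _ _ _ Posz F)//; last by move=> ? ? _ _ [].
rewrite esum_mkcond; apply: le_esum => k _.
by case: (k \in _); [exact: lexx | exact: F0].
Qed.

End HalfEnergy.

(** * First variation of the Gagliardo integral *)

Section Torus.
Variable R : realType.
Local Notation mu := (@lebesgue_measure R).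
Local Notation I := (@circle_itv R).
Local Notation mR := (measurableTypeR R).
Local Notation mu2 := (mu \x mu)%E.
Local Notation torus := (I `*` I : set (mR * mR)).
Implicit Types (f g h : R -> R) (k n l : nat) (G H : mR * mR -> R).

(** The product measure is used in place of iterated integrals because the first variation has a
    signed integrand, for which linearity is wanted. *)
Definition torus_int G : R := \int[mu2]_(z in torus) G z.
Definition torus_L1 G := mu2.-integrable torus (EFin \o G).

Lemma torus_L1D G H : torus_L1 G -> torus_L1 H -> torus_L1 (fun z => G z + H z).
Proof.
move=> g1 h1; have := integrableD (@measurable_torus R) g1 h1.
by apply: eq_integrable => [|x _]; [exact: measurable_torus|rewrite /= EFinD].
Qed.

Lemma torus_L1Z c G : torus_L1 G -> torus_L1 (fun z => c * G z).
Proof.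
move=> g1; have := integrableZl (@measurable_torus R) c g1.
by apply: eq_integrable => [|x _]; [exact: measurable_torus|rewrite /= EFinM].
Qed.

Lemma torus_intD G H : torus_L1 G -> torus_L1 H ->
  torus_int (fun z => G z + H z) = torus_int G + torus_int H.
Proof. by apply: RintegralD; exact: measurable_torus. Qed.

Lemma torus_intZ c G : torus_L1 G ->
  torus_int (fun z => c * G z) = c * torus_int G.
Proof. by apply: RintegralZl; exact: measurable_torus. Qed.

Lemma torus_int_sum n (F : 'I_n -> mR * mR -> R) : (forall i, torus_L1 (F i)) ->
  torus_L1 (fun x => \sum_(i < n) F i x) /\
  torus_int (fun x => \sum_(i < n) F i x) = \sum_(i < n) torus_int (F i).
Proof.
move=> F1; elim: n F F1 => [|n IH] F F1.
  rewrite (_ : (fun x => _) = cst 0); last by apply/funext => x; rewrite big_ord0.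
  split; first by apply: (eq_integrable (@measurable_torus R) (cst 0%E)) => //; exact: integrable0.
  by rewrite big_ord0 /torus_int /Rintegral integral0.
rewrite (_ : (fun x => _) = fun x => F ord0 x + \sum_(i < n) F (lift ord0 i) x); last first.
  by apply/funext => x; rewrite big_ord_recl.
have [h1 h2] := IH (fun i => F (lift ord0 i)) (fun i => F1 _).
split; first exact: torus_L1D.
by rewrite torus_intD// h2 big_ord_recl.
Qed.

Lemma ge0_torus_integral (G : mR * mR -> \bar R) :
  measurable_fun [set: mR * mR] G -> (forall z, (0 <= G z)%E) ->
  (\int[mu2]_(z in torus) G z = \int[mu]_(x in I) \int[mu]_(y in I) G (x, y))%E.
Proof.
move=> mG G0; rewrite integral_mkcond.
rewrite (@fubini_tonelli1 _ _ mR mR R mu mu (G \_ (I `*` I))); last 2 first.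
- exact: measurable_torus_restrict.
- exact: torus_restrict_ge0.
rewrite [RHS]integral_mkcond; apply: eq_integral => x _.
by rewrite /fubini_F torus_restrict.
Qed.

Lemma torus_int_prod g h : measurable_fun [set: R] g -> measurable_fun [set: R] h ->
  circle_L1 g -> circle_L1 h ->
  torus_L1 (fun z => g z.1 * h z.2) /\
  torus_int (fun z => g z.1 * h z.2) = circle_int g * circle_int h.
Proof.
move=> mg mh g1 h1.
have mgh : measurable_fun [set: mR * mR] (fun z : mR * mR => g z.1 * h z.2).
  apply: measurable_funM; first exact: (measurableT_comp mg measurable_fst).
  exact: (measurableT_comp mh measurable_snd).
have gh1 : torus_L1 (fun z => g z.1 * h z.2).
  apply/integrableP; split.
    by apply/measurable_EFinP; apply: measurable_funTS; exact: mgh.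
  rewrite ge0_torus_integral//; last first.
    by apply: measurableT_comp => //; exact/measurable_EFinP.
  under eq_integral => x _.
    under eq_integral => y _ do rewrite /= normrM EFinM.
    rewrite ge0_integralZl_EFin//; last first.
      exact: measurable_int (circle_L1_norm h1).
    over.
  rewrite ge0_integralZr//.
  - have := circle_int_fin (circle_L1_norm g1) => ->.
    have := circle_int_fin (circle_L1_norm h1) => ->.
    by rewrite -EFinM ltry.
  - exact: measurable_int (circle_L1_norm g1).
  - by apply: integral_ge0.
split => //.
rewrite /torus_int /Rintegral integral_mkcond.
have m2 : measurable_fun [set: mR * mR] (fun z : mR * mR => (g z.1 * h z.2)%:E).
  exact/measurable_EFinP.
rewrite -(@integral12_prod_meas1 _ _ mR mR R mu mu
   ((fun z => (g z.1 * h z.2)%:E) \_ torus)).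
- rewrite /fubini_F.
  under eq_integral do rewrite torus_restrict.
  rewrite -integral_mkcond.
  transitivity (circle_int (fun x => circle_int h * g x)); last first.
    by rewrite circle_intZ// mulrC.
  congr fine; apply: eq_integral => x _.
  rewrite (@circle_int_fin _ (fun y => g x * h y)); last exact: circle_L1Z.
  by rewrite circle_intZ// mulrC.
- by rewrite -integrable_mkcond//; exact: measurable_torus.
Qed.

(** Tonelli and the one-variable substitution in each coordinate; the inner integral inherits from
    [G] the periodicity needed for the outer one. *)
Lemma circle_subst_torus (phi dphi : R -> R) (G : mR * mR -> \bar R) :
  (forall x : R, is_derive x 1 phi (dphi x)) -> (forall x, 0 < dphi x) ->
  continuous dphi -> (forall x, phi (x + 2 * pi) = phi x + 2 * pi) ->
  measurable_fun [set: mR * mR] G -> (forall z, (0 <= G z)%E) ->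
  (forall x y : R, G ((x + 2 * pi)%R, y) = G (x, y)) ->
  (forall x y : R, G (x, (y + 2 * pi)%R) = G (x, y)) ->
  (\int[mu2]_(z in torus) (G (phi z.1, phi z.2) * (dphi z.1 * dphi z.2)%:E) =
   \int[mu2]_(z in torus) G z)%E.
Proof.
move=> D dphi0 cdphi pphi mG G0 p1 p2.
have cphi : continuous phi.
  move=> x; apply: differentiable_continuous; apply/derivable1_diffP.
  by have [] := D x.
have mphi := continuous_measurable_fun cphi.
have mdphi := continuous_measurable_fun cdphi.
rewrite !ge0_torus_integral//; last 2 first.
- apply: emeasurable_funM.
    apply: (measurableT_comp mG); apply/measurable_fun_prod => /=.
      exact: (measurableT_comp mphi measurable_fst).
    exact: (measurableT_comp mphi measurable_snd).
  apply/measurable_EFinP; apply: measurable_funM.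
    exact: (measurableT_comp mdphi measurable_fst).
  exact: (measurableT_comp mdphi measurable_snd).
- by move=> z; rewrite mule_ge0// lee_fin mulr_ge0// ltW.
have mG1 (x : R) : measurable_fun [set: R] (fun y => G (x, y)).
  exact: (measurableT_comp mG (@measurable_pair1 _ _ mR mR x)).
rewrite -(ge0_circle_subst (g := fun x => \int[mu]_(y in I) G (x, y))%E
  D dphi0 cdphi pphi); last 3 first.
- exact: (measurable_torus_section mG G0).
- by move=> x; apply: integral_ge0 => z _; exact: G0.
- by move=> x; apply: eq_integral => y _; rewrite p1.
apply: eq_integral => x _.
rewrite -(ge0_circle_subst D dphi0 cdphi pphi (mG1 (phi x)) (fun y => G0 _)
  (fun y => p2 (phi x) y)).
rewrite -ge0_integralZr//.
- by apply: eq_integral => y _ /=; rewrite EFinM -muleA (muleC (dphi y)%:E).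
- apply: emeasurable_funM; last exact/measurable_EFinP/measurable_funTS.
  apply: measurable_funTS; exact: (measurableT_comp (mG1 (phi x)) mphi).
- by move=> y _; rewrite mule_ge0// lee_fin ltW.
- by rewrite lee_fin ltW.
Qed.

End Torus.

(** * Densities of the first variation and their Fourier expression *)

Section Variation.
Variable R : realType.
Local Notation mu := (@lebesgue_measure R).
Local Notation I := (@circle_itv R).
Local Notation mR := (measurableTypeR R).
Local Notation mu2 := (mu \x mu)%E.
Local Notation torus := (I `*` I : set (mR * mR)).
Implicit Types (f g h : R -> R) (k n l p q : nat) (M : R -> R -> R).

(** The Lipschitz condition serves to evaluate the density at points displaced by the flow: the
    displacement is O(t), and the density already carries a factor [t], so the error is O(t^2). *)
Definition smooth_kernel M :=
  [/\ exists B : R, forall x y, `|M x y| <= B,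
      exists C : R, forall x y x' y', `|M x y - M x' y'| <= C * (`|x - x'| + `|y - y'|),
      forall x y, M (x + 2 * pi) y = M x y,
      forall x y, M x (y + 2 * pi) = M x y &
      measurable_fun [set: mR * mR] (fun z : mR * mR => M z.1 z.2)].

Lemma smooth_kernelD M N : smooth_kernel M -> smooth_kernel N ->
  smooth_kernel (fun x y => M x y + N x y).
Proof.
move=> [[B MB] [C MC] M1 M2 mM] [[B' NB] [C' NC] N1 N2 mN]; split.
- by exists (B + B') => x y; apply: (le_trans (ler_normD _ _)); exact: lerD.
- exists (C + C') => x y x' y'; rewrite opprD addrACA mulrDl.
  by apply: (le_trans (ler_normD _ _)); exact: lerD.
- by move=> x y; rewrite M1 N1.
- by move=> x y; rewrite M2 N2.
- exact: measurable_funD.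
Qed.

Lemma smooth_kernelZ c M : smooth_kernel M -> smooth_kernel (fun x y => c * M x y).
Proof.
move=> [[B MB] [C MC] M1 M2 mM]; split.
- by exists (`|c| * B) => x y; rewrite normrM ler_wpM2l.
- by exists (`|c| * C) => x y x' y'; rewrite -mulrBr normrM -mulrA ler_wpM2l.
- by move=> x y; rewrite M1.
- by move=> x y; rewrite M2.
- by apply: measurable_funM => //; exact: measurable_cst.
Qed.

Lemma smooth_kernelM M N : smooth_kernel M -> smooth_kernel N ->
  smooth_kernel (fun x y => M x y * N x y).
Proof.
move=> [[B MB] [C MC] M1 M2 mM] [[B' NB] [C' NC] N1 N2 mN].
have B0 : 0 <= B by apply: le_trans (MB 0 0).
have B0' : 0 <= B' by apply: le_trans (NB 0 0).
split.
- by exists (B * B') => x y; rewrite normrM ler_pM.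
- exists (C * B' + B * C') => x y x' y'.
  rewrite (_ : _ - _ = (M x y - M x' y') * N x y + M x' y' * (N x y - N x' y')).
    apply: (le_trans (ler_normD _ _)); rewrite !normrM mulrDl; apply: lerD.
      by rewrite mulrAC; apply: ler_pM.
    by rewrite -mulrA; apply: ler_pM.
  by ring.
- by move=> x y; rewrite M1 N1.
- by move=> x y; rewrite M2 N2.
- exact: measurable_funM.
Qed.

Lemma smooth_kernel_cst c : smooth_kernel (fun _ _ => c).
Proof.
split => //.
- by exists `|c|.
- by exists 0 => *; rewrite subrr normr0 mul0r.
Qed.

Lemma smooth_kernel_sum n (M : 'I_n -> R -> R -> R) :
  (forall i, smooth_kernel (M i)) -> smooth_kernel (fun x y => \sum_(i < n) M i x y).
Proof.
move=> sM; elim: n M sM => [|n IH] M sM.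
  rewrite (_ : (fun x => _) = fun _ _ => 0); first exact: smooth_kernel_cst.
  by apply/funext => x; apply/funext => y; rewrite big_ord0.
rewrite (_ : (fun x => _) = fun x y => M ord0 x y + \sum_(i < n) M (lift ord0 i) x y).
  by apply: smooth_kernelD => //; exact: IH.
by apply/funext => x; apply/funext => y; rewrite big_ord_recl.
Qed.

Lemma smooth_kernel_fst g : periodic g (2 * pi) -> measurable_fun [set: R] g ->
  (forall x, `|g x| <= 1) -> (exists C, forall x y, `|g x - g y| <= C * `|x - y|) ->
  smooth_kernel (fun x _ => g x).
Proof.
move=> pg mg g1 [C gC]; split => //.
- by exists 1.
- exists C => x y x' y'; apply: (le_trans (gC _ _)).
  rewrite mulrDr lerDl mulr_ge0//.
  have := gC 1 0; rewrite subr0 normr1 mulr1; apply: le_trans; exact: normr_ge0.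
- exact: (measurableT_comp mg measurable_fst).
Qed.

Lemma smooth_kernel_swap M : smooth_kernel M -> smooth_kernel (fun x y => M y x).
Proof.
move=> [[B MB] [C MC] M1 M2 mM]; split => //.
- by exists B.
- by exists C => x y x' y'; rewrite [X in C * X]addrC; exact: MC.
have mswap : measurable_fun [set: mR * mR] (fun z : mR * mR => (z.2, z.1) : mR * mR).
  by apply/measurable_fun_prod => /=; [exact: measurable_snd|exact: measurable_fst].
exact: (measurableT_comp mM mswap).
Qed.

Lemma cosM_lipschitz (c x y : R) : `|cos (c * x) - cos (c * y)| <= `|c| * `|x - y|.
Proof. by apply: (le_trans (cos_lipschitz _ _)); rewrite -mulrBr normrM. Qed.

Lemma sinM_lipschitz (c x y : R) : `|sin (c * x) - sin (c * y)| <= `|c| * `|x - y|.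
Proof. by apply: (le_trans (sin_lipschitz _ _)); rewrite -mulrBr normrM. Qed.

Lemma smooth_kernel_cosM k : smooth_kernel (fun x _ => cos (k%:R * x)).
Proof.
apply: smooth_kernel_fst.
- exact: periodic_cosM.
- by apply: continuous_measurable_fun; exact: continuous_cosM.
- by move=> x; exact: cos_max.
- by exists `|k%:R|; exact: cosM_lipschitz.
Qed.

Lemma smooth_kernel_sinM k : smooth_kernel (fun x _ => sin (k%:R * x)).
Proof.
apply: smooth_kernel_fst.
- exact: periodic_sinM.
- by apply: continuous_measurable_fun; exact: continuous_sinM.
- by move=> x; exact: sin_max.
- by exists `|k%:R|; exact: sinM_lipschitz.
Qed.

Lemma smooth_kernel_coscos k l :
  smooth_kernel (fun x y => cos (k%:R * x) * cos (l%:R * y)).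
Proof.
apply: smooth_kernelM; first exact: smooth_kernel_cosM.
exact: (smooth_kernel_swap (smooth_kernel_cosM l)).
Qed.

Lemma smooth_kernel_sinsin k l :
  smooth_kernel (fun x y => sin (k%:R * x) * sin (l%:R * y)).
Proof.
apply: smooth_kernelM; first exact: smooth_kernel_sinM.
exact: (smooth_kernel_swap (smooth_kernel_sinM l)).
Qed.

Lemma smooth_kernel_sincos k l :
  smooth_kernel (fun x y => sin (k%:R * x) * cos (l%:R * y)).
Proof.
apply: smooth_kernelM; first exact: smooth_kernel_sinM.
exact: (smooth_kernel_swap (smooth_kernel_cosM l)).
Qed.

Lemma smooth_kernel_hopf_sin k : smooth_kernel (@hopf_sin R k).
Proof.
apply: (@smooth_kernel_sum _ (fun (p : 'I_k.+1) x y => (p * (k - p))%:R *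
   cos (p%:R * x + (k - p)%:R * y))) => p; apply: smooth_kernelZ.
rewrite (_ : (fun _ _ => _) = fun x y => cos (p%:R * x) * cos ((k - p)%:R * y)
  + -1 * (sin (p%:R * x) * sin ((k - p)%:R * y))).
  apply: smooth_kernelD; first exact: smooth_kernel_coscos.
  by apply: smooth_kernelZ; exact: smooth_kernel_sinsin.
by apply/funext => x; apply/funext => y; rewrite cosD mulN1r.
Qed.

Lemma smooth_kernel_hopf_cos k : smooth_kernel (@hopf_cos R k).
Proof.
rewrite (_ : @hopf_cos R k = fun x y => -1 * \sum_(p < k.+1) (p * (k - p))%:R *
   sin (p%:R * x + (k - p)%:R * y)); last first.
  by apply/funext => x; apply/funext => y; rewrite mulN1r.
apply: smooth_kernelZ.
apply: (@smooth_kernel_sum _ (fun (p : 'I_k.+1) x y => (p * (k - p))%:R *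
   sin (p%:R * x + (k - p)%:R * y))) => p; apply: smooth_kernelZ.
rewrite (_ : (fun _ _ => _) = fun x y => sin (p%:R * x) * cos ((k - p)%:R * y)
  + cos (p%:R * x) * sin ((k - p)%:R * y)).
  apply: smooth_kernelD; first exact: smooth_kernel_sincos.
  apply: smooth_kernelM; first exact: smooth_kernel_cosM.
  exact: (smooth_kernel_swap (smooth_kernel_sinM _)).
by apply/funext => x; apply/funext => y; rewrite sinD.
Qed.

(* [M] is the density, relative to [4 sin^2 ((x - y) / 2)], of the first
   variation of the kernel of [gagliardo] under the vector field [Y]. *)
Definition variation_kernel (Y dY : R -> R) M :=
  [/\ forall x : R, is_derive x 1 Y (dY x),
      forall x y, (Y x - Y y) * cos ((x - y) / 2) -
         (dY x + dY y) * sin ((x - y) / 2) = 4 * sin ((x - y) / 2) ^+ 3 * M x y &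
      smooth_kernel M].

Lemma variation_kernel_cos k :
  variation_kernel (fun x => cos (k%:R * x)) (fun x => - (k%:R * sin (k%:R * x)))
    (@hopf_cos R k).
Proof.
split; first by move=> x; exact: is_derive_cosM.
  move=> x y; have [<- _] := hopf_kernel k x y; ring.
exact: smooth_kernel_hopf_cos.
Qed.

Lemma variation_kernel_sin k :
  variation_kernel (fun x => sin (k%:R * x)) (fun x => k%:R * cos (k%:R * x))
    (@hopf_sin R k).
Proof.
split; first by move=> x; exact: is_derive_sinM.
  move=> x y; have [_ <-] := hopf_kernel k x y; ring.
exact: smooth_kernel_hopf_sin.
Qed.

(** The singularity has cancelled: the factor 4 sin((x - y)/2)^2 in the relative variation is the
    inverse of the chord kernel, and a bounded density against the squared increment remains. *)
Definition variation f M : R :=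
  torus_int (fun z => (f z.1 - f z.2) ^+ 2 * M z.1 z.2).

Lemma torus_L1M (G N : mR * mR -> R) B : torus_L1 G ->
  measurable_fun [set: mR * mR] N -> (forall z, `|N z| <= B) ->
  torus_L1 (fun z => G z * N z).
Proof.
move=> G1 mN NB.
have := @integrableMl _ _ _ mu2 torus (@measurable_torus R) (EFin \o G) N G1.
apply; first exact: measurable_funTS.
by exists B; split; [exact: num_real | move=> y By x _; apply: le_trans (NB x) (ltW By)].
Qed.

Lemma circle_L1_1 : circle_L1 (fun=> 1 : R).
Proof. by apply: continuous_L1 => x; exact: cvg_cst. Qed.

Lemma torus_L1_increment f : circle_L2 f -> torus_L1 (fun z => (f z.1 - f z.2) ^+ 2).
Proof.
move=> f2; have f1 := circle_L2_L1 f2; have [pf mf ff] := f2.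
have mff : measurable_fun [set: R] (fun x => f x ^+ 2) := measurable_funX 2 mf.
have m1 : measurable_fun [set: R] (fun=> 1 : R) by exact: measurable_cst.
have [h1 _] := torus_int_prod mff m1 ff circle_L1_1.
have [h2 _] := torus_int_prod m1 mff circle_L1_1 ff.
have [h3 _] := torus_int_prod mf mf f1 f1.
have := torus_L1D (torus_L1D h1 h2) (torus_L1Z (-2) h3).
congr torus_L1; apply/funext => z; ring.
Qed.

Lemma variation_L1 f M : circle_L2 f -> smooth_kernel M ->
  torus_L1 (fun z => (f z.1 - f z.2) ^+ 2 * M z.1 z.2).
Proof.
move=> f2 [[B MB] _ _ _ mM].
exact: (torus_L1M (torus_L1_increment f2) mM (fun z => MB z.1 z.2)).
Qed.

Lemma variationD f M N : circle_L2 f -> smooth_kernel M -> smooth_kernel N ->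
  variation f (fun x y => M x y + N x y) = variation f M + variation f N.
Proof.
move=> f2 sM sN; rewrite /variation -torus_intD; try exact: variation_L1.
by congr torus_int; apply/funext => z; rewrite mulrDr.
Qed.

Lemma variationZ f c M : circle_L2 f -> smooth_kernel M ->
  variation f (fun x y => c * M x y) = c * variation f M.
Proof.
move=> f2 sM; rewrite /variation -torus_intZ; last exact: variation_L1.
by congr torus_int; apply/funext => z; rewrite mulrCA.
Qed.

Lemma variation_sum f n (M : 'I_n -> R -> R -> R) : circle_L2 f ->
  (forall i, smooth_kernel (M i)) ->
  variation f (fun x y => \sum_(i < n) M i x y) = \sum_(i < n) variation f (M i).
Proof.
move=> f2 sM; rewrite /variation.
have [_ <-] := torus_int_sum (fun i => variation_L1 f2 (sM i)).
by congr torus_int; apply/funext => z; rewrite mulr_sumr.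
Qed.

(** Expansion of (f x - f y)^2 leaves only the cross term: each pure square is integrated against a
    product one of whose factors has mean zero. This is how products of two Fourier coefficients
    arise. *)
Lemma variation_prod f g h : circle_L2 f -> trigpoly g -> trigpoly h ->
  circle_int g = 0 -> circle_int h = 0 ->
  variation f (fun x y => g x * h y) =
  - 2 * (circle_int (fun x => f x * g x) * circle_int (fun x => f x * h x)).
Proof.
move=> f2 tg th g0 h0; have f1 := circle_L2_L1 f2; have [pf mf ff] := f2.
have cg := continuous_trigpoly tg; have ch := continuous_trigpoly th.
have pg := periodic_trigpoly tg; have ph := periodic_trigpoly th.
have mg := continuous_measurable_fun cg; have mh := continuous_measurable_fun ch.
have mff : measurable_fun [set: R] (fun x => f x ^+ 2) := measurable_funX 2 mf.
have mm (u v : R -> R) : measurable_fun [set: R] u -> measurable_fun [set: R] v ->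
  measurable_fun [set: R] (fun x => u x * v x : R) by exact: measurable_funM.
have [A1 E1] := torus_int_prod (mm _ _ mff mg) mh
  (circle_L1M_cont ff pg cg) (continuous_L1 ch).
have [A2 E2] := torus_int_prod mg (mm _ _ mff mh) (continuous_L1 cg)
  (circle_L1M_cont ff ph ch).
have [A3 E3] := torus_int_prod (mm _ _ mf mg) (mm _ _ mf mh)
  (circle_L1M_cont f1 pg cg) (circle_L1M_cont f1 ph ch).
rewrite /variation (_ : (fun z => _) = fun z : mR * mR =>
   (f z.1 ^+ 2 * g z.1 * h z.2 + g z.1 * (f z.2 ^+ 2 * h z.2)) +
   (-2) * (f z.1 * g z.1 * (f z.2 * h z.2))); last by apply/funext => z; ring.
rewrite torus_intD; [|exact: torus_L1D|exact: torus_L1Z].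
by rewrite torus_intD// torus_intZ// E1 E2 E3 g0 h0 mul0r mulr0 !add0r.
Qed.

Lemma circle_int_cosM0 k : (0 < k)%N -> circle_int (fun x : R => cos (k%:R * x)) = 0.
Proof. by rewrite circle_int_cos; case: k. Qed.

Lemma circle_int_sinM0 k : circle_int (fun x : R => sin (k%:R * x)) = 0.
Proof. exact: circle_int_sin. Qed.

Lemma variation_hopf_sin f k : circle_L2 f ->
  variation f (@hopf_sin R k) = - 2 * \sum_(p < k.+1) (p * (k - p))%:R *
    (ccos f p * ccos f (k - p) - csin f p * csin f (k - p)).
Proof.
move=> f2; rewrite mulr_sumr.
rewrite (_ : @hopf_sin R k = fun x y => \sum_(p < k.+1) (p * (k - p))%:R *
   (cos (p%:R * x) * cos ((k - p)%:R * y)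
  + -1 * (sin (p%:R * x) * sin ((k - p)%:R * y)))); last first.
  apply/funext => x; apply/funext => y; apply: eq_bigr => p _.
  by rewrite cosD mulN1r.
have s1 := smooth_kernel_coscos; have s2 := smooth_kernel_sinsin.
have s3 p q : smooth_kernel (fun x y => -1 * (sin (p%:R * x) * sin (q%:R * y))).
  by apply: smooth_kernelZ.
rewrite variation_sum//; last first.
  by move=> p; apply: smooth_kernelZ; exact: smooth_kernelD.
apply: eq_bigr => p _; rewrite variationZ//; last exact: smooth_kernelD.
(* The constant mode is not of mean zero, but at p = 0 and p = k the weight p (k - p) vanishes. *)
have [->|p0] := posnP p; first by rewrite !mul0n !mul0r mulr0.
have [->|q0] := posnP (k - p); first by rewrite !muln0 !mul0r mulr0.
rewrite variationD// variationZ// !variation_prod//;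
  try exact: trigpoly_cos; try exact: trigpoly_sin;
  try exact: circle_int_cosM0; try exact: circle_int_sinM0.
rewrite /ccos /csin; ring.
Qed.

Lemma variation_hopf_cos f k : circle_L2 f ->
  variation f (@hopf_cos R k) = 2 * \sum_(p < k.+1) (p * (k - p))%:R *
    (csin f p * ccos f (k - p) + ccos f p * csin f (k - p)).
Proof.
move=> f2; rewrite mulr_sumr.
rewrite (_ : @hopf_cos R k = fun x y => -1 * \sum_(p < k.+1) (p * (k - p))%:R *
   (sin (p%:R * x) * cos ((k - p)%:R * y)
  + cos (p%:R * x) * sin ((k - p)%:R * y))); last first.
  apply/funext => x; apply/funext => y; rewrite mulN1r /hopf_cos; congr (- _).
  by apply: eq_bigr => p _; rewrite sinD.
have s1 := smooth_kernel_sincos.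
have s2 p q : smooth_kernel (fun x y => cos (p%:R * x) * sin (q%:R * y)).
  apply: smooth_kernelM; first exact: smooth_kernel_cosM.
  exact: (smooth_kernel_swap (smooth_kernel_sinM _)).
have s3 (p : 'I_k.+1) : smooth_kernel (fun x y => (p * (k - p))%:R *
   (sin (p%:R * x) * cos ((k - p)%:R * y)
  + cos (p%:R * x) * sin ((k - p)%:R * y))).
  by apply: smooth_kernelZ; exact: smooth_kernelD.
rewrite variationZ//; last exact: smooth_kernel_sum.
rewrite variation_sum// mulr_sumr; apply: eq_bigr => p _.
rewrite variationZ//; last exact: smooth_kernelD.
have [->|p0] := posnP p; first by rewrite !mul0n !mul0r !mulr0.
have [->|q0] := posnP (k - p); first by rewrite !muln0 !mul0r !mulr0.
rewrite variationD// !variation_prod//;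
  try exact: trigpoly_cos; try exact: trigpoly_sin;
  try exact: circle_int_cosM0; try exact: circle_int_sinM0.
rewrite /ccos /csin; ring.
Qed.

(** A periodic primitive exists only after subtraction of the mean; the constant [c] collects the
    contributions of cosines of frequency 0. *)
Lemma trigpoly_primitive T : trigpoly T -> exists2 Y, trigpoly Y &
  exists c, forall x : R, is_derive x 1 Y (T x - c).
Proof.
elim=> [k|k|{}T U tT [Y tY [c Yc]] tU [Z tZ [d Zd]]|a {}T tT [Y tY [c Yc]]].
- have [->|k0] := posnP k.
    exists (cst 0); first exact: trigpoly_cst.
    by exists 1 => x; rewrite mul0r cos0 subrr; exact: is_derive_cst.
  have kn : k%:R != 0 :> R by rewrite pnatr_eq0 -lt0n.
  exists (fun x => k%:R^-1 * sin (k%:R * x)); first exact/trigpolyZ/trigpoly_sin.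
  exists 0 => x; rewrite subr0.
  have := is_derive1_comp (is_derive_mulc k%:R^-1 (sin (k%:R * x))) (is_derive_sinM k%:R x).
  by move=> h; apply: (is_derive_eq h); rewrite mulKf.
- have [->|k0] := posnP k.
    exists (cst 0); first exact: trigpoly_cst.
    by exists 0 => x; rewrite mul0r sin0 subrr; exact: is_derive_cst.
  have kn : k%:R != 0 :> R by rewrite pnatr_eq0 -lt0n.
  exists (fun x => - k%:R^-1 * cos (k%:R * x)); first exact/trigpolyZ/trigpoly_cos.
  exists 0 => x; rewrite subr0.
  have := is_derive1_comp (is_derive_mulc (- k%:R^-1) (cos (k%:R * x)))
    (is_derive_cosM k%:R x).
  by move=> h; apply: (is_derive_eq h); rewrite mulrNN mulKf.
- exists (fun x => Y x + Z x); first exact: trigpolyD.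
  exists (c + d) => x; apply: (is_derive_eq (is_deriveD (Yc x) (Zd x))).
  by rewrite opprD addrACA.
- exists (fun x => a * Y x); first exact: trigpolyZ.
  exists (a * c) => x.
  have := is_derive1_comp (is_derive_mulc a (Y x)) (Yc x).
  by move=> h; apply: (is_derive_eq h); rewrite mulrBr.
Qed.

(** Both the defining identity of a density and the variation are linear, so density and vanishing
    are propagated together from the basic fields cos(kx) and sin(kx). *)
Lemma trigpoly_variation_kernel (m : nat) (f : 'I_m -> R -> R) T :
  (forall j, circle_L2 (f j)) ->
  (forall k, \sum_(j < m) variation (f j) (@hopf_cos R k) = 0) ->
  (forall k, \sum_(j < m) variation (f j) (@hopf_sin R k) = 0) ->
  trigpoly T -> exists dT M, variation_kernel T dT M /\
    \sum_(j < m) variation (f j) M = 0.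
Proof.
move=> f2 fc fs.
elim=> [k|k|{}T U tT [dT [M [[T1 T2 T3] TV]]] tU [dU [N [[U1 U2 U3] UV]]]|
  a {}T tT [dT [M [[T1 T2 T3] TV]]]].
- by exists (fun x => - (k%:R * sin (k%:R * x))), (@hopf_cos R k); split => //;
    exact: variation_kernel_cos.
- by exists (fun x => k%:R * cos (k%:R * x)), (@hopf_sin R k); split => //;
    exact: variation_kernel_sin.
- exists (fun x => dT x + dU x), (fun x y => M x y + N x y); split.
    split; last exact: smooth_kernelD.
      by move=> x; exact: (is_deriveD (T1 x) (U1 x)).
    by move=> x y; rewrite mulrDr -T2 -U2; ring.
  by under eq_bigr do rewrite variationD//; rewrite big_split /= TV UV addr0.
- exists (fun x => a * dT x), (fun x y => a * M x y); split.
    split; last exact: smooth_kernelZ.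
      move=> x; have := is_derive1_comp (is_derive_mulc a (T x)) (T1 x).
      exact.
    by move=> x y; rewrite [RHS]mulrCA -T2; ring.
  by under eq_bigr do rewrite variationZ//; rewrite -mulr_sumr TV mulr0.
Qed.

End Variation.

(** * The energy along the maps x + t X(x) *)

Section Flow.
Variable R : realType.
Local Notation mu := (@lebesgue_measure R).
Local Notation I := (@circle_itv R).
Local Notation mR := (measurableTypeR R).
Local Notation mu2 := (mu \x mu)%E.
Local Notation torus := (I `*` I : set (mR * mR)).
Implicit Types (f g h : R -> R) (k n l p q : nat) (M : R -> R -> R).

(** Where the chord kernel divides by 0, the increment of a periodic function vanishes as well, so
    the default value of the kernel does no harm. *)
Lemma periodic_sin_half_eq0 f x y : periodic f (2 * pi) ->
  sin ((x - y) / 2) = 0 -> f x = f y.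
Proof.
move=> pf s0; have [z] := near_multiple (x - y).
rewrite s0 normr0 mulr0 normr_le0 => /eqP e.
by rewrite -(@periodicz R f (2 * pi) z x pf) (_ : x + _ = y)//; move: e; lra.
Qed.

(** When [M] belongs to the field [Y], this is the quantity [N] of [kernel_ratio_bound] for that
    field wherever sin((x - y)/2) is nonzero, written without division. *)
Definition chord_density M x y : R := 4 * sin ((x - y) / 2) ^+ 2 * M x y.

Lemma smooth_chord_density M : smooth_kernel M -> smooth_kernel (chord_density M).
Proof.
move=> sM; rewrite (_ : chord_density M = fun x y => (2 + -2 *
  (cos (1%:R * x) * cos (1%:R * y) + sin (1%:R * x) * sin (1%:R * y))) * M x y).
  apply: smooth_kernelM => //; apply: smooth_kernelD; first exact: smooth_kernel_cst.
  apply: smooth_kernelZ; apply: smooth_kernelD; first exact: smooth_kernel_coscos.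
  exact: smooth_kernel_sinsin.
apply/funext => x; apply/funext => y; rewrite /chord_density !mul1r -cosB.
rewrite (_ : 2 + _ = 2 * (1 - cos (x - y))); last by ring.
by rewrite -sin_halfX; congr (_ * _); ring.
Qed.

Lemma torus_int_fin (G : mR * mR -> R) : torus_L1 G ->
  (\int[mu2]_(z in torus) (G z)%:E = (torus_int G)%:E)%E.
Proof.
move=> G1; rewrite /torus_int /Rintegral fineK//.
exact: (integrable_fin_num (@measurable_torus R) G1).
Qed.

Definition chord_quotient f (z : mR * mR) : R :=
  (f z.1 - f z.2) ^+ 2 * chord_kernel (z.1 - z.2).

Lemma chord_quotient_ge0 f z : 0 <= chord_quotient f z.
Proof. by rewrite mulr_ge0 ?sqr_ge0 ?chord_kernel_ge0. Qed.

Lemma chord_quotient_periodic1 f (x y : R) : periodic f (2 * pi) ->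
  chord_quotient f (x + 2 * pi, y) = chord_quotient f (x, y).
Proof. by move=> pf; rewrite /chord_quotient /= pf addrAC chord_kernel_periodic. Qed.

Lemma chord_quotient_periodic2 f (x y : R) : periodic f (2 * pi) ->
  chord_quotient f (x, y + 2 * pi) = chord_quotient f (x, y).
Proof.
move=> pf; rewrite /chord_quotient /= pf -(chord_kernelN (x - y)).
by rewrite -(chord_kernelN (x - (y + _))) !opprB addrAC chord_kernel_periodic.
Qed.

Lemma gagliardo_torus f : measurable_fun [set: R] f ->
  (gagliardo f = \int[mu2]_(z in torus) (chord_quotient f z)%:E)%E.
Proof.
move=> mf; rewrite ge0_torus_integral//.
  by apply/measurable_EFinP; exact: measurable_gagliardo.
by move=> z; rewrite lee_fin chord_quotient_ge0.
Qed.

Lemma gagliardo_torus_L1 f : measurable_fun [set: R] f -> (gagliardo f < +oo)%E ->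
  torus_L1 (chord_quotient f) /\ torus_int (chord_quotient f) = fine (gagliardo f).
Proof.
move=> mf; rewrite gagliardo_torus// => fin; split => //.
apply/integrableP; split.
  by apply/measurable_EFinP; apply: measurable_funTS; exact: measurable_gagliardo.
apply: le_lt_trans fin; rewrite le_eqVlt; apply/orP; left; apply/eqP.
by apply: eq_integral => z _ /=; rewrite ger0_norm// chord_quotient_ge0.
Qed.

Lemma chord_quotient_density f M (x y : R) : periodic f (2 * pi) ->
  chord_quotient f (x, y) * chord_density M x y = (f x - f y) ^+ 2 * M x y.
Proof.
move=> pf; rewrite /chord_quotient /chord_density /chord_kernel /=.
have [s0|s0] := eqVneq (sin ((x - y) / 2)) 0.
  by rewrite (periodic_sin_half_eq0 pf s0) subrr expr0n /= !mul0r.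
by field.
Qed.

Section Vectorfield.
Variables (X dX Y dY : R -> R) (M : R -> R -> R) (L delta : R).
Hypotheses (pX : periodic X (2 * pi)) (pY : periodic Y (2 * pi))
  (DX : forall x : R, is_derive x 1 X (dX x)) (cdX : continuous dX)
  (dXL : forall x, 4 * `|dX x| <= L) (L1 : 1 <= L)
  (YM : variation_kernel Y dY M) (XY : forall x, `|dX x - dY x| <= delta).

Let phi t x : R := x + t * X x.

(** Only [Y] has a known density, so the first order coefficient of [X] is replaced by that of [Y].
    The cost 10 delta is 8 delta from the chord bound for X - Y and delta from each of the two
    derivatives. The factor 4 in [dXL] turns the 8 of [chord_bound] into |X x - X y| / 2 <= L
    |sin((x - y)/2)|. *)
Lemma flow_chord_bound (t x y : R) : `|t| * L <= 1 / 2 -> sin ((x - y) / 2) != 0 ->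
  `|sin ((phi t x - phi t y) / 2) ^+ 2 - (1 + t * chord_density M x y) *
     ((1 + t * dX x) * (1 + t * dX y)) * sin ((x - y) / 2) ^+ 2| <=
  (76 * L ^+ 2 * t ^+ 2 + 10 * delta * `|t|) *
     ((1 + t * dX x) * (1 + t * dX y)) * sin ((x - y) / 2) ^+ 2.
Proof.
move=> tL sn0.
have [DY YE _] := YM.
have L4 : L / 4 <= L.
  have l1 : 1 <= L := L1.
  by lra.
have dXL4 z : `|dX z| <= L / 4 by have := dXL z; lra.
have J0 z : 1 / 2 <= 1 + t * dX z.
  have : `|t * dX z| <= `|t| * L.
    by rewrite normrM ler_wpM2l//; apply: (le_trans (dXL4 z)).
  by rewrite ler_norml => /andP[]; lra.
have hX := chord_bound pX DX dXL4 x y.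
have DZ (z : R) : is_derive z 1 (fun z => X z - Y z) (dX z - dY z).
  exact: (is_deriveB (DX z) (DY z)).
have pZ : periodic (fun z => X z - Y z) (2 * pi) by move=> z; rewrite pX pY.
have hZ := chord_bound pZ DZ XY x y.
have hR := @kernel_ratio_bound R L t ((x - y) / 2) ((X x - X y) / 2) (dX x) (dX y)
  L1 tL sn0.
rewrite (_ : (phi t x - phi t y) / 2 = (x - y) / 2 + t * ((X x - X y) / 2)); last first.
  by rewrite /phi; field.
move: sn0 (YE x y) hX hZ hR; rewrite /chord_density.
move: (sin ((x - y) / 2)) (cos_max ((x - y) / 2)).
set q := sin (_ + _); move: (cos ((x - y) / 2)) q => c q s c1 sn0 E hX hZ hR.
have s0 : 0 < `|s| by rewrite normr_gt0.
have {}hR := hR _ (le_trans (dXL4 x) _) (le_trans (dXL4 y) _).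
have {hR hX} : `|q ^+ 2 - (1 + t * (2 * ((X x - X y) / 2 * c / s) - dX x - dX y)) *
    ((1 + t * dX x) * (1 + t * dX y)) * s ^+ 2| <=
   76 * L ^+ 2 * t ^+ 2 * ((1 + t * dX x) * (1 + t * dX y)) * s ^+ 2.
  apply: hR; [|lra|lra].
  rewrite normrM [`|2^-1|]ger0_norm//; move: hX; lra.
have J2 : 0 <= (1 + t * dX x) * (1 + t * dX y) * s ^+ 2.
  have := J0 x; have := J0 y => ? ?.
  by rewrite mulr_ge0 ?sqr_ge0// mulr_ge0//; lra.
set NX := 2 * _ - _ - _; set J := _ * (1 + t * dX y).
have hN : `|NX - 4 * s ^+ 2 * M x y| <= 10 * delta.
  have -> : NX - 4 * s ^+ 2 * M x y =
     (X x - Y x - (X y - Y y)) * c / s - (dX x - dY x) - (dX y - dY y).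
    have -> : 4 * s ^+ 2 * M x y = ((Y x - Y y) * c - (dY x + dY y) * s) / s.
      by rewrite E; field.
    by rewrite /NX; field.
  have h1 : `|(X x - Y x - (X y - Y y)) * c / s| <= 8 * delta.
    rewrite !normrM normfV ler_pdivrMr// -[leRHS]mulr1; apply: ler_pM => //.
  have := XY x; have := XY y.
  move: h1; rewrite !ler_norml => /andP[? ?] /andP[? ?] /andP[? ?].
  by apply/andP; split; lra.
move=> hR.
rewrite (_ : _ - _ = (q ^+ 2 - (1 + t * NX) * J * s ^+ 2) +
    t * (NX - 4 * s ^+ 2 * M x y) * (J * s ^+ 2)); last by ring.
apply: (le_trans (ler_normD _ _)).
rewrite (_ : (76 * _ * _ + _) * _ * _ = 76 * L ^+ 2 * t ^+ 2 * J * s ^+ 2 +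
   `|t| * (10 * delta) * (J * s ^+ 2)); last by ring.
apply: lerD => //; rewrite normrM [`|J * _|]ger0_norm// ler_wpM2r// normrM.
by rewrite ler_wpM2l.
Qed.

Variables (B C : R).
Hypotheses (XB : forall x, `|X x| <= B)
  (NC : forall x y x' y', `|chord_density M x y - chord_density M x' y'| <=
     C * (`|x - x'| + `|y - y'|)).

(** Three sources of error: the second order remainder, the replacement of [X] by [Y], and the
    evaluation of the density at the displaced points, each moved by at most B |t|. *)
Let err t := 76 * L ^+ 2 * t ^+ 2 + 10 * delta * `|t| + `|t| * (C * (2 * B * `|t|)).

(** The comparison function is evaluated at (phi x, phi y) and multiplied by both Jacobians,
    precisely so that its integral can be computed by the change of variables. The error is a
    multiple of the quotient itself. *)
Lemma flow_chord_quotient f (t x y : R) : periodic f (2 * pi) ->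
  `|t| * L <= 1 / 2 ->
  `|chord_quotient (fun x => f (phi t x)) (x, y) -
    chord_quotient f (phi t x, phi t y) *
    (1 + t * chord_density M (phi t x) (phi t y)) *
    ((1 + t * dX x) * (1 + t * dX y))| <=
  err t * (chord_quotient f (phi t x, phi t y) * ((1 + t * dX x) * (1 + t * dX y))).
Proof.
move=> pf tL; rewrite /chord_quotient /=.
have B0 : 0 <= B by apply: le_trans (XB 0).
have C0 : 0 <= C.
  by have := NC 1 0 0 0; rewrite !subr0 normr1 normr0 addr0 mulr1; apply: le_trans.
have J0 z : 0 <= 1 + t * dX z.
  have : `|t * dX z| <= `|t| * L.
    rewrite normrM ler_wpM2l//; have := dXL z; have := normr_ge0 (dX z); lra.
  by rewrite ler_norml => /andP[]; lra.
have [q0|q0] := eqVneq (sin ((phi t x - phi t y) / 2)) 0.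
  rewrite (periodic_sin_half_eq0 pf q0) subrr expr0n /= !mul0r.
  by rewrite subrr normr0 mulr0.
(* If x - y is a multiple of 2 pi then so is phi x - phi y, contrary to [q0]. *)
have [s0|s0] := eqVneq (sin ((x - y) / 2)) 0.
  case/eqP: q0; have [z] := near_multiple (x - y).
  rewrite s0 normr0 mulr0 normr_le0 => /eqP e.
  have e' : x = y + (- z)%:~R * (2 * pi) by rewrite mulrNz; move: e; lra.
  rewrite (_ : phi t x - phi t y = 0 + (- z)%:~R * (2 * pi)); last first.
    by rewrite /phi e' periodicz//; ring.
  by apply/eqP; rewrite -normr_eq0 sin_half_shift mul0r sin0 normr0.
have := flow_chord_bound tL s0.
rewrite /chord_kernel.
set W := (_ - _) ^+ 2; set q := sin _ in q0 *; set s := sin _ in s0 *.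
set N := chord_density M x y; set N' := chord_density M (phi t x) _.
set J := (1 + _) * (1 + _) => h.
have hN : `|N - N'| <= C * (2 * B * `|t|).
  apply: (le_trans (NC _ _ _ _)); rewrite ler_wpM2l//.
  rewrite /phi !opprD !addNKr !normrN !normrM.
  by have := ler_wpM2l (normr_ge0 t) (XB x); have := ler_wpM2l (normr_ge0 t) (XB y); lra.
(* Multiplication of the estimate on squared sines by this factor turns it into an estimate between
   the two chord quotients. *)
have K0 : 0 <= W / (4 * q ^+ 2) / s ^+ 2.
  by apply: divr_ge0; rewrite ?sqr_ge0// divr_ge0 ?sqr_ge0// mulr_ge0 ?sqr_ge0.
have J2 : 0 <= J by rewrite mulr_ge0.
have {}h : `|q ^+ 2 - (1 + t * N') * J * s ^+ 2| <= err t * J * s ^+ 2.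
  rewrite (_ : _ - _ = (q ^+ 2 - (1 + t * N) * J * s ^+ 2) +
    t * (N - N') * (J * s ^+ 2)); last by ring.
  apply: (le_trans (ler_normD _ _)).
  rewrite (_ : err t * _ * _ = (76 * L ^+ 2 * t ^+ 2 + 10 * delta * `|t|) * J * s ^+ 2 +
    `|t| * (C * (2 * B * `|t|)) * (J * s ^+ 2)); last by rewrite /err; ring.
  apply: lerD => //.
  have J3 : 0 <= J * s ^+ 2 by apply: mulr_ge0; rewrite ?sqr_ge0.
  rewrite normrM [`|J * _|]ger0_norm// normrM.
  by apply: ler_wpM2r => //; apply: ler_wpM2l.
have := ler_wpM2l K0 h.
have E1 (w a b n j : R) : a != 0 -> b != 0 -> w / (4 * a ^+ 2) / b ^+ 2 *
  (a ^+ 2 - n * j * b ^+ 2) = w / (4 * b ^+ 2) - w / (4 * a ^+ 2) * n * j.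
  by move=> a0 b0; field; rewrite a0 b0.
have E2 (w a b e j : R) : a != 0 -> b != 0 -> w / (4 * a ^+ 2) / b ^+ 2 *
  (e * j * b ^+ 2) = e * (w / (4 * a ^+ 2) * j).
  by move=> a0 b0; field; rewrite a0 b0.
by rewrite E2// -(ger0_norm K0) -normrM E1.
Qed.

Lemma flow_derive (t x : R) : is_derive x 1 (phi t) (1 + t * dX x).
Proof.
have D := is_derive1_comp (is_derive_mulc t (X x)) (DX x).
exact: (is_deriveD (is_derive_id x 1) D).
Qed.

Lemma flow_shift (t x : R) : phi t (x + 2 * pi) = phi t x + 2 * pi.
Proof. by rewrite /phi pX addrAC. Qed.

Lemma flow_dpos (t x : R) : `|t| * L <= 1 / 2 -> 1 / 2 <= 1 + t * dX x.
Proof.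
move=> tL; have : `|t * dX x| <= `|t| * L.
  rewrite normrM ler_wpM2l//; have := dXL x; have := normr_ge0 (dX x); lra.
by rewrite ler_norml => /andP[]; lra.
Qed.

Lemma flow_dcont (t : R) : continuous (fun x => 1 + t * dX x).
Proof.
by move=> x; apply: cvgD; [exact: cvg_cst|apply: cvgM; [exact: cvg_cst|exact: cdX]].
Qed.

Lemma flow_measurable (t : R) : measurable_fun [set: R] (phi t).
Proof.
apply: continuous_measurable_fun => x; apply: differentiable_continuous.
by apply/derivable1_diffP; have [] := flow_derive t x.
Qed.

(** The Jacobian is at least 1/2, so the integral of f(phi)^2 is at most twice the integral with the
    Jacobian, which equals that of f^2. *)
Lemma circle_L2_flow f (t : R) : circle_L2 f -> `|t| * L <= 1 / 2 ->
  circle_L2 (fun x => f (phi t x)).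
Proof.
move=> [pf mf f2] tL; have mphi := flow_measurable t.
have mfp : measurable_fun [set: R] (fun x => f (phi t x)) := measurableT_comp mf mphi.
split => //; first by move=> x; rewrite flow_shift pf.
have mff : measurable_fun [set: R] (fun x => f (phi t x) ^+ 2) := measurable_funX 2 mfp.
apply/integrableP; split; first by apply/measurable_EFinP/measurable_funTS.
have dp x : 0 < 1 + t * dX x by apply: lt_le_trans (flow_dpos x tL); lra.
have S := @ge0_circle_subst R (phi t) (fun x => 1 + t * dX x)
  (fun x => (f x ^+ 2)%:E) (flow_derive t) dp (@flow_dcont t) (flow_shift t).
have {}S : (\int[mu]_(x in I) (f (phi t x) ^+ 2 * (1 + t * dX x))%:E =
    (circle_int (fun x => f x ^+ 2))%:E)%E.
  rewrite -circle_int_fin// -S.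
  - by apply: eq_integral => x _; rewrite EFinM.
  - by apply/measurable_EFinP; exact: measurable_funX.
  - by move=> x; rewrite lee_fin sqr_ge0.
  - by move=> x; rewrite pf.
have mJ : measurable_fun [set: R] (fun x => 1 + t * dX x).
  by apply: continuous_measurable_fun; exact: flow_dcont.
have hle : (\int[mu]_(x in I) `|(f (phi t x) ^+ 2)%:E| <=
    \int[mu]_(x in I) (2%:E * (f (phi t x) ^+ 2 * (1 + t * dX x))%:E))%E.
  apply: ge0_le_integral => //.
  - by apply/measurableT_comp => //; apply/measurable_EFinP/measurable_funTS.
  - by apply/measurable_EFinP/measurable_funTS; apply: measurable_funM => //; exact: measurable_funM.
  - move=> x _ /=; rewrite lee_fin ger0_norm ?sqr_ge0//.
    have := flow_dpos x tL; have := sqr_ge0 (f (phi t x)); nra.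
apply: (le_lt_trans hle).
rewrite ge0_integralZl_EFin//.
- by rewrite S -EFinM ltry.
- by move=> x _; rewrite lee_fin mulr_ge0 ?sqr_ge0// ltW.
- by apply/measurable_EFinP/measurable_funTS; exact: measurable_funM.
Qed.

Lemma gagliardo_flow f (t BN : R) : circle_L2 f -> (gagliardo f < +oo)%E ->
  `|t| * L <= 1 / 2 -> (forall x y, `|chord_density M x y| <= BN) ->
  `|t| * BN <= 1 / 4 -> err t <= 1 / 4 ->
  (gagliardo (fun x => f (phi t x)) < +oo)%E /\
  `|fine (gagliardo (fun x => f (phi t x))) - fine (gagliardo f) - t * variation f M|
    <= err t * fine (gagliardo f).
Proof.
move=> f2 fin tL NB tN e4; have [pf mf _] := f2; have [_ _ [_ _ M1 M2 mM]] := YM.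
have dp x : 0 < 1 + t * dX x by apply: lt_le_trans (flow_dpos x tL); lra.
have [g2 mg _] := circle_L2_flow f2 tL.
have [_ _ N1 N2 mN] := smooth_chord_density (let: And3 _ _ sM := YM in sM).
have [Q1 QE] := gagliardo_torus_L1 mf fin.
have mQ := measurable_gagliardo mf.
have QN1 : torus_L1 (fun z => chord_quotient f z * chord_density M z.1 z.2).
  by apply: (torus_L1M (B := BN) Q1 mN) => z.
have QNE : torus_int (fun z => chord_quotient f z * chord_density M z.1 z.2) = variation f M.
  by congr torus_int; apply/funext => -[x y]; exact: chord_quotient_density.
(* After the change of variables, the energy of [f \o phi t] lies between the
   integrals of [H (- err t)] and [H (err t)]. *)
pose H e (z : mR * mR) : R := chord_quotient f z * (1 + t * chord_density M z.1 z.2 + e).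
have H1 e : torus_L1 (H e) /\ torus_int (H e) =
    (1 + e) * fine (gagliardo f) + t * variation f M.
  have -> : H e = fun z => (1 + e) * chord_quotient f z +
      t * (chord_quotient f z * chord_density M z.1 z.2).
    by apply/funext => z; rewrite /H; ring.
  split; first by apply: torus_L1D; exact: torus_L1Z.
  by rewrite torus_intD ?torus_intZ ?QE ?QNE//; exact: torus_L1Z.
have mH e : measurable_fun [set: mR * mR] (H e).
  apply: measurable_funM => //; apply: measurable_funD => //.
  by apply: measurable_funD => //; apply: measurable_funM.
(* The thresholds 1/4 on |t| BN and on [e] keep the factor 1 + tN + e at least 1/2, so the change of
   variables for nonnegative functions applies to both bounds. *)
have H0 e z : `|e| <= 1 / 4 -> 0 <= H e z.
  move=> le; apply: mulr_ge0; first exact: chord_quotient_ge0.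
  have : `|t * chord_density M z.1 z.2| <= `|t| * BN by rewrite normrM ler_wpM2l.
  by move: le; rewrite !ler_norml => /andP[? ?] /andP[? ?]; lra.
pose HJ e (z : mR * mR) : R := H e (phi t z.1, phi t z.2) *
  ((1 + t * dX z.1) * (1 + t * dX z.2)).
have HJE e : `|e| <= 1 / 4 -> (\int[mu2]_(z in torus) (HJ e z)%:E =
    ((1 + e) * fine (gagliardo f) + t * variation f M)%:E)%E.
  move=> le; have [h1 <-] := H1 e.
  rewrite -torus_int_fin//.
  rewrite -(@circle_subst_torus R (phi t) (fun x => 1 + t * dX x)
     (fun z => (H e z)%:E) (flow_derive t) dp (@flow_dcont t) (flow_shift t)).
  - by apply: eq_integral => z _; rewrite EFinM.
  - by apply/measurable_EFinP.
  - by move=> z; rewrite lee_fin H0.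
  - by move=> x y; rewrite /H /= chord_quotient_periodic1// N1.
  - by move=> x y; rewrite /H /= chord_quotient_periodic2// N2.
have mphi := flow_measurable t.
have mphi2 : measurable_fun [set: mR * mR]
    (fun z : mR * mR => (phi t z.1, phi t z.2) : mR * mR).
  apply/measurable_fun_prod => /=; first exact: (measurableT_comp mphi measurable_fst).
  exact: (measurableT_comp mphi measurable_snd).
have mJ : measurable_fun [set: R] (fun x => 1 + t * dX x).
  by apply: continuous_measurable_fun; exact: flow_dcont.
have mHJ e : measurable_fun [set: mR * mR] (HJ e).
  apply: measurable_funM; first exact: (measurableT_comp (mH e) mphi2).
  apply: measurable_funM; first exact: (measurableT_comp mJ measurable_fst).
  exact: (measurableT_comp mJ measurable_snd).
have HJ0 e z : `|e| <= 1 / 4 -> 0 <= HJ e z.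
  by move=> le; apply: mulr_ge0; [exact: H0|rewrite mulr_ge0// ltW].
have mG := measurable_gagliardo mg.
have pt z : HJ (- err t) z <= chord_quotient (fun x => f (phi t x)) z <= HJ (err t) z.
  case: z => x y; have := flow_chord_quotient x y pf tL.
  rewrite ler_norml /HJ /H /=.
  set a := chord_quotient _ (x, y); set b := chord_quotient _ _; set N := chord_density _ _ _.
  set J := (_ * (1 + t * dX y)); move: (err t) => e /andP[h1 h2].
  by apply/andP; split; lra.
have err0 : 0 <= err t.
  have B0 : 0 <= B by apply: le_trans (XB 0).
  have C0 : 0 <= C.
    by have := NC 1 0 0 0; rewrite !subr0 normr1 normr0 addr0 mulr1; apply: le_trans.
  have d0 : 0 <= delta by apply: le_trans (XY 0).
  by rewrite /err; apply: addr_ge0; first apply: addr_ge0;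
    repeat first [exact: normr_ge0 | exact: sqr_ge0 | exact: ler0n | done | apply: mulr_ge0].
have le1 : `|err t| <= 1 / 4 by rewrite ger0_norm.
have le2 : `|- err t| <= 1 / 4 by rewrite normrN.
have U : (gagliardo (fun x => f (phi t x)) <=
    ((1 + err t) * fine (gagliardo f) + t * variation f M)%:E)%E.
  rewrite gagliardo_torus// -HJE//; apply: ge0_le_integral => //.
  - exact: measurable_torus.
  - by move=> z _; rewrite lee_fin chord_quotient_ge0.
  - by apply/measurable_EFinP/measurable_funTS.
  - by apply/measurable_EFinP/measurable_funTS.
  - by move=> z _; rewrite lee_fin; case/andP: (pt z).
have V : (((1 - err t) * fine (gagliardo f) + t * variation f M)%:E <=
    gagliardo (fun x => f (phi t x)))%E.
  rewrite -HJE// gagliardo_torus//; apply: ge0_le_integral => //.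
  - exact: measurable_torus.
  - by move=> z _; rewrite lee_fin HJ0.
  - by apply/measurable_EFinP/measurable_funTS.
  - by apply/measurable_EFinP/measurable_funTS.
  - by move=> z _; rewrite lee_fin; case/andP: (pt z).
have fin' : (gagliardo (fun x => f (phi t x)) < +oo)%E by apply: le_lt_trans U (ltry _).
split => //; move: U V fin'; case: (gagliardo (fun x => _)) => [r||] //=.
rewrite !lee_fin => U V _; rewrite ler_norml; apply/andP; split; lra.
Qed.

End Vectorfield.
End Flow.

(** * Stationarity in terms of Fourier coefficients *)

Section Stationarity.
Local Open Scope complex_scope.
Variable R : realType.
Implicit Types (f g h : R -> R) (k n l p q : nat) (M : R -> R -> R).

Lemma is_derive_first_order g (c : R) :
  (forall e, 0 < e -> exists2 t0 : R, 0 < t0 &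
     forall t, `|t| <= t0 -> `|g t - g 0 - t * c| <= e * `|t|) ->
  is_derive (0 : R) (1 : R) g c.
Proof.
move=> H.
suff C : h^-1 *: (g (h *: 1 + 0) - g 0) @[h --> (0 : R)^'] --> (c : R^o).
  have D : derivable g 0 1 by apply/cvg_ex; exists c.
  split => //; exact: (cvg_lim (@norm_hausdorff _ _) C).
apply/cvgrPdist_le => e e0.
have [t0 t00 Ht] := H _ e0.
near=> t.
have tn : t != 0 by near: t; exact: nbhs_dnbhs_neq.
have tt : `|t| <= t0.
  by near: t; apply: dnbhs0_le.
have := Ht _ tt.
rewrite addr0 /GRing.scale /= mulr1 => h.
rewrite (_ : c - _ = - t^-1 * (g t - g 0 - t * c)); last by field.
by rewrite normrM normrN normfV mulrC ler_pdivrMr ?normr_gt0.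
Unshelve. all: by end_near. Qed.

Lemma periodic_derive f (df : R -> R) T : periodic f T ->
  (forall x : R, is_derive x 1 f (df x)) -> periodic df T.
Proof.
move=> pf D x; have Ds : is_derive x 1 (fun y : R => y + T) 1.
  by apply: (is_derive_eq (is_deriveD (is_derive_id x 1) (is_derive_cst T x 1)));
    rewrite addr0.
have DT : is_derive ((fun y : R => y + T) x) 1 f (df (x + T)) by exact: D.
have D1 := @is_derive1_comp R f (fun y : R => y + T) x _ _ DT Ds.
rewrite (_ : f \o _ = f) ?mulr1 in D1; last by apply/funext => y /=; exact: pf.
by rewrite -(@derive_val _ _ _ _ _ _ _ D1) (@derive_val _ _ _ _ _ _ _ (D x)).
Qed.

(** The term in [delta] does not become small with [t]; it is a slope. With Y = X it vanishes and
    the derivative along a field with a density follows; with Y close to X it bounds the difference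
    quotient along an arbitrary C^1 field. *)
Lemma half_energy_flow (m : nat) (u : R -> 'rV[R]_m) (X dX Y dY : R -> R) M
    (delta e : R) : H12 u ->
  periodic X (2 * pi) -> periodic Y (2 * pi) ->
  (forall x : R, is_derive x 1 X (dX x)) -> continuous dX -> variation_kernel Y dY M ->
  (forall x, `|dX x - dY x| <= delta) -> 0 < e ->
  exists2 t0 : R, 0 < t0 & forall t, `|t| <= t0 ->
    `|half_energy (fun x => u (x + t * X x)) - half_energy u -
       t * ((2 * pi)^-1 * \sum_(j < m) variation (fun x => u x 0 j) M)| <=
    (10 * delta + e) * half_energy u * `|t|.
Proof.
move=> hu pX pY DX cdX YM XY e0.
have p0 : 0 < 2 * pi :> R by rewrite mulr_gt0// pi_gt0.
have [/L2circleP u2 _] := hu; have ug := H12_gagliardo hu.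
have pdX := periodic_derive pX DX.
have [L0 L00 dXL0] := bounded_periodic pdX cdX.
have cX : continuous X.
  move=> x; apply: differentiable_continuous; apply/derivable1_diffP.
  by have [] := DX x.
have [B B0 XB] := bounded_periodic pX cX.
have [_ _ sM] := YM.
have [[BN NB] [C NC] _ _ _] := smooth_chord_density sM.
have BN0 : 0 <= BN by apply: le_trans (NB 0 0).
have C0 : 0 <= C.
  by have := NC 1 0 0 0; rewrite !subr0 normr1 normr0 addr0 mulr1; apply: le_trans.
have d0 : 0 <= delta by apply: le_trans (XY 0).
pose L := 1 + 4 * L0.
have L1 : 1 <= L by rewrite lerDl mulr_ge0.
have dXL x : 4 * `|dX x| <= L by have := dXL0 x; rewrite /L; lra.
pose A := 76 * L ^+ 2 + 2 * C * B.
have A0 : 0 <= A by have := sqr_ge0 L; have := mulr_ge0 C0 B0; rewrite /A; lra.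
(* A single constant above all those that multiply |t| in the constraints, so that |t| K <= min(e,
   1/4) secures them together. *)
pose K := L + BN + A + (10 * delta + e) + 1.
have K1 : 1 <= K by rewrite /K; lra.
exists (Num.min e (1 / 4) / K).
  by rewrite divr_gt0// ?lt_min ?e0/=; lra.
move=> t; rewrite ler_pdivlMr; last by lra.
rewrite le_min => /andP[tKe tK4].
have n0 := normr_ge0 t.
have tL : `|t| * L <= 1 / 2.
  have : `|t| * L <= `|t| * K by rewrite ler_wpM2l// /K; lra.
  lra.
have tBN : `|t| * BN <= 1 / 4.
  have : `|t| * BN <= `|t| * K by rewrite ler_wpM2l// /K; lra.
  lra.
have tA : `|t| * A <= e.
  have : `|t| * A <= `|t| * K by rewrite ler_wpM2l// /K; lra.
  lra.
have td : `|t| * (10 * delta + e) <= 1 / 4.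
  have : `|t| * (10 * delta + e) <= `|t| * K by rewrite ler_wpM2l// /K; lra.
  lra.
have errE : 76 * L ^+ 2 * t ^+ 2 + 10 * delta * `|t| + `|t| * (C * (2 * B * `|t|)) <=
    (10 * delta + e) * `|t|.
  rewrite -(real_normK (num_real t)).
  have := ler_wpM2l n0 tA; rewrite /A; move: (`|t|) => a; nra.
have err4 : 76 * L ^+ 2 * t ^+ 2 + 10 * delta * `|t| + `|t| * (C * (2 * B * `|t|)) <= 1 / 4.
  by apply: (le_trans errE); rewrite mulrC.
have G j := gagliardo_flow pX pY DX cdX dXL L1 YM XY XB NC (u2 j) (ug j) tL NB tBN err4.
have E0 := half_energyE (proj1 hu) ug.
have Et := half_energyE ((L2circleP _).2 (fun j => circle_L2_flow pX DX cdX dXL (u2 j) tL))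
  (fun j => (G j).1).
rewrite Et E0 -mulrBr [t * _]mulrCA -mulrBr normrM ger0_norm; last by rewrite invr_ge0 ltW.
rewrite [X in _ <= X](_ : _ = (2 * pi)^-1 * ((10 * delta + e) * `|t| *
  \sum_(j < m) fine (gagliardo (fun x => u x 0 j)))); last by ring.
rewrite ler_wpM2l ?invr_ge0 ?(ltW p0)//.
rewrite -sumrB !mulr_sumr -sumrB; apply: (le_trans (ler_norm_sum _ _ _)).
apply: ler_sum => j _; apply: (le_trans (G j).2).
rewrite ler_wpM2r// fine_ge0//; apply: integral_ge0 => x _; apply: integral_ge0 => y _.
by rewrite lee_fin mulr_ge0 ?sqr_ge0 ?chord_kernel_ge0.
Qed.

(** Stationarity is tested on cos(kx) and sin(kx), where the derivative is known. Conversely, X' is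
    approximated rather than X, since the error is governed by the distance between derivatives. *)
Lemma half_stationary_variation (m : nat) (u : R -> 'rV[R]_m) : H12 u ->
  half_stationary u <->
  (forall k, \sum_(j < m) variation (fun x => u x 0 j) (@hopf_cos R k) = 0) /\
  (forall k, \sum_(j < m) variation (fun x => u x 0 j) (@hopf_sin R k) = 0).
Proof.
move=> hu; have p0 : 0 < 2 * pi :> R by rewrite mulr_gt0// pi_gt0.
have [/L2circleP u2 _] := hu.
have E0 : 0 <= half_energy u.
  by rewrite /half_energy; apply: Rintegral_ge0 => x _; exact: sqr_ge0.
have hE (X : R -> R) : half_energy (fun x => u (x + 0 * X x)) = half_energy u.
  by congr half_energy; apply/funext => x; rewrite mul0r addr0.
split=> [st|[vc vs] X [pX dX cX]].
  have key (Y dY : R -> R) M : periodic Y (2 * pi) -> variation_kernel Y dY M -> continuous dY ->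
      \sum_(j < m) variation (fun x => u x 0 j) M = 0.
    move=> pY YM cdY; have [DY _ _] := YM.
    have CY : C1_circle Y.
      have dYd x : derivable Y x 1 by have [] := DY x.
      split=> //.
      rewrite (_ : derive1 Y = dY)//; apply/funext => x.
      by rewrite derive1E; apply: derive_val.
    have D1 := st Y CY.
    have D2 : is_derive (0 : R) (1 : R)
        (fun t : R => half_energy (fun x => u (x + t * Y x)))
        ((2 * pi)^-1 * \sum_(j < m) variation (fun x => u x 0 j) M).
      apply: is_derive_first_order => e e0.
      have e1 : 0 < e / (half_energy u + 1) by rewrite divr_gt0// ltr_wpDl.
      have YY x : `|dY x - dY x| <= 0 by rewrite subrr normr0.
      have [t0 t00 Ht] := half_energy_flow hu pY pY DY cdY YM YY e1.
      exists t0 => // t tt; rewrite hE; apply: (le_trans (Ht t tt)).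
      rewrite ler_wpM2r// mulr0 add0r mulrAC ler_pdivrMr ?ltr_wpDl//.
      by rewrite ler_wpM2l ?(ltW e0)// lerDl.
    have := @derive_val _ _ _ _ _ _ _ D1; rewrite (@derive_val _ _ _ _ _ _ _ D2).
    by move=> /eqP; rewrite mulf_eq0 invr_eq0 gt_eqF//= => /eqP.
  split=> k; apply: key.
  - exact: periodic_cosM.
  - exact: variation_kernel_cos.
  - move=> x; apply: cvgN; apply: cvgM; [exact: cvg_cst|exact: continuous_sinM].
  - exact: periodic_sinM.
  - exact: variation_kernel_sin.
  - move=> x; apply: cvgM; [exact: cvg_cst|exact: continuous_cosM].
have DX (x : R) : is_derive x 1 X (derive1 X x).
  by rewrite derive1E; exact/derivableP.
apply: is_derive_first_order => e e0.
(* The derivative of the approximating field is within 2d of X', which gives the slope 20 d = e / (2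
   (E + 1)) with E the energy; the other half of the budget is the error term passed to
   [half_energy_flow]. *)
pose d := e / (40 * (half_energy u + 1)).
have E1 : 0 < half_energy u + 1 by rewrite ltr_wpDl.
have d0 : 0 < d by rewrite divr_gt0// mulr_gt0.
have [T tT TX] := trigpoly_dense (periodic_derive pX DX) cX d0.
have [Y tY [c Yc]] := trigpoly_primitive tT.
have cT := continuous_trigpoly tT.
(* X' has mean zero by periodicity, so the mean [c] of its approximation is no larger than the
   uniform error. *)
have cle : `|c| <= d.
  have I1 : circle_int (derive1 X) = 0.
    by rewrite (circle_int_derive DX cX) -[2 * pi]add0r pX subrr.
  have I2 : circle_int (fun x => T x - c) = 0.
    rewrite (circle_int_derive Yc); last first.
      by move=> x; apply: cvgB; [exact: cT|exact: cvg_cst].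
    by rewrite -[2 * pi]add0r (periodic_trigpoly tY) subrr.
  have T1 := continuous_L1 cT; have X1 := continuous_L1 cX.
  have {I2}I2 : circle_int T = 2 * pi * c.
    by apply/eqP; rewrite -circle_int_cst -subr_eq0 -circle_intB// ?I2//; exact: circle_L1_cst.
  have TX1 : circle_L1 (fun x => T x - derive1 X x).
    by apply: continuous_L1 => x; apply: cvgB; [exact: cT|exact: cX].
  have := normr_circle_int TX1.
  rewrite circle_intB// I1 I2 subr0 normrM gtr0_norm// => h.
  have := le_circle_int (circle_L1_norm TX1) (circle_L1_cst d) TX.
  by rewrite circle_int_cst => /(le_trans h); rewrite ler_pM2l.
have [dY [M [YM VM]]] := trigpoly_variation_kernel u2 vc vs tY.
have [DY _ _] := YM.
have dYE x : dY x = T x - c.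
  by rewrite -(@derive_val _ _ _ _ _ _ _ (DY x)) (@derive_val _ _ _ _ _ _ _ (Yc x)).
have XY x : `|derive1 X x - dY x| <= 2 * d.
  rewrite dYE (_ : _ - _ = c - (T x - derive1 X x)); last by ring.
  by apply: (le_trans (ler_normB _ _)); have := TX x; lra.
have [t0 t00 Ht] := half_energy_flow hu pX (periodic_trigpoly tY) DX cX YM XY
  (divr_gt0 e0 (mulr_gt0 (ltr0n R 2) E1)).
exists t0 => // t tt; rewrite hE; apply: (le_trans _ (le_trans (Ht t tt) _)).
  by rewrite VM !mulr0.
rewrite ler_wpM2r// /d.
rewrite (_ : _ + _ = e / (half_energy u + 1)); last by field; rewrite gt_eqF.
by rewrite mulrAC ler_pdivrMr// ler_wpM2l ?(ltW e0)// lerDl.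
Qed.

(** The sum runs over the whole range 0 to k: the end terms have weight 0, and this range matches
    that of [hopf_sin] and [hopf_cos]. *)
Definition hopf_coef (m : nat) (u : R -> 'rV[R]_m) k : R[i] :=
  \sum_(p < k.+1) (p * (k - p))%:R * dot (fourier u p%:Z) (fourier u (k - p)%:Z).

(** The set of pairs is the graph of j = k - i without its two ends, and at those ends the weight i
    (k - i) is 0. *)
Lemma hopf_coef_pairs (m : nat) (u : R -> 'rV[R]_m) k :
  \sum_(p : 'I_k.+1 * 'I_k.+1 |
          [&& (0 < p.1)%N, (0 < p.2)%N & (p.1 + p.2 == k)%N])
    dot (p.1%:R *: fourier u p.1%:Z) (p.2%:R *: fourier u p.2%:Z) = hopf_coef u k.
Proof.
have dotZ (a b : R[i]) (v w : 'rV_m) : dot (a *: v) (b *: w) = a * b * dot v w.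
  by rewrite /dot mulr_sumr; apply: eq_bigr => j _; rewrite !mxE mulrACA.
rewrite -(pair_big_dep xpredT
  (fun i j : 'I_k.+1 => [&& (0 < i)%N, (0 < j)%N & (i + j == k)%N])
  (fun i j : 'I_k.+1 => dot (i%:R *: fourier u i%:Z) (j%:R *: fourier u j%:Z)))/=.
apply: eq_bigr => i _; have ik : (k - i < k.+1)%N by rewrite ltnS leq_subr.
have [/eqP e|ne] := boolP (i * (k - i) == 0)%N.
  rewrite e mul0r big_pred0// => j; apply/negbTE/negP => /and3P[i0 j0 /eqP ij].
  by move/eqP: e; rewrite muln_eq0; move: i0 j0 ij; clear; lia.
rewrite (big_pred1 (Ordinal ik)); last first.
  move=> j /=; rewrite -val_eqE /=; move: ne (ltn_ord i); rewrite muln_eq0; lia.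
by rewrite /= dotZ natrM.
Qed.

(** Each of the two Fourier coefficients is ([ccos] - i [csin]) / (2 pi), and the cross term of the
    squared increment contributes -2; together they give the constant. *)
Lemma hopf_coef_variation (m : nat) (u : R -> 'rV[R]_m) k : L2circle u ->
  hopf_coef u k = (- (2 * (2 * pi) ^+ 2)^-1)%:C *
    ((\sum_(j < m) variation (fun x => u x 0 j) (@hopf_sin R k)) +i*
     (\sum_(j < m) variation (fun x => u x 0 j) (@hopf_cos R k))).
Proof.
move=> /L2circleP u2; have p0 : (pi : R) != 0 by rewrite gt_eqF// pi_gt0.
rewrite (_ : (_ +i* _) = \sum_(j < m) (variation (fun x => u x 0 j) (@hopf_sin R k) +i*
     variation (fun x => u x 0 j) (@hopf_cos R k))); last first.
  by apply/eqP; rewrite eq_complex !raddf_sum !eqxx.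
rewrite /hopf_coef mulr_sumr.
under eq_bigr do rewrite /dot mulr_sumr.
rewrite exchange_big; apply: eq_bigr => j _ /=.
rewrite variation_hopf_sin// variation_hopf_cos//.
set f := (fun x : R => u x 0 j).
rewrite (_ : (_ +i* _) = \sum_(p < k.+1) ((p * (k - p))%:R)%:C *
  ((- 2 * (ccos f p * ccos f (k - p) - csin f p * csin f (k - p))) +i*
   (2 * (csin f p * ccos f (k - p) + ccos f p * csin f (k - p))))); last first.
  apply/eqP; rewrite eq_complex !raddf_sum /= !mulr_sumr.
  by apply/andP; split; apply/eqP; apply: eq_bigr => p _; rewrite /= mul0r ?subr0 ?addr0 mulrCA.
rewrite mulr_sumr; apply: eq_bigr => p _; rewrite [RHS]mulrCA; congr (_ * _).
  exact/esym/(rmorph_nat (real_complex R)).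
rewrite !fourier_nat -/f; simpc.
move: (ccos f _) (csin f _) (ccos f _) (csin f _) (pi : R) p0 => a b c d P P0.
by congr (_ +i* _); field; exact: P0.
Qed.

Lemma half_stationary_hopf (m : nat) (u : R -> 'rV[R]_m) : H12 u ->
  half_stationary u <-> forall k, hopf_coef u k = 0.
Proof.
move=> hu; rewrite half_stationary_variation//; have [u2 _] := hu.
have p0 : (- (2 * (2 * pi) ^+ 2)^-1)%:C != 0 :> R[i].
  rewrite eq_complex /= eqxx andbT oppr_eq0 invr_eq0.
  by rewrite !mulf_neq0// ?expf_neq0// ?mulf_neq0// gt_eqF// pi_gt0.
split=> [[vc vs] k|H]; first by rewrite hopf_coef_variation// vc vs mulr0.
have {}H k : \sum_(j < m) variation (fun x => u x 0 j) (@hopf_sin R k) = 0 /\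
  \sum_(j < m) variation (fun x => u x 0 j) (@hopf_cos R k) = 0.
  move: (H k); rewrite hopf_coef_variation// => /eqP.
  by rewrite mulf_eq0 (negbTE p0) /= eq_complex /= => /andP[/eqP ? /eqP ?].
by split=> k; have [] := H k.
Qed.

End Stationarity.

(** * Complex power series *)

Section PowerSeries.
Local Open Scope complex_scope.
Variable R : realType.
Local Notation C := R[i].
Local Notation Re := (@complex.Re R).
Local Notation Im := (@complex.Im R).
(** The modulus as an element of [R]; the norm on [R[i]] takes its values in [R[i]]. *)
Definition modulus (z : C) : R := Normc.normc z.
Local Notation normc := modulus.

Implicit Types (a b : nat -> C) (z w : C) (k n : nat) (s : nat -> C).

Lemma normc_ge0 z : 0 <= normc z.
Proof. by case: z => x y; exact: sqrtr_ge0. Qed.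

Lemma normc_sqr z : normc z ^+ 2 = Re z ^+ 2 + Im z ^+ 2.
Proof. by case: z => x y; rewrite /modulus /= sqr_sqrtr// addr_ge0 ?sqr_ge0. Qed.

Lemma modulus0 : normc 0 = 0.
Proof. exact: Normc.normc0. Qed.

Lemma modulus1 : normc 1 = 1.
Proof. exact: Normc.normc1. Qed.

Lemma modulusM z w : normc (z * w) = normc z * normc w.
Proof. exact: Normc.normcM. Qed.

Lemma normcD z w : normc (z + w) <= normc z + normc w.
Proof. exact: le_normcD. Qed.

Lemma normcX z n : normc (z ^+ n) = normc z ^+ n.
Proof.
by elim: n => [|n IH]; rewrite ?expr0 ?modulus1// !exprS modulusM IH.
Qed.

Lemma normc_nat n : normc n%:R = n%:R.
Proof.
rewrite -(rmorph_nat (real_complex R)) /modulus /= expr0n addr0 sqrtr_sqr.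
by rewrite ger0_norm.
Qed.

Lemma Re_le_normc z : `|Re z| <= normc z.
Proof.
rewrite -(@ler_pXn2r _ 2) ?nnegrE ?normc_ge0// normc_sqr real_normK ?num_real//.
by rewrite lerDl sqr_ge0.
Qed.

Lemma Im_le_normc z : `|Im z| <= normc z.
Proof.
rewrite -(@ler_pXn2r _ 2) ?nnegrE ?normc_ge0// normc_sqr real_normK ?num_real//.
by rewrite lerDr sqr_ge0.
Qed.

Lemma normc_sum (I : Type) (r : seq I) (P : pred I) (F : I -> C) :
  normc (\sum_(i <- r | P i) F i) <= \sum_(i <- r | P i) normc (F i).
Proof.
elim/big_ind2: _ => //; first by rewrite modulus0.
by move=> z x w y zx wy; apply: (le_trans (normcD _ _)); exact: lerD.
Qed.

Lemma ReM z w : Re (z * w) = Re z * Re w - Im z * Im w.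
Proof. by case: z w => [? ?] [? ?]. Qed.

Lemma ImM z w : Im (z * w) = Re z * Im w + Im z * Re w.
Proof. by case: z w => [? ?] [? ?]. Qed.

Lemma complex_eq z w : Re z = Re w -> Im z = Im w -> z = w.
Proof. by case: z w => [? ?] [? ?] /= -> ->. Qed.

(** Coordinatewise convergence, so that every limit is taken in [R]; [ps] follows the same
    convention. *)
Definition ccvg s z :=
  (fun n => Re (s n)) @ \oo --> Re z /\ (fun n => Im (s n)) @ \oo --> Im z.

Lemma ccvg_cst z : ccvg (fun=> z) z.
Proof. by split; exact: cvg_cst. Qed.

Lemma ccvgD s s' z w : ccvg s z -> ccvg s' w -> ccvg (fun n => s n + s' n) (z + w).
Proof.
move=> [s1 s2] [s1' s2']; split.
  rewrite raddfD (_ : (fun n => _) = (fun n => Re (s n) + Re (s' n))).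
    exact: cvgD.
  by apply/funext => n; rewrite raddfD.
rewrite raddfD (_ : (fun n => _) = (fun n => Im (s n) + Im (s' n))).
  exact: cvgD.
by apply/funext => n; rewrite raddfD.
Qed.

Lemma ccvgM s s' z w : ccvg s z -> ccvg s' w -> ccvg (fun n => s n * s' n) (z * w).
Proof.
move=> [s1 s2] [s1' s2']; split.
  rewrite ReM (_ : (fun n => _) = (fun n => Re (s n) * Re (s' n) - Im (s n) * Im (s' n))).
    by apply: cvgB; exact: cvgM.
  by apply/funext => n; rewrite ReM.
rewrite ImM (_ : (fun n => _) = (fun n => Re (s n) * Im (s' n) + Im (s n) * Re (s' n))).
  by apply: cvgD; exact: cvgM.
by apply/funext => n; rewrite ImM.
Qed.

Lemma ccvgB s s' z w : ccvg s z -> ccvg s' w -> ccvg (fun n => s n - s' n) (z - w).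
Proof.
move=> sz sw; have := ccvgD sz (ccvgM (ccvg_cst (-1)) sw).
by rewrite mulN1r; congr ccvg; apply/funext => n; rewrite mulN1r.
Qed.

Lemma ccvg_unique s z w : ccvg s z -> ccvg s w -> z = w.
Proof.
move=> [s1 s2] [s1' s2']; apply: complex_eq.
  by rewrite -(cvg_lim _ s1)// -(cvg_lim _ s1').
by rewrite -(cvg_lim _ s2)// -(cvg_lim _ s2').
Qed.

Lemma ccvg_shift s z n : ccvg s z -> ccvg (fun k => s (k + n)%N) z.
Proof.
move=> [s1 s2]; split.
  by have := s1; rewrite -(cvg_shiftn n).
by have := s2; rewrite -(cvg_shiftn n).
Qed.

Lemma ccvg0 s (e : nat -> R) : (forall n, normc (s n) <= e n) -> e @ \oo --> (0 : R) ->
  ccvg s 0.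
Proof.
move=> se e0; have eN : (fun n => - e n) @ \oo --> (0 : R) by rewrite -oppr0; exact: cvgN.
split; apply: (squeeze_cvgr _ eN e0); apply: nearW => n; rewrite -ler_norml.
  exact: (le_trans (Re_le_normc _)).
exact: (le_trans (Im_le_normc _)).
Qed.

Lemma ccvg_normc_le s z (K : R) : ccvg s z -> (forall n, normc (s n) <= K) -> normc z <= K.
Proof.
move=> [s1 s2] sK; have K0 : 0 <= K by apply: le_trans (sK 0%N); exact: normc_ge0.
rewrite -(@ler_pXn2r _ 2) ?nnegrE ?normc_ge0// normc_sqr.
have H : (fun n => Re (s n) ^+ 2 + Im (s n) ^+ 2) @ \oo --> Re z ^+ 2 + Im z ^+ 2.
  by apply: cvgD; rewrite expr2; under eq_fun do rewrite expr2; exact: cvgM.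
rewrite -(cvg_lim _ H)//; apply: limr_le; first by apply/cvg_ex; eexists; exact: H.
by apply: nearW => n; rewrite -normc_sqr ler_pXn2r ?nnegrE ?normc_ge0.
Qed.

Definition psum a z n : C := \sum_(k < n) a k * z ^+ k.

Lemma psumS a z n : psum a z n.+1 = a 0%N + \sum_(k < n) a k.+1 * z ^+ k.+1.
Proof. by rewrite /psum big_ord_recl expr0 mulr1. Qed.

Lemma psumS2 a z n :
  psum a z n.+2 = a 0%N + a 1%N * z + \sum_(k < n) a k.+2 * z ^+ k.+2.
Proof. by rewrite psumS big_ord_recl addrA. Qed.

Definition ps a z : C := limn (fun n => Re (psum a z n)) +i* limn (fun n => Im (psum a z n)).

(* The radius of convergence is at least 1. *)
Definition radius1 a := forall x : R, 0 < x < 1 ->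
  exists B : R, forall k, normc (a k) * x ^+ k <= B.

Lemma geometric_sum_le (x : R) n : 0 <= x < 1 -> \sum_(i < n) x ^+ i <= (1 - x)^-1.
Proof.
move=> /andP[x0 x1]; rewrite -[leRHS]mul1r ler_pdivlMr ?subr_gt0//.
have := subrX1 x n; have := exprn_ge0 n x0; move: (\sum_(i < n) _) (x ^+ n) => S y.
by lra.
Qed.

(** Each of the k + 1 terms of the geometric sum up to x^k is at least x^k. *)
Lemma mulXn_le (x : R) k : 0 <= x < 1 -> k.+1%:R * x ^+ k <= (1 - x)^-1.
Proof.
move=> x01; apply: le_trans (geometric_sum_le k.+1 x01).
rewrite (_ : _ * _ = \sum_(i < k.+1) x ^+ k); last first.
  by rewrite sumr_const card_ord mulr_natl.
case/andP: x01 => x0 x1; apply: ler_sum => i _.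
by apply: ler_wiXn2l => //; [exact: ltW | rewrite -ltnS].
Qed.

Lemma geometric_dominated_cvg (v : nat -> R) (B x : R) : 0 <= x < 1 ->
  (forall k, `|v k| <= B * x ^+ k) -> cvgn (fun n => \sum_(k < n) v k).
Proof.
move=> /andP[x0 x1] vB.
have B0 : 0 <= B by have := vB 0%N; rewrite expr0 mulr1; apply: le_trans.
rewrite (_ : (fun n => _) = series v); last first.
  by apply/funext => n; rewrite /series /= big_mkord.
apply: normed_cvg; apply: (series_le_cvg _ _ vB) => //.
  by move=> n; rewrite mulr_ge0// exprn_ge0.
by have := @is_cvg_geometric_series R B x; rewrite ger0_norm//; apply.
Qed.

(** The boundedness hypothesis is used at the midpoint s of r and 1, which leaves the geometric
    ratio r / s. *)
Lemma radius1_bound a (r : R) : radius1 a -> 0 <= r < 1 ->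
  exists B x : R, [/\ 0 <= B, 0 <= x < 1 & forall k, normc (a k) * r ^+ k <= B * x ^+ k].
Proof.
move=> ra /andP[r0 r1]; pose s := (1 + r) / 2.
have s0 : 0 < s by rewrite /s; lra.
have [B HB] : exists B : R, forall k, normc (a k) * s ^+ k <= B by apply: ra; rewrite /s; lra.
have B0 : 0 <= B.
  by have := HB 0%N; rewrite expr0 mulr1; apply: le_trans; exact: normc_ge0.
exists B, (r / s); split => //.
  rewrite divr_ge0 ?(ltW s0)// ltr_pdivrMr// /s; lra.
move=> k; rewrite exprMn exprVn (_ : B * _ = B / s ^+ k * r ^+ k); last by ring.
by rewrite ler_wpM2r ?exprn_ge0// ler_pdivlMr ?exprn_gt0.
Qed.

Lemma radius1_sum_le a (r : R) : radius1 a -> 0 <= r < 1 ->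
  exists2 K : R, 0 <= K & forall n, \sum_(k < n) normc (a k) * r ^+ k <= K.
Proof.
move=> ra r01; have [B [x [B0 x01 H]]] := radius1_bound ra r01.
have x1 : 0 <= (1 - x)^-1 by rewrite invr_ge0; case/andP: x01 => *; lra.
exists (B * (1 - x)^-1); first by rewrite mulr_ge0.
move=> n; apply: (@le_trans _ _ (\sum_(k < n) B * x ^+ k)); first exact: ler_sum.
by rewrite -mulr_sumr ler_wpM2l// geometric_sum_le.
Qed.

Lemma psum_cvg a z : radius1 a -> normc z < 1 -> ccvg (psum a z) (ps a z).
Proof.
move=> ra z1; have z01 : 0 <= normc z < 1 by rewrite normc_ge0.
have [B [x [B0 x01 H]]] := radius1_bound ra z01.
split.
  have := @geometric_dominated_cvg (fun k => Re (a k * z ^+ k)) B x x01.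
  rewrite (_ : (fun n => \sum_(k < n) _) = fun n => Re (psum a z n)); last first.
    by apply/funext => n; rewrite /psum raddf_sum.
  apply => k; apply: (le_trans (Re_le_normc _)); rewrite modulusM normcX; exact: H.
have := @geometric_dominated_cvg (fun k => Im (a k * z ^+ k)) B x x01.
rewrite (_ : (fun n => \sum_(k < n) _) = fun n => Im (psum a z n)); last first.
  by apply/funext => n; rewrite /psum raddf_sum.
apply => k; apply: (le_trans (Im_le_normc _)); rewrite modulusM normcX; exact: H.
Qed.

Definition ps_deriv a k : C := k.+1%:R * a k.+1.

Lemma radius1_deriv a : radius1 a -> radius1 (ps_deriv a).
Proof.
move=> ra x /andP[x0 x1]; pose s := (1 + x) / 2.
have s0 : 0 < s by rewrite /s; lra.
have [B HB] : exists B : R, forall k, normc (a k) * s ^+ k <= B by apply: ra; rewrite /s; lra.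
have xs : 0 <= x / s < 1.
  by rewrite divr_ge0 ?(ltW s0) ?(ltW x0)// ltr_pdivrMr// /s; lra.
clearbody s; exists (B / s * (1 - x / s)^-1) => k.
rewrite /ps_deriv modulusM normc_nat.
rewrite (_ : _ * _ = (normc (a k.+1) * s ^+ k.+1) / s * (k.+1%:R * (x / s) ^+ k)); last first.
  have E (p S t y c : R) : t != 0 -> S != 0 -> c * p * y = p * (t * S) / t * (c * (y * S^-1)).
    by move=> ? ?; field; apply/andP.
  by rewrite exprMn exprVn exprS; apply: E; rewrite ?expf_neq0 ?gt_eqF.
apply: ler_pM; last exact: mulXn_le.
- by rewrite divr_ge0 ?(ltW s0)// mulr_ge0 ?normc_ge0// exprn_ge0// ltW.
- by rewrite mulr_ge0// exprn_ge0//; case/andP: xs.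
- by rewrite ler_wpM2r// invr_ge0 ltW.
Qed.

(** The Taylor remainders satisfy R(n+1) = w R(n) + (n+2) z^(n+1) (w - z)^2, so induction replaces
    the binomial expansion. *)
Lemma exprB_le z w (r : R) n : normc z <= r -> normc w <= r ->
  normc (w ^+ n.+2 - z ^+ n.+2 - n.+2%:R * z ^+ n.+1 * (w - z)) <=
  (n.+2 * n.+1)%:R * r ^+ n * normc (w - z) ^+ 2.
Proof.
move=> zr wr; have r0 : 0 <= r by apply: le_trans zr; exact: normc_ge0.
elim: n => [|n IH].
  rewrite (_ : _ - _ = (w - z) ^+ 2); last by ring.
  rewrite normcX expr0 mulr1 ler_peMl ?sqr_ge0//; lra.
rewrite (_ : _ - _ = w * (w ^+ n.+2 - z ^+ n.+2 - n.+2%:R * z ^+ n.+1 * (w - z)) +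
  n.+2%:R * z ^+ n.+1 * (w - z) ^+ 2); last by rewrite !exprS; ring.
apply: (le_trans (normcD _ _)); rewrite !modulusM !normcX normc_nat.
have h1 : normc z ^+ n.+1 <= r ^+ n.+1 by apply: lerXn2r; rewrite ?nnegrE ?normc_ge0.
have d0 := sqr_ge0 (normc (w - z)).
apply: (@le_trans _ _ (r * ((n.+2 * n.+1)%:R * r ^+ n * normc (w - z) ^+ 2) +
   n.+2%:R * r ^+ n.+1 * normc (w - z) ^+ 2)).
  apply: lerD; first by apply: ler_pM; rewrite ?normc_ge0.
  by rewrite ler_wpM2r// ler_wpM2l.
rewrite (_ : _ + _ = ((n.+2 * n.+1)%:R + n.+2%:R) * (r ^+ n.+1 * normc (w - z) ^+ 2)); last first.
  by rewrite (exprS r); ring.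
by rewrite -mulrA ler_wpM2r ?mulr_ge0 ?exprn_ge0 ?normc_ge0// -natrD ler_nat; lia.
Qed.

(** A quadratic remainder, uniform on each smaller disc, replaces a theory of complex
    differentiation. Its constant bounds the sum of moduli of the twice differentiated series at
    radius [r]. *)
Lemma ps_diff a (r : R) : radius1 a -> 0 <= r < 1 -> exists2 K : R, 0 <= K &
  forall z w, normc z <= r -> normc w <= r ->
    normc (ps a w - ps a z - ps (ps_deriv a) z * (w - z)) <= K * normc (w - z) ^+ 2.
Proof.
move=> ra r01; have [r0 r1] := andP r01.
have rd := radius1_deriv ra; have rdd := radius1_deriv rd.
have [K K0 HK] := radius1_sum_le rdd r01.
exists K => // z w zr wr.
have z1 := le_lt_trans zr r1; have w1 := le_lt_trans wr r1.
(* The shifts 2 and 1 align the truncations: the constant and linear terms cancel and each remaining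
   summand is the remainder of a single power. *)
have L := ccvgB (ccvgB (ccvg_shift 2 (psum_cvg ra w1)) (ccvg_shift 2 (psum_cvg ra z1)))
  (ccvgM (ccvg_shift 1 (psum_cvg rd z1)) (ccvg_cst (w - z))).
apply: (ccvg_normc_le L) => n.
rewrite (_ : _ - _ = \sum_(k < n) a k.+2 *
    (w ^+ k.+2 - z ^+ k.+2 - k.+2%:R * z ^+ k.+1 * (w - z))); last first.
  rewrite (eq_bigr (fun k : 'I_n => a k.+2 * w ^+ k.+2 - a k.+2 * z ^+ k.+2 -
    ps_deriv a k.+1 * z ^+ k.+1 * (w - z))); last by move=> k _; rewrite /ps_deriv; ring.
  rewrite !sumrB -mulr_suml addn2 addn1 !psumS2 psumS /ps_deriv.
  by ring.
apply: (le_trans (normc_sum _ _ _)).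
apply: (@le_trans _ _ (\sum_(k < n) normc (ps_deriv (ps_deriv a) k) * r ^+ k *
   normc (w - z) ^+ 2)); last by rewrite -mulr_suml ler_wpM2r ?sqr_ge0.
apply: ler_sum => k _; rewrite modulusM.
apply: (le_trans (ler_wpM2l (normc_ge0 _) (exprB_le k zr wr))).
rewrite /ps_deriv !modulusM !normc_nat natrM le_eqVlt; apply/orP; left; apply/eqP; ring.
Qed.

Definition cauchy_prod a b k : C := \sum_(p < k.+1) a p * b (k - p)%N.

Lemma convolution_le (a b : nat -> R) (B B' x : R) : 0 <= x ->
  (forall k, 0 <= a k) -> (forall k, 0 <= b k) ->
  (forall k, a k * x ^+ k <= B) -> (forall k, b k * x ^+ k <= B') ->
  forall k, (\sum_(p < k.+1) a p * b (k - p)%N) * x ^+ k <= k.+1%:R * (B * B').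
Proof.
move=> x0 a0 b0 aB bB k; rewrite mulr_suml.
apply: (@le_trans _ _ (\sum_(p < k.+1) B * B')); last first.
  by rewrite sumr_const card_ord mulr_natl.
apply: ler_sum => p _; have pk : (p <= k)%N by rewrite -ltnS.
rewrite (_ : x ^+ k = x ^+ p * x ^+ (k - p)); last by rewrite -exprD subnKC.
rewrite mulrACA.
by apply: ler_pM => //; rewrite mulr_ge0// exprn_ge0.
Qed.

(** The product of the two truncations is a polynomial whose first [n] coefficients are those of the
    Cauchy product; what remains has degrees n to 2n - 1 and is geometrically small. *)
Lemma ccvg_psum_conv a b z : radius1 a -> radius1 b -> normc z < 1 ->
  exists B x : R, [/\ 0 <= B, 0 <= x < 1 & forall n,
    normc (psum a z n * psum b z n - psum (cauchy_prod a b) z n) <= B * x ^+ n].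
Proof.
move=> ra rb z1; have z0 := normc_ge0 z.
(* Two radii between |z| and 1: coefficients are bounded at [t], the ratio s/t absorbs the factor k
   + 1 of a convolution, and |z|/s provides the decay. *)
pose s : R := (1 + normc z) / 2; pose t : R := (1 + s) / 2.
have zs : normc z < s by rewrite /s; lra.
have st : s < t by rewrite /t /s; lra.
have t1 : t < 1 by rewrite /t /s; lra.
clearbody s; clearbody t.
have s0 : 0 < s by lra.
have t0 : 0 < t by lra.
have t01 : 0 < t < 1 by rewrite t0.
have [A HA] := ra t t01; have [B HB] := rb t t01.
have A0 : 0 <= A by have := HA 0%N; rewrite expr0 mulr1; apply: le_trans; exact: normc_ge0.
have B0 : 0 <= B by have := HB 0%N; rewrite expr0 mulr1; apply: le_trans; exact: normc_ge0.
have y01 : 0 <= s / t < 1 by rewrite divr_ge0 ?(ltW s0) ?(ltW t0)// ltr_pdivrMr// mul1r.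
have x01 : 0 <= normc z / s < 1 by rewrite divr_ge0 ?(ltW s0)// ltr_pdivrMr// mul1r.
pose D := A * B * (1 - s / t)^-1.
have i0 (y : R) : 0 <= y < 1 -> 0 <= (1 - y)^-1.
  by case/andP=> *; rewrite invr_ge0; lra.
have D0 : 0 <= D by rewrite !mulr_ge0// i0.
exists (D * (1 - normc z / s)^-1), (normc z / s); split => //.
  by rewrite mulr_ge0// i0.
move=> n; pose P := \poly_(k < n) a k; pose Q := \poly_(k < n) b k.
have PE : P.[z] = psum a z n by rewrite horner_poly.
have QE : Q.[z] = psum b z n by rewrite horner_poly.
have cle (p : {poly C}) (c : nat -> C) : p = \poly_(k < n) c k -> forall k, normc p`_k <= normc (c k).
  move=> -> k; rewrite coef_poly; case: ifP => // _; rewrite modulus0; exact: normc_ge0.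
have cPQ k : normc (P * Q)`_k * t ^+ k <= k.+1%:R * (A * B).
  have H := @convolution_le (fun k => normc (a k)) (fun k => normc (b k)) A B t
    (ltW t0) (fun k => normc_ge0 _) (fun k => normc_ge0 _) HA HB k.
  apply: (le_trans _ H); rewrite ler_wpM2r ?exprn_ge0 ?(ltW t0)// coefM.
  apply: (le_trans (normc_sum _ _ _)); apply: ler_sum => p _; rewrite modulusM.
  by apply: ler_pM; rewrite ?normc_ge0// cle.
have cz k : normc ((P * Q)`_k * z ^+ k) <= D * (normc z / s) ^+ k.
  rewrite modulusM normcX.
  have E : normc (P * Q)`_k * normc z ^+ k =
     normc (P * Q)`_k * t ^+ k * (s / t) ^+ k * (normc z / s) ^+ k.
    rewrite -!mulrA -!exprMn; congr (_ * _ ^+ _); field.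
    by rewrite !gt_eqF.
  rewrite E ler_wpM2r ?exprn_ge0//; first by case/andP: x01.
  apply: (@le_trans _ _ (k.+1%:R * (A * B) * (s / t) ^+ k)).
    by rewrite ler_wpM2r// exprn_ge0//; case/andP: y01.
  rewrite mulrAC mulrC /D ler_wpM2l ?mulr_ge0//; exact: mulXn_le.
have sPQ : (size (P * Q)%R <= n + n)%N.
  apply: (leq_trans (size_polyMleq _ _)).
  by apply: (leq_trans (leq_pred _)); apply: leq_add; exact: size_poly.
rewrite -PE -QE -hornerM (horner_coef_wide _ sPQ) big_split_ord /=.
have -> : \sum_(i < n) (P * Q)`_i * z ^+ i = psum (cauchy_prod a b) z n.
  apply: eq_bigr => i _; congr (_ * _); rewrite coefM; apply: eq_bigr => p _.
  have pn : (p < n)%N by apply: leq_ltn_trans (ltn_ord i); rewrite -ltnS.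
  have qn : (i - p < n)%N by apply: leq_ltn_trans (ltn_ord i); exact: leq_subr.
  by rewrite !coef_poly pn qn.
rewrite addrAC subrr add0r; apply: (le_trans (normc_sum _ _ _)).
apply: (@le_trans _ _ (\sum_(i < n) D * (normc z / s) ^+ n * (normc z / s) ^+ i)).
  by apply: ler_sum => i _; apply: (le_trans (cz _)); rewrite exprD mulrA.
rewrite -mulr_sumr [leRHS]mulrAC ler_wpM2l ?geometric_sum_le//.
by rewrite mulr_ge0// exprn_ge0//; case/andP: x01.
Qed.

Lemma ps_conv_cvg a b z : radius1 a -> radius1 b -> normc z < 1 ->
  ccvg (psum (cauchy_prod a b) z) (ps a z * ps b z).
Proof.
move=> ra rb z1; have [B [x [B0 /andP[x0 x1] H]]] := ccvg_psum_conv ra rb z1.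
have h : ccvg (fun n => psum a z n * psum b z n - psum (cauchy_prod a b) z n) 0.
  by apply: (ccvg0 H); apply: cvg_geometric; rewrite ger0_norm.
have := ccvgB (ccvgM (psum_cvg ra z1) (psum_cvg rb z1)) h.
by rewrite subr0; congr ccvg; apply/funext => n; rewrite subKr.
Qed.

Lemma ccvg_ps a z w : ccvg (psum a z) w -> ps a z = w.
Proof. by move=> [h1 h2]; apply: complex_eq; exact: cvg_lim. Qed.

Lemma radius1_shift a : radius1 a -> radius1 (fun k => a k.+1).
Proof.
move=> ra x x01; have [B HB] := ra x x01; have /andP[x0 x1] := x01.
exists (B / x) => k; rewrite ler_pdivlMr// -mulrA -exprSr; exact: HB.
Qed.

Lemma ps0 a : ps a 0 = a 0%N.
Proof.
apply: ccvg_ps; have h : ccvg (fun n => psum a 0 n.+1) (a 0%N).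
  rewrite (_ : (fun n => _) = fun=> a 0%N); first exact: ccvg_cst.
  apply/funext => n; rewrite psumS big1 ?addr0// => k _.
  by rewrite expr0n mulr0.
by case: h => h1 h2; split; rewrite -cvg_shiftS.
Qed.

Lemma ps_shift a z : radius1 a -> normc z < 1 ->
  ps a z = a 0%N + z * ps (fun k => a k.+1) z.
Proof.
move=> ra z1; have L := ccvg_shift 1 (psum_cvg ra z1).
apply: (ccvg_unique L).
have := ccvgD (ccvg_cst (a 0%N)) (ccvgM (ccvg_cst z) (psum_cvg (radius1_shift ra) z1)).
congr ccvg; apply/funext => n; rewrite addn1 psumS; congr (_ + _).
by rewrite /psum mulr_sumr; apply: eq_bigr => k _; rewrite exprS mulrCA.
Qed.

Lemma modulus_real (x : R) : 0 <= x -> normc x%:C = x.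
Proof. by move=> x0; rewrite /modulus /= expr0n addr0 sqrtr_sqr ger0_norm. Qed.

(** By [ps_diff] at 0, the value at [x] differs from the constant term by at most L x; the series
    vanishes at every small positive [x]. *)
Lemma ps_identity_coef0 a : radius1 a -> (forall x : R, 0 < x < 1 -> ps a x%:C = 0) ->
  a 0%N = 0.
Proof.
move=> ra a0; have r01 : 0 <= (2^-1 : R) < 1 by lra.
have [K K0 HK] := ps_diff ra r01.
pose L := normc (ps (ps_deriv a) 0) + K.
have L0 : 0 <= L by rewrite addr_ge0// normc_ge0.
have H (x : R) : 0 < x <= 2^-1 -> normc (a 0%N) <= L * x.
  move=> /andP[x0 x2].
  have := HK 0 x%:C; rewrite modulus0 modulus_real ?(ltW x0)// a0; last by lra.
  rewrite ps0 sub0r subr0 modulus_real ?(ltW x0)// => /(_ (ltac:(lra)) x2) h.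
  rewrite -[normc _](_ : normc (- a 0%N) = _); last first.
    by rewrite -mulN1r modulusM; rewrite /modulus /= ?oppr0 expr0n addr0 sqrrN expr1n sqrtr1 mul1r.
  rewrite (_ : - a 0%N = (- a 0%N - ps (ps_deriv a) 0 * x%:C) + ps (ps_deriv a) 0 * x%:C);
    last by ring.
  apply: (le_trans (normcD _ _)); rewrite [leRHS]mulrDl addrC.
  apply: lerD; first by rewrite modulusM modulus_real ?(ltW x0).
  by apply: (le_trans h); rewrite ler_wpM2l// expr2 ler_piMr ?(ltW x0)//; lra.
apply: Normc.eq0_normc; apply/eqP; rewrite eq_le normc_ge0 andbT.
apply/ler_addgt0Pr => e e0; rewrite add0r.
pose x := Num.min (2^-1) (e / (L + 1)).
have L1 : 0 < L + 1 by lra.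
have x0 : 0 < x by rewrite lt_min divr_gt0// andbT; lra.
have x2 : x <= 2^-1 by rewrite ge_min lexx.
have xe : x <= e / (L + 1) by rewrite ge_min lexx orbT.
apply: (le_trans (H x _)); first by rewrite x0.
apply: (le_trans (ler_wpM2l L0 xe)); rewrite mulrCA ler_piMr ?(ltW e0)//.
by rewrite ler_pdivrMr// mul1r lerDl.
Qed.

Lemma ps_identity a : radius1 a -> (forall x : R, 0 < x < 1 -> ps a x%:C = 0) ->
  forall k, a k = 0.
Proof.
move=> ra a0 k; elim: k a ra a0 => [|k IH] a ra a0; first exact: ps_identity_coef0.
apply: (IH (fun k => a k.+1)); first exact: radius1_shift.
move=> x x01; have /andP[x0 x1] := x01; have := a0 x x01.
rewrite ps_shift//; last by rewrite modulus_real// ltW.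
rewrite (ps_identity_coef0 ra a0) add0r => /eqP; rewrite mulf_eq0 => /orP[/eqP[xz]|/eqP//].
by rewrite xz ltxx in x0.
Qed.

End PowerSeries.

(** * Power series determined by their real or imaginary part *)

Section Harmonic.
Local Open Scope complex_scope.
Variable R : realType.
Local Notation C := R[i].
Local Notation normc := (@modulus R).
Local Notation Re := (@complex.Re R).
Local Notation Im := (@complex.Im R).
Implicit Types (a b : nat -> C) (z w : C) (k n : nat) (s : nat -> C).

Lemma radius1_conv a b : radius1 a -> radius1 b -> radius1 (cauchy_prod a b).
Proof.
move=> ra rb x /andP[x0 x1]; pose t : R := (1 + x) / 2.
have xt : x < t by rewrite /t; lra.
have t1 : t < 1 by rewrite /t; lra.
clearbody t; have t0 : 0 < t by lra.
have t01 : 0 < t < 1 by rewrite t0.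
have [A HA] := ra t t01; have [B HB] := rb t t01.
have A0 : 0 <= A by have := HA 0%N; rewrite expr0 mulr1; apply: le_trans; exact: normc_ge0.
have B0 : 0 <= B by have := HB 0%N; rewrite expr0 mulr1; apply: le_trans; exact: normc_ge0.
have y01 : 0 <= x / t < 1 by rewrite divr_ge0 ?(ltW x0) ?(ltW t0)// ltr_pdivrMr// mul1r.
exists (A * B * (1 - x / t)^-1) => k.
have H := @convolution_le R (fun k => normc (a k)) (fun k => normc (b k)) A B t
    (ltW t0) (fun k => normc_ge0 _) (fun k => normc_ge0 _) HA HB k.
have {}H : normc (cauchy_prod a b k) * t ^+ k <= k.+1%:R * (A * B).
  apply: (le_trans _ H); rewrite ler_wpM2r ?exprn_ge0 ?(ltW t0)//.
  apply: (le_trans (normc_sum _ _ _)); apply: ler_sum => p _.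
  by rewrite modulusM.
rewrite (_ : x ^+ k = t ^+ k * (x / t) ^+ k); last first.
  by rewrite -exprMn; congr (_ ^+ _); field; rewrite gt_eqF.
rewrite mulrA; apply: (@le_trans _ _ (k.+1%:R * (A * B) * (x / t) ^+ k)).
  by rewrite ler_wpM2r// exprn_ge0//; case/andP: y01.
by rewrite mulrAC mulrC ler_wpM2l ?mulr_ge0//; exact: mulXn_le.
Qed.

Lemma radius1_sum m (a : 'I_m -> nat -> C) : (forall j, radius1 (a j)) ->
  radius1 (fun k => \sum_(j < m) a j k).
Proof.
move=> ra x x01; have /choice[B HB] : forall j, exists B, forall k, normc (a j k) * x ^+ k <= B.
  by move=> j; exact: ra.
exists (\sum_(j < m) B j) => k.
apply: (@le_trans _ _ (\sum_(j < m) normc (a j k) * x ^+ k)); last exact: ler_sum.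
rewrite -mulr_suml ler_wpM2r ?normc_sum// exprn_ge0//; case/andP: x01 => /ltW//.
Qed.

Lemma ps_sum_conv m (a : 'I_m -> nat -> C) z : (forall j, radius1 (a j)) ->
  normc z < 1 ->
  ps (fun k => \sum_(j < m) cauchy_prod (a j) (a j) k) z = \sum_(j < m) ps (a j) z ^+ 2.
Proof.
move=> ra z1; apply: ccvg_ps.
have H (J : seq 'I_m) : ccvg (fun n => \sum_(j <- J) psum (cauchy_prod (a j) (a j)) z n)
    (\sum_(j <- J) ps (a j) z ^+ 2).
  elim: J => [|j J IH].
    rewrite big_nil (_ : (fun n => _) = fun=> 0); first exact: ccvg_cst.
    by apply/funext => n; rewrite big_nil.
  rewrite big_cons; under eq_fun do rewrite big_cons.
  by apply: ccvgD => //; rewrite expr2; exact: ps_conv_cvg.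
move: (H (index_enum 'I_m)); congr ccvg; apply/funext => n.
rewrite /psum exchange_big; apply: eq_bigr => k _ /=.
by rewrite mulr_suml.
Qed.

Lemma normc_expi (t : R) : normc (expi t) = 1.
Proof. by rewrite /modulus /= cos2Dsin2 sqrtr1. Qed.

(** Along each ray the real part is a real power series in [r], so Re(a_k e^(ikt)) = 0 for every t.
    For k = 0 the angle has no effect and an imaginary constant stays undetermined, hence 0 < k. *)
Lemma ps_Re_identity a : radius1 a ->
  (forall r t : R, 0 < r < 1 -> Re (ps a (r%:C * expi t)) = 0) ->
  forall k, (0 < k)%N -> a k = 0.
Proof.
move=> ra H k k0.
have key (t : R) : Re (a k * expi (k%:R * t)) = 0.
  pose b k : C := (Re (a k * expi (k%:R * t)))%:C.
  have rb : radius1 b.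
    move=> x x01; have [B HB] := ra x x01; exists B => l.
    apply: (le_trans _ (HB l)); rewrite ler_wpM2r ?exprn_ge0 ?(ltW (andP x01).1)//.
    rewrite /b {1}/modulus /= expr0n addr0 sqrtr_sqr.
    by apply: (le_trans (Re_le_normc _)); rewrite modulusM normc_expi mulr1.
  suff /(ps_identity rb) /(_ k) [] : forall x : R, 0 < x < 1 -> ps b x%:C = 0 by [].
  move=> x x01; have /andP[x0 x1] := x01.
  have z1 : normc (x%:C * expi t) < 1.
    by rewrite modulusM normc_expi mulr1 modulus_real// ltW.
  apply: ccvg_ps; have [h1 _] := psum_cvg ra z1; rewrite (H x t x01) in h1.
  have E n : psum b x%:C n = (Re (psum a (x%:C * expi t) n))%:C.
    rewrite /psum (_ : Re _ = \sum_(l < n) Re (a l * (x%:C * expi t) ^+ l)); last first.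
      exact: raddf_sum.
    rewrite [RHS](rmorph_sum (real_complex R)); apply: eq_bigr => l _ /=.
    have xl : x%:C ^+ l = (x ^+ l)%:C by rewrite -[RHS]/(real_complex R (x ^+ l)) rmorphXn.
    rewrite exprMn xl (_ : expi t ^+ l = expi (l%:R * t)); last first.
      by rewrite (expi_mulz l t).
    rewrite /b; move: (a l) (expi _) (x ^+ l) => [? ?] [? ?] y.
    by apply: complex_eq; rewrite /=; ring.
  split; under eq_fun do rewrite E; first exact: h1.
  by rewrite /=; exact: cvg_cst.
apply: complex_eq.
  by have := key 0; rewrite mulr0 expi0 mulr1.
(* At this angle e^(ikt) = i, which exposes the imaginary part. *)
have := key (pi / 2 / k%:R); rewrite mulrCA mulfV ?pnatr_eq0 -?lt0n// mulr1.
rewrite ReM /expi /= cos_pihalf sin_pihalf mulr0 mulr1 sub0r => /eqP.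
by rewrite oppr_eq0 => /eqP.
Qed.

Lemma ps_Im_identity a : radius1 a ->
  (forall r t : R, 0 < r < 1 -> Im (ps a (r%:C * expi t)) = 0) ->
  forall k, (0 < k)%N -> a k = 0.
Proof.
move=> ra H k k0; pose i : C := 0 +i* 1.
have i1 : normc i = 1 by rewrite /modulus /= expr0n expr1n add0r sqrtr1.
have ri : radius1 (fun k => i * a k).
  move=> x x01; have [B HB] := ra x x01; exists B => l.
  by rewrite modulusM i1 mul1r.
have i0 : i != 0 by rewrite eq_complex /= oner_eq0 andbF.
suff : i * a k = 0 by move/eqP; rewrite mulf_eq0 (negbTE i0) => /eqP.
apply: (ps_Re_identity ri _ k0) => r t r01; have /andP[r0 r1] := r01.
have z1 : normc (r%:C * expi t) < 1.
  by rewrite modulusM normc_expi mulr1 modulus_real// ltW.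
rewrite (_ : ps _ _ = i * ps a (r%:C * expi t)).
  by rewrite ReM H// mulr0 subr0 [Re i]/(0 : R) mul0r.
apply: ccvg_ps; have := ccvgM (ccvg_cst i) (psum_cvg ra z1).
congr ccvg; apply/funext => n; rewrite /psum mulr_sumr.
by apply: eq_bigr => l _; rewrite mulrA.
Qed.

End Harmonic.

(** * The harmonic extension *)

Section HarmonicExtension.
Local Open Scope complex_scope.
Variables (R : realType) (m : nat) (u : R -> 'rV[R]_m).
Hypothesis u2 : L2circle u.
Local Notation C := R[i].
Local Notation normc := (@modulus R).
Local Notation Re := (@complex.Re R).
Local Notation Im := (@complex.Im R).
Implicit Types (z w : C) (k n : nat) (j : 'I_m) (p : 'rV[R]_2).

Lemma modulus_le z : normc z <= `|Re z| + `|Im z|.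
Proof.
rewrite -(@ler_pXn2r _ 2) ?nnegrE ?normc_ge0 ?addr_ge0// normc_sqr.
rewrite -(real_normK (num_real (Re z))) -(real_normK (num_real (Im z))).
by have := mulr_ge0 (normr_ge0 (Re z)) (normr_ge0 (Im z)); nra.
Qed.

(** Coefficients of the holomorphic function F of which the extension is the real part: conjugate
    pairs of frequencies are merged, whence the factor 2 away from 0. *)
Definition analytic_coef j k : C :=
  if k is 0 then fourier u 0 0 j else 2 * fourier u k%:Z 0 j.

(** The Fourier coefficients of an integrable function are bounded by a multiple of its L^1 norm. *)
Lemma radius1_analytic_coef j : radius1 (analytic_coef j).
Proof.
have /L2circleP/(_ j) f2 := u2; set f := fun x => u x 0 j in f2.
have f1 := circle_L2_L1 f2; pose B := circle_int (fun x => `|f x|).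
have int_le g : (forall x, `|g x| <= 1) -> circle_L1 (fun x => f x * g x) ->
    `|circle_int (fun x => f x * g x)| <= B.
  move=> g1 fg1; apply: (le_trans (normr_circle_int fg1)); apply: le_circle_int.
  - exact: circle_L1_norm.
  - exact: circle_L1_norm.
  - by move=> x; rewrite normrM ler_piMr.
have hc k : `|ccos f k| <= B by apply: int_le => [x|]; [exact: cos_max|exact: circle_L1_cos].
have hs k : `|csin f k| <= B by apply: int_le => [x|]; [exact: sin_max|exact: circle_L1_sin].
have p0 : 0 <= (2 * pi)^-1 :> R by rewrite invr_ge0 mulr_ge0// pi_ge0.
have B0 : 0 <= B by apply: le_trans (hc 0%N).
have hf k : normc (fourier u k%:Z 0 j) <= 2 * ((2 * pi)^-1 * B).
  rewrite fourier_nat -/f; apply: (le_trans (modulus_le _)) => /=.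
  rewrite normrN !normrM (ger0_norm p0) -mulrDr mulrCA ler_wpM2l//.
  by have := hc k; have := hs k; lra.
move=> x /andP[x0 x1]; exists (2 * (2 * ((2 * pi)^-1 * B))) => k.
have hk : normc (analytic_coef j k) <= 2 * (2 * ((2 * pi)^-1 * B)).
  have D0 : 0 <= 2 * ((2 * pi)^-1 * B) by rewrite mulr_ge0// mulr_ge0.
  case: k => [|k]; first by apply: (le_trans (hf 0%N)); rewrite ler_peMl//; lra.
  by rewrite /analytic_coef modulusM normc_nat ler_wpM2l.
rewrite -[leRHS]mulr1; apply: ler_pM => //; first exact: normc_ge0.
  by rewrite exprn_ge0// ltW.
by rewrite exprn_ile1// ltW.
Qed.

Lemma sum_symmetric (g : int -> R) n :
  \sum_(i < n.*2.+1) g (i%:Z - n%:Z) =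
  g 0 + \sum_(k < n) (g k.+1%:Z + g (- k.+1%:Z)).
Proof.
elim: n => [|n IH]; first by rewrite big_ord_recl !big_ord0 subr0.
rewrite doubleS [in RHS]big_ord_recr /= addrA -IH big_ord_recl big_ord_recr /= sub0r.
rewrite [LHS]addrC -[LHS]addrA; congr (_ + _).
  by apply: eq_bigr => i _; congr g; rewrite /= /bump /=; lia.
by congr (g _ + _); rewrite /= /bump /=; lia.
Qed.

(** Frequencies k and -k contribute equal real parts. The range |k| <= n has n + 1 nonnegative
    frequencies, hence the truncation at [n.+1]. *)
Lemma harm_partialE p n j :
  Re (harm_partial u p n 0 j) = Re (psum (analytic_coef j) (complex_of p) n.+1).
Proof.
pose z := complex_of p.
pose g (k : int) : R := Re ((`|z| ^+ `|k|%N * (z / `|z|) ^ k) * fourier u k 0 j).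
have zk k : `|z| ^+ k * (z / `|z|) ^+ k = z ^+ k.
  rewrite -exprMn; congr (_ ^+ _); have [->|z0] := eqVneq z 0.
    by rewrite normr0 !mul0r.
  by rewrite mulrCA mulfV ?mulr1// normr_eq0.
have gN k : g (- k%:Z) = g k%:Z.
  rewrite /g abszN fourierN mxE -conj_dirX.
  have cn : (`|z|)^*%C = `|z| by rewrite normc_def /= oppr0.
  have cX : (`|z| ^+ k)^*%C = `|z| ^+ k by rewrite -[in RHS]cn -[LHS]/((conjc : {rmorphism _ -> _}) _) rmorphXn.
  rewrite absz_nat -{1}cX.
  by move: (`|z| ^+ k) (_ ^ _) (fourier u k 0 j) => [? ?] [? ?] [? ?] /=; ring.
have -> : Re (harm_partial u p n 0 j) = \sum_(i < n.*2.+1) g (i%:Z - n%:Z).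
  rewrite /harm_partial summxE (_ : Re _ = \sum_(i < n.*2.+1) Re ((
     let k := i%:Z - n%:Z in (`|z| ^+ `|k|%N * (z / `|z|) ^ k) *: fourier u k) 0 j)).
    by apply: eq_bigr => i _ /=; rewrite mxE.
  exact: raddf_sum.
rewrite sum_symmetric psumS raddfD; congr (_ + _).
  by rewrite /g expr0 expr0z !mul1r.
rewrite [RHS]raddf_sum; apply: eq_bigr => k _.
rewrite gN /g absz_nat -exprnP zk /analytic_coef -/z.
by move: (z ^+ k.+1) (fourier u _ 0 j) => [? ?] [? ?] /=; ring.
Qed.

Lemma harm_extE p j : normc (complex_of p) < 1 ->
  harm_ext u p 0 j = Re (ps (analytic_coef j) (complex_of p)).
Proof.
move=> z1; rewrite mxE; under eq_fun do rewrite harm_partialE.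
have [h _] := ccvg_shift 1 (psum_cvg (@radius1_analytic_coef j) z1).
rewrite -(cvg_lim _ h)//; congr (limn _); apply/funext => n.
by rewrite addn1.
Qed.

End HarmonicExtension.

(** * The differential of the harmonic extension *)

Lemma quadratic_differentiable (R : realType) (V W : normedModType R) (f : V -> W)
    (df : {linear V -> W}) (x : V) (K d : R) : continuous df -> 0 < d ->
  (forall h, `|h| <= d -> `|f (h + x) - (f x + df h)| <= K * `|h| ^+ 2) ->
  differentiable f x /\ 'd f x = df :> (V -> W).
Proof.
move=> cdf d0 H.
have lo : f \o shift x = cst (f x) + df +o_ 0 id.
  apply/eqaddoP => e e0; near=> h.
  apply: (le_trans (H h _)); first by near: h; exact: nbhs0_le.
  rewrite expr2 mulrA ler_wpM2r//.
  have : `|h| <= e / (`|K| + 1) by near: h; apply: nbhs0_le; rewrite divr_gt0// ltr_wpDl.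
  rewrite ler_pdivlMr ?ltr_wpDl// mulrC; apply: le_trans.
  by rewrite ler_wpM2r//; apply: (le_trans (ler_norm K)); rewrite lerDl.
have dE := diff_unique cdf lo.
by split => //; apply/diff_locallyP; rewrite dE.
Unshelve. all: by end_near. Qed.

Section HarmonicDifferential.
Local Open Scope complex_scope.
Variables (R : realType) (m : nat) (u : R -> 'rV[R]_m).
Hypothesis u2 : L2circle u.
Local Notation C := R[i].
Local Notation normc := (@modulus R).
Local Notation Re := (@complex.Re R).
Local Notation Im := (@complex.Im R).
Implicit Types (z w : C) (k n : nat) (j : 'I_m) (p X Y : 'rV[R]_2).

Definition analytic_deriv j z : C := ps (ps_deriv (analytic_coef u j)) z.

(** Acts on row vectors from the right; the minus sign is that of Re(F'(z) (x + iy)) = x Re F'(z) -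
    y Im F'(z). *)
Definition harm_jacobian z : 'M[R]_(2, m) :=
  \matrix_(i, j) if i == 0 then Re (analytic_deriv j z) else - Im (analytic_deriv j z).

Lemma harm_jacobianE z X j :
  (X *m harm_jacobian z) 0 j = Re (analytic_deriv j z * complex_of X).
Proof.
rewrite ReM mxE !big_ord_recl big_ord0 addr0 !mxE /=.
rewrite (_ : lift ord0 ord0 = 1); last exact: val_inj.
by rewrite mulrN mulrC (mulrC (X 0 1)).
Qed.

Lemma coord_le_norm n1 (X : 'rV[R]_n1) i : `|X 0 i| <= `|X|.
Proof. by rewrite [leRHS]/Num.Def.normr/= mx_normrE; exact: (le_bigmax _ _ (0, i)). Qed.

Lemma modulus_complex_of p : normc (complex_of p) <= 2 * `|p|.
Proof.
apply: (le_trans (modulus_le _)); rewrite mulr_natl mulr2n.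
by apply: lerD; exact: coord_le_norm.
Qed.

Lemma continuous_mulmxr z : continuous (mulmxr (harm_jacobian z) : 'rV[R]_2 -> 'rV[R]_m).
Proof.
rewrite (_ : GRing.Linear.sort _ = fun X : 'rV[R]_2 => X 0 0 *: row 0 (harm_jacobian z) +
   X 0 1 *: row 1 (harm_jacobian z)); last first.
  apply/funext => X; apply/rowP => j; rewrite /mulmxr !mxE !big_ord_recl big_ord0 addr0.
  by rewrite !mxE (_ : lift ord0 ord0 = 1)//; exact: val_inj.
move=> X; have cc (i : 'I_2) (v : 'rV[R]_m) :
    (fun X : 'rV[R]_2 => X 0 i *: v) Y @[Y --> X] --> X 0 i *: v.
  apply: (@cvgZr_tmp R 'rV[R]_m _ (nbhs X) (nbhs_filter X)).
  exact: (@coord_continuous R 1 2 0 i X).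
exact: cvgD (cc 0 _) (cc 1 _).
Qed.

Lemma harm_ext_diff p : normc (complex_of p) < 1 ->
  differentiable (harm_ext u) p /\
  ('d (harm_ext u) p : 'rV[R]_2 -> 'rV[R]_m) = mulmxr (harm_jacobian (complex_of p)).
Proof.
move=> z1; set z := complex_of p.
have z0 := normc_ge0 z.
have cf := @continuous_mulmxr z.
pose r : R := (1 + normc z) / 2.
have r01 : 0 <= r < 1 by rewrite /r; lra.
have zr : normc z <= r by rewrite /r; lra.
have /choice[K HK] : forall j, exists K : R, 0 <= K /\
    forall z w, normc z <= r -> normc w <= r ->
    normc (ps (analytic_coef u j) w - ps (analytic_coef u j) z -
       analytic_deriv j z * (w - z)) <= K * normc (w - z) ^+ 2.
  by move=> j; have [K K0 H] := ps_diff (radius1_analytic_coef u2 j) r01; exists K.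
pose S := \sum_j K j.
have S0 : 0 <= S by apply: sumr_ge0 => j _; case: (HK j).
have KS j : K j <= S.
  by rewrite /S (bigD1 j)//= lerDl sumr_ge0// => i _; case: (HK i).
(* Row vectors carry the sup norm, and the modulus of the associated complex number is at most twice
   that norm; hence the 4 in the constant and the 2 in the radius. *)
apply: (quadratic_differentiable (K := 4 * S) (d := (r - normc z) / 2)) => //.
  by rewrite /r; lra.
move=> h hr; rewrite [leLHS]/Num.Def.normr/= mx_normrE.
have S4 : 0 <= 4 * S * `|h| ^+ 2 by rewrite mulr_ge0 ?sqr_ge0// mulr_ge0.
apply: bigmax_le => // -[i j] _ /=; rewrite (ord1 i) {i}.
have zh : complex_of (h + p) = complex_of h + z.
  by apply: complex_eq; rewrite /= !mxE.
have h2 := modulus_complex_of h.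
have hzr : normc (complex_of h + z) <= r.
  by apply: (le_trans (normcD _ _)); lra.
have zh1 : normc (complex_of (h + p)) < 1.
  by rewrite zh; apply: (le_lt_trans hzr); rewrite /r; lra.
have E (A A' B : 'rV[R]_m) (x y : R) : A' 0 j = x -> A 0 j = y ->
    (A - (A' + B)) 0 j = y - (x + B 0 j).
  by move=> <- <-; rewrite !mxE.
rewrite (E _ _ _ _ _ (harm_extE u2 j z1) (harm_extE u2 j zh1)) harm_jacobianE.
rewrite zh -/z; have [K0 /(_ z (complex_of h + z) zr hzr)] := HK j.
rewrite addrK => hK; have := le_trans (Re_le_normc _) hK.
have RE (a b c : C) : Re (a - b - c) = Re a - (Re b + Re c).
  by case: a b c => [? ?] [? ?] [? ?] /=; ring.
rewrite RE => /le_trans; apply.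
apply: (@le_trans _ _ (S * (2 * `|h|) ^+ 2)); last by rewrite exprMn; lra.
by apply: ler_pM => //; [exact: sqr_ge0|rewrite ler_pXn2r ?nnegrE ?normc_ge0// mulr_ge0].
Qed.

End HarmonicDifferential.

(** * The Hopf differential and conformality *)

Section Conformality.
Local Open Scope complex_scope.
Variables (R : realType) (m : nat) (u : R -> 'rV[R]_m).
Hypothesis u2 : L2circle u.
Local Notation C := R[i].
Local Notation normc := (@modulus R).
Local Notation Re := (@complex.Re R).
Local Notation Im := (@complex.Im R).
Implicit Types (z w : C) (k n : nat) (j : 'I_m) (p X Y : 'rV[R]_2).

Lemma derive1_harm_ext (g : R -> 'rV[R]_2) (s : R) (d : 'rV[R]_2) :
  (forall i, is_derive s 1 (fun x : R => g x 0 i) (d 0 i)) ->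
  normc (complex_of (g s)) < 1 ->
  derive1 (fun x => harm_ext u (g x)) s = d *m harm_jacobian u (complex_of (g s)).
Proof.
move=> gd z1; have [dh dhE] := harm_ext_diff u2 z1.
have dg : derivable g s 1.
  by apply/derivable_mxP => i j; rewrite (ord1 i); have [] := gd j.
have Dg : 'D_1 g s = d.
  rewrite derive_mx//; apply/rowP => i; rewrite mxE; exact: derive_val.
have dfg : differentiable g s by apply/derivable1_diffP.
rewrite derive1E deriveE; last exact: differentiable_comp.
have E : 'd g s 1 = d by rewrite -deriveE.
have := congr1 (fun f => f 1) (diff_comp dfg dh) => /= ->.
by rewrite E dhE.
Qed.

Lemma complex_of_polar (r t : R) : complex_of (polar r t) = r%:C * expi t.
Proof. by apply: complex_eq; rewrite /complex_of /polar !mxE /=; ring. Qed.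

Lemma modulus_polar (r t : R) : 0 < r < 1 -> normc (r%:C * expi t) < 1.
Proof. by move=> /andP[r0 r1]; rewrite modulusM normc_expi mulr1 modulus_real// ltW. Qed.

Lemma dthetaE (r t : R) j : 0 < r < 1 ->
  dtheta (harm_ext u) r t 0 j = - (r * Im (analytic_deriv u j (r%:C * expi t) * expi t)).
Proof.
move=> r01; have z1 := modulus_polar t r01.
pose d : 'rV[R]_2 := \row_i if i == 0 then - (r * sin t) else r * cos t.
have D i : is_derive t 1 (fun x : R => polar r x 0 i) (d 0 i).
  rewrite mxE /polar; case: ifP => i0.
    rewrite (_ : (fun x => _) = fun x => r * cos x); last first.
      by apply/funext => x; rewrite mxE i0.
    have := is_derive1_comp (is_derive_mulc r (cos t)) (is_derive_cos t).
    by move=> h; apply: (is_derive_eq h); rewrite mulrN.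
  rewrite (_ : (fun x => _) = fun x => r * sin x); last first.
    by apply/funext => x; rewrite mxE i0.
  exact: (is_derive1_comp (is_derive_mulc r (sin t)) (is_derive_sin t)).
have z1' : normc (complex_of (polar r t)) < 1 by rewrite complex_of_polar.
rewrite /dtheta (derive1_harm_ext D z1') harm_jacobianE complex_of_polar.
by rewrite /complex_of !mxE; case: (analytic_deriv _ _ _) => a b /=; ring.
Qed.

Lemma dradialE (r t : R) j : 0 < r < 1 ->
  dradial (harm_ext u) r t 0 j = Re (analytic_deriv u j (r%:C * expi t) * expi t).
Proof.
move=> r01; have z1 := modulus_polar t r01.
pose d : 'rV[R]_2 := \row_i if i == 0 then cos t else sin t.
have D i : is_derive r 1 (fun x : R => polar x t 0 i) (d 0 i).
  rewrite mxE /polar; case: ifP => i0.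
    rewrite (_ : (fun x => _) = fun x => cos t * x); first exact: is_derive_mulc.
    by apply/funext => x; rewrite mxE i0 mulrC.
  rewrite (_ : (fun x => _) = fun x => sin t * x); first exact: is_derive_mulc.
  by apply/funext => x; rewrite mxE i0 mulrC.
have z1' : normc (complex_of (polar r t)) < 1 by rewrite complex_of_polar.
rewrite /dradial (derive1_harm_ext D z1') harm_jacobianE complex_of_polar.
by rewrite /complex_of !mxE; case: (analytic_deriv _ _ _) => a b /=; ring.
Qed.

(** The Hopf differential of the extension up to a factor 4, the complex derivative d/dz of Re F
    being F'/2. *)
Definition hopf_differential z : C := \sum_(j < m) analytic_deriv u j z ^+ 2.

Lemma hopf_coef_deriv k : 4 * hopf_coef u k.+2 =
  \sum_(j < m) cauchy_prod (ps_deriv (analytic_coef u j)) (ps_deriv (analytic_coef u j)) k.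
Proof.
rewrite /hopf_coef big_ord_recl mul0n mul0r add0r big_ord_recr /=.
rewrite /bump /= add1n subnn muln0 mul0r addr0 /cauchy_prod exchange_big mulr_sumr.
apply: eq_bigr => p _; have pk : (p <= k)%N by rewrite -ltnS.
rewrite /dot mulr_sumr mulr_sumr; apply: eq_bigr => j _.
rewrite /bump /= add1n subSS subSn// /ps_deriv /analytic_coef natrM.
by ring.
Qed.

Let hopf_series k : C :=
  \sum_(j < m) cauchy_prod (ps_deriv (analytic_coef u j)) (ps_deriv (analytic_coef u j)) k.

Lemma radius1_hopf_series : radius1 hopf_series.
Proof.
apply: (@radius1_sum R m (fun j => cauchy_prod _ _)) => j.
by apply: radius1_conv; apply: radius1_deriv; exact: radius1_analytic_coef.
Qed.

Lemma hopf_differentialE z : normc z < 1 -> ps hopf_series z = hopf_differential z.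
Proof.
move=> z1; apply: (@ps_sum_conv R m (fun j => ps_deriv (analytic_coef u j)) z) => // j.
by apply: radius1_deriv; exact: radius1_analytic_coef.
Qed.

Lemma hopf_coef_small : hopf_coef u 0 = 0 /\ hopf_coef u 1 = 0.
Proof.
by rewrite /hopf_coef !big_ord_recl !big_ord0 /= !mul0n ?mul0r ?muln0 ?mul0r ?addr0.
Qed.

Lemma hopf_coef_series :
  (forall k, hopf_coef u k = 0) <-> (forall k, hopf_series k = 0).
Proof.
split=> [H k|H]; first by rewrite /hopf_series -hopf_coef_deriv H mulr0.
case=> [|[|k]]; [exact: hopf_coef_small.1|exact: hopf_coef_small.2|].
have := H k; rewrite /hopf_series -hopf_coef_deriv => /eqP.
by rewrite mulf_eq0 pnatr_eq0 => /eqP.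
Qed.

Lemma hopf_differential_eq0 : (forall k, hopf_coef u k = 0) <->
  (forall z, normc z < 1 -> hopf_differential z = 0).
Proof.
rewrite hopf_coef_series; split=> [H z z1|H].
  rewrite -hopf_differentialE//; apply: ccvg_ps.
  rewrite (_ : psum _ _ = fun=> 0); first exact: ccvg_cst.
  by apply/funext => n; rewrite /psum big1// => k _; rewrite H mul0r.
apply: (ps_identity radius1_hopf_series) => x /andP[x0 x1].
have x1' : normc x%:C < 1 by rewrite modulus_real// ltW.
by rewrite hopf_differentialE// H.
Qed.

(** The series of z^2 F'.F', the quantity that polar derivatives see. Its constant coefficient is 0
    by construction, so nothing is lost when the real or imaginary part determines only the
    coefficients of positive index. *)
Let shifted_hopf_series k : C := if k is k'.+2 then hopf_series k' else 0.

Lemma shifted_hopf_seriesE z : normc z < 1 ->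
  ps shifted_hopf_series z = z ^+ 2 * hopf_differential z.
Proof.
move=> z1; rewrite -hopf_differentialE//; apply: ccvg_ps.
have L := ccvgM (ccvg_cst (z ^+ 2)) (psum_cvg radius1_hopf_series z1).
have {L} L : ccvg (fun n => psum shifted_hopf_series z (n + 2)%N) (z ^+ 2 * ps hopf_series z).
  move: L; congr ccvg; apply/funext => n; rewrite addn2 psumS2 /= mul0r !add0r.
  by rewrite /psum mulr_sumr; apply: eq_bigr => k _; rewrite mulrCA -exprD.
case: L => h1 h2; split.
  by move: h1; rewrite (cvg_shiftn 2 (fun n => Re (psum shifted_hopf_series z n))).
by move: h2; rewrite (cvg_shiftn 2 (fun n => Im (psum shifted_hopf_series z n))).
Qed.

Lemma radius1_shifted_hopf_series : radius1 shifted_hopf_series.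
Proof.
move=> x x01; have [B HB] := radius1_hopf_series x01; have /andP[x0 x1] := x01.
have B0 : 0 <= B by have := HB 0%N; rewrite expr0 mulr1; apply: le_trans; exact: normc_ge0.
exists B => -[|[|k]]; rewrite /shifted_hopf_series ?modulus0 ?mul0r//.
rewrite exprSr exprSr !mulrA; apply: (le_trans _ (HB k)).
have xk : 0 <= normc (hopf_series k) * x ^+ k by rewrite mulr_ge0 ?normc_ge0 ?exprn_ge0 ?ltW.
rewrite -mulrA; apply: ler_piMr => //; rewrite mulr_ile1 ?ltW//.
Qed.

(** The vectors p and q are the real and imaginary parts of e^(it) F'(z), and the bilinear square of
    p + iq has real part |p|^2 - |q|^2 and imaginary part 2 p.q. The minus sign in [q] comes from
    the angular derivative being -r times the imaginary part. *)
Lemma shifted_hopf_series_polar (r t : R) : 0 < r < 1 ->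
  let p := dradial (harm_ext u) r t in let q := - (r^-1) *: dtheta (harm_ext u) r t in
  ps shifted_hopf_series (r%:C * expi t) = (r ^+ 2)%:C * ((dot p p - dot q q) +i* (2 * dot p q)).
Proof.
move=> r01 p q; have z1 := modulus_polar t r01; have /andP[r0 _] := r01.
have pE j : p 0 j = Re (analytic_deriv u j (r%:C * expi t) * expi t) by exact: dradialE.
have qE j : q 0 j = Im (analytic_deriv u j (r%:C * expi t) * expi t).
  rewrite /q mxE dthetaE// mulrNN mulKf// gt_eqF//.
have rX : (r ^+ 2)%:C = r%:C ^+ 2 by rewrite -[LHS]/(real_complex R (r ^+ 2)) rmorphXn.
rewrite shifted_hopf_seriesE// exprMn rX -mulrA; congr (_ * _).
rewrite /hopf_differential mulr_sumr /dot -sumrB mulr_sumr.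
apply: complex_eq.
  rewrite /= (_ : Re _ = \sum_(j < m) Re (expi t ^+ 2 * analytic_deriv u j (r%:C * expi t) ^+ 2));
    last exact: raddf_sum.
  apply: eq_bigr => j _; rewrite pE qE -exprMn mulrC expr2; exact: ReM.
rewrite /= (_ : Im _ = \sum_(j < m) Im (expi t ^+ 2 * analytic_deriv u j (r%:C * expi t) ^+ 2));
  last exact: raddf_sum.
apply: eq_bigr => j _; rewrite pE qE -exprMn (mulrC (expi t)).
by move: (analytic_deriv u j _ * expi t) => [a b] /=; ring.
Qed.

Lemma dot_ge0 n (v : 'rV[R]_n) : 0 <= dot v v.
Proof. by apply: sumr_ge0 => j _; rewrite -expr2 sqr_ge0. Qed.

Lemma dotC n (v w : 'rV[R]_n) : dot v w = dot w v.
Proof. by apply: eq_bigr => j _; rewrite mulrC. Qed.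

Lemma dotZr n (a : R) (v w : 'rV[R]_n) : dot v (a *: w) = a * dot v w.
Proof. by rewrite /dot mulr_sumr; apply: eq_bigr => j _; rewrite mxE mulrCA. Qed.

Lemma enormZ n (a : R) (v : 'rV[R]_n) : enorm (a *: v) = `|a| * enorm v.
Proof.
rewrite /enorm (_ : dot (a *: v) (a *: v) = a ^+ 2 * dot v v).
  by rewrite sqrtrM ?sqr_ge0// sqrtr_sqr.
by rewrite dotZr dotC dotZr mulrA expr2.
Qed.

Lemma eq_enorm_polar (r t : R) : 0 < r < 1 ->
  r^-1 * enorm (dtheta (harm_ext u) r t) = enorm (dradial (harm_ext u) r t) <->
  Re (ps shifted_hopf_series (r%:C * expi t)) = 0.
Proof.
move=> r01; have /andP[r0 _] := r01; rewrite shifted_hopf_series_polar// ReM /= mul0r subr0.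
set p := dradial _ _ _; set q := - _ *: _.
have -> : r^-1 * enorm (dtheta (harm_ext u) r t) = enorm q.
  by rewrite enormZ normrN ger0_norm// invr_ge0 ltW.
have r2 : r ^+ 2 != 0 by rewrite expf_neq0// gt_eqF.
split=> [|/eqP].
  rewrite /enorm => /(congr1 (fun x => x ^+ 2)); rewrite !sqr_sqrtr ?dot_ge0// => ->.
  by rewrite subrr mulr0.
by rewrite mulf_eq0 (negbTE r2) /= subr_eq0 /enorm => /eqP ->.
Qed.

Lemma dot_rescale_eq0 n (r : R) (v w : 'rV[R]_n) : 0 < r ->
  dot w v = 0 <-> r ^+ 2 * (2 * dot v (- r^-1 *: w)) = 0.
Proof.
move=> r0; rewrite dotZr dotC; split=> [->|/eqP]; first by rewrite !mulr0.
by rewrite !mulf_eq0 oppr_eq0 invr_eq0 pnatr_eq0 ?expf_eq0 (gt_eqF r0) => /eqP.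
Qed.

Lemma dot_polar (r t : R) : 0 < r < 1 ->
  dot (dtheta (harm_ext u) r t) (dradial (harm_ext u) r t) = 0 <->
  Im (ps shifted_hopf_series (r%:C * expi t)) = 0.
Proof.
move=> r01; have /andP[r0 _] := r01.
rewrite shifted_hopf_series_polar// ImM /= mul0r addr0; exact: dot_rescale_eq0.
Qed.

Lemma shifted_hopf_series_eq0 :
  (forall k, (0 < k)%N -> shifted_hopf_series k = 0) -> forall k, hopf_coef u k = 0.
Proof. by move=> H; apply/hopf_coef_series => k; exact: (H k.+2). Qed.

Lemma hopf_coef_enorm : (forall k, hopf_coef u k = 0) <->
  (forall r t : R, 0 < r < 1 ->
     r^-1 * enorm (dtheta (harm_ext u) r t) = enorm (dradial (harm_ext u) r t)).
Proof.
split=> [/hopf_differential_eq0 H r t r01|H].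
  by apply/eq_enorm_polar; rewrite // shifted_hopf_seriesE ?modulus_polar// H ?modulus_polar// mulr0.
apply/shifted_hopf_series_eq0/(ps_Re_identity radius1_shifted_hopf_series) => r t r01.
exact/eq_enorm_polar/H.
Qed.

Lemma hopf_coef_dot : (forall k, hopf_coef u k = 0) <->
  (forall r t : R, 0 < r < 1 ->
     dot (dtheta (harm_ext u) r t) (dradial (harm_ext u) r t) = 0).
Proof.
split=> [/hopf_differential_eq0 H r t r01|H].
  by apply/dot_polar; rewrite // shifted_hopf_seriesE ?modulus_polar// H ?modulus_polar// mulr0.
apply/shifted_hopf_series_eq0/(ps_Im_identity radius1_shifted_hopf_series) => r t r01.
exact/dot_polar/H.
Qed.

Lemma modulus_disc p : disc p <-> normc (complex_of p) < 1.
Proof.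
have -> : (normc (complex_of p) < 1) = (normc (complex_of p) ^+ 2 < 1).
  by rewrite -[X in _ = (_ < X)](expr1n _ 2) ltr_pXn2r ?nnegrE ?normc_ge0.
rewrite normc_sqr /disc /= /dot !big_ord_recl big_ord0 addr0 -!expr2.
by rewrite (_ : lift ord0 ord0 = 1)//; exact: val_inj.
Qed.

Lemma disc_surj z : normc z < 1 -> exists2 p, disc p & complex_of p = z.
Proof.
move=> z1; pose p : 'rV[R]_2 := \row_i if i == 0 then Re z else Im z.
have pz : complex_of p = z by apply: complex_eq; rewrite /= !mxE.
by exists p => //; apply/modulus_disc; rewrite pz.
Qed.

Lemma dot_harm_jacobian z X Y :
  dot (X *m harm_jacobian u z) (Y *m harm_jacobian u z) =
  (\sum_(j < m) Re (analytic_deriv u j z) ^+ 2) * (X 0 0 * Y 0 0) +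
  (\sum_(j < m) Im (analytic_deriv u j z) ^+ 2) * (X 0 1 * Y 0 1) -
  (\sum_(j < m) Re (analytic_deriv u j z) * Im (analytic_deriv u j z)) *
    (X 0 0 * Y 0 1 + X 0 1 * Y 0 0).
Proof.
rewrite /dot !mulr_suml -big_split -sumrB /=; apply: eq_bigr => j _.
by rewrite !harm_jacobianE !ReM /=; ring.
Qed.

Lemma sum_sqrC (w : 'I_m -> C) : \sum_(j < m) w j ^+ 2 =
  (\sum_(j < m) Re (w j) ^+ 2 - \sum_(j < m) Im (w j) ^+ 2) +i*
  (2 * \sum_(j < m) Re (w j) * Im (w j)).
Proof.
rewrite -sumrB mulr_sumr; apply: complex_eq => /=.
  rewrite (_ : Re _ = \sum_(j < m) Re (w j ^+ 2)); last exact: raddf_sum.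
  by apply: eq_bigr => j _; rewrite expr2 ReM.
rewrite (_ : Im _ = \sum_(j < m) Im (w j ^+ 2)); last exact: raddf_sum.
by apply: eq_bigr => j _; case: (w j) => a b /=; ring.
Qed.

Lemma dot2 X Y : dot X Y = X 0 0 * Y 0 0 + X 0 1 * Y 0 1.
Proof.
rewrite /dot !big_ord_recl big_ord0 addr0.
by rewrite (_ : lift ord0 ord0 = 1)//; exact: val_inj.
Qed.

(** The pulled back metric has diagonal entries A, B and off-diagonal entry -D, while the Hopf
    differential is (A - B) + 2iD; it vanishes exactly when the metric is scalar. *)
Lemma hopf_differential_similarity z : hopf_differential z = 0 <->
  exists c : R, forall X Y,
    dot (X *m harm_jacobian u z) (Y *m harm_jacobian u z) = c * dot X Y.
Proof.
rewrite /hopf_differential sum_sqrC.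
set A := \sum_(j < m) _; set B := \sum_(j < m) _; set D := \sum_(j < m) _.
split=> [[/eqP]|[c H]].
  rewrite subr_eq0 => /eqP AB /eqP; rewrite mulf_eq0 pnatr_eq0 /= => /eqP D0.
  exists A => X Y; rewrite dot_harm_jacobian -/A -/B -/D D0 -AB dot2; ring.
pose e0 : 'rV[R]_2 := \row_i if i == 0 then 1 else 0.
pose e1 : 'rV[R]_2 := \row_i if i == 0 then 0 else 1.
have := H e0 e0; have := H e1 e1; have := H e0 e1.
rewrite !dot_harm_jacobian -/A -/B -/D !dot2 !mxE /=.
by move=> h1 h2 h3; apply: complex_eq => /=; lra.
Qed.

End Conformality.

(** * Conformal factors and the equivalences *)

Section Equivalences.
Variables (R : realType) (m : nat) (u : R -> 'rV[R]_m).
Hypothesis u2 : L2circle u.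
Local Notation h := (harm_ext u).

Lemma diff_harm_ext (p X Y : 'rV[R]_2) : disc p ->
  differentiable h p /\ dot ('d h p X) ('d h p Y) =
  dot (X *m harm_jacobian u (complex_of p)) (Y *m harm_jacobian u (complex_of p)).
Proof. by move=> /modulus_disc/(harm_ext_diff u2)[dh ->]. Qed.

Lemma hopf_differential_disc :
  (forall z, modulus z < 1 -> hopf_differential u z = 0) <->
  (forall p : 'rV[R]_2, disc p -> exists c : R, forall X Y,
     dot ('d h p X) ('d h p Y) = c * dot X Y).
Proof.
split=> [H p dp|H z /disc_surj[p dp <-]].
  have /modulus_disc/H/hopf_differential_similarity[c Hc] := dp.
  by exists c => X Y; have [_ ->] := diff_harm_ext X Y dp.
have [c Hc] := H p dp; apply/hopf_differential_similarity; exists c => X Y.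
by have [_ <-] := diff_harm_ext X Y dp.
Qed.

Lemma similarity_factor_ge0 (p : 'rV[R]_2) (c : R) :
  (forall X Y, dot ('d h p X) ('d h p Y) = c * dot X Y) -> 0 <= c.
Proof.
pose e : 'rV[R]_2 := \row_i if i == 0 then 1 else 0.
move=> H; have := dot_ge0 ('d h p e); rewrite H.
by rewrite dot2 !mxE /= mulr1 mulr0 addr0 mulr1.
Qed.

(** A factor c is nonnegative, being a squared length. If positive it is e^(2 lambda) with lambda =
    ln(c)/2; c = 0 corresponds to lambda = -oo. *)
Lemma weakly_conformalP : weakly_conformal (@disc R) h <->
  (forall p : 'rV[R]_2, disc p -> exists c : R, forall X Y,
     dot ('d h p X) ('d h p Y) = c * dot X Y).
Proof.
split=> [H p dp|H p dp].
  have [_ [l lt Hl]] := H p dp; exists (fine (expeR (2%:E * l))) => X Y.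
  have := Hl X Y; case: l lt {Hl} => [l| |] //= _.
    by rewrite -EFinM => -[].
  by rewrite gt0_muleNy// mul0e mul0r => -[->].
have [dh _] := diff_harm_ext 0 0 dp; split => //.
have [c Hc] := H p dp; have c0 := similarity_factor_ge0 Hc.
have [c00|cn0] := eqVneq c 0.
  by exists -oo%E => // X Y; rewrite gt0_muleNy// mul0e Hc c00 mul0r.
have cp : 0 < c by rewrite lt_def cn0.
exists (ln c / 2)%:E => [|X Y]; first exact: ltry.
by rewrite -EFinM /= mulrCA mulfV// mulr1 lnK// Hc EFinM.
Qed.

(** A strictly positive factor makes the differential injective, since it sends nonzero vectors to
    vectors of nonzero length. Conversely a zero factor would annihilate the first basis vector. *)
Lemma conformalP : conformal (@disc R) h <->
  weakly_conformal (@disc R) h /\ immersed (@disc R) h.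
Proof.
split=> [H|[/weakly_conformalP H inj] p dp].
  split.
    apply/weakly_conformalP => p dp; have [_ [l Hl]] := H p dp.
    by exists (expR (2 * l)).
  move=> p dp X Y /= XY; have [_ [l Hl]] := H p dp.
  have := Hl (X - Y) (X - Y); rewrite linearB XY subrr.
  rewrite {1}/dot big1 => [/esym/eqP|j _]; last by rewrite mxE mul0r.
  rewrite mulf_eq0 gt_eqF ?expR_gt0//= dot2 -!expr2.
  rewrite paddr_eq0 ?sqr_ge0// !sqrf_eq0 !mxE !subr_eq0 => /andP[/eqP e0 /eqP e1].
  apply/rowP => i; case: (unliftP 0 i) => [i' ->|->//].
  by rewrite (_ : lift 0 i' = 1)//; apply: val_inj; rewrite /= (ord1 i').
have [dh _] := diff_harm_ext 0 0 dp; split => //.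
have [c Hc] := H p dp; have c0 := similarity_factor_ge0 Hc.
have cp : 0 < c.
  rewrite lt_def c0 andbT; apply/eqP => c00.
  pose e : 'rV[R]_2 := \row_i if i == 0 then 1 else 0.
  have := Hc e e; rewrite c00 mul0r => /eqP; rewrite psumr_eq0; last first.
    by move=> j _; rewrite -expr2 sqr_ge0.
  move=> /allP de; have /(inj p dp) : 'd h p e = 'd h p 0.
    rewrite linear0; apply/rowP => j; rewrite [RHS]mxE.
    by have := de j (mem_index_enum _); rewrite -expr2 sqrf_eq0 => /eqP.
  by move=> /rowP/(_ 0); rewrite !mxE /= => /eqP; rewrite oner_eq0.
exists (ln c / 2) => X Y.
by rewrite mulrCA mulfV// mulr1 lnK.
Qed.

End Equivalences.

Theorem theorem1p7 (R : realType) (m : nat) (hm : (1 <= m)%N)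
    (u : R -> 'rV[R]_m) (hu : H12 u) :
  [<-> half_stationary u;
       forall k : nat, (0 < k)%N ->
         \sum_(p : 'I_k.+1 * 'I_k.+1 |
                 [&& (0 < p.1)%N, (0 < p.2)%N & (p.1 + p.2 == k)%N])
           dot (p.1%:R *: fourier u p.1%:Z) (p.2%:R *: fourier u p.2%:Z) = 0;
       forall r t : R, 0 < r < 1 ->
         r^-1 * enorm (dtheta (harm_ext u) r t) =
         enorm (dradial (harm_ext u) r t);
       forall r t : R, 0 < r < 1 ->
         dot (dtheta (harm_ext u) r t) (dradial (harm_ext u) r t) = 0]
  /\ (half_stationary u <-> weakly_conformal (@disc R) (harm_ext u))
  /\ (conformal (@disc R) (harm_ext u) <->
      half_stationary u /\ immersed (@disc R) (harm_ext u)).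
Proof.
have [u2 _] := hu.
have SW : half_stationary u <-> weakly_conformal (@disc R) (harm_ext u).
  rewrite (half_stationary_hopf hu) hopf_differential_eq0// hopf_differential_disc//.
  by rewrite weakly_conformalP.
split; last by split => //; rewrite conformalP// SW.
tfae.
- by move=> /(half_stationary_hopf hu) H k k0; rewrite hopf_coef_pairs.
(* The hypothesis concerns k > 0 only; the coefficient of index 0 is zero in any case. *)
- move=> H; apply/(hopf_coef_enorm u2) => -[|k]; first by have [] := hopf_coef_small u.
  by rewrite -hopf_coef_pairs; exact: H.
- by move=> /(hopf_coef_enorm u2)/(hopf_coef_dot u2).
- by move=> /(hopf_coef_dot u2)/(half_stationary_hopf hu).
Qed.
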